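(* Under the nilpotent center condition $a_2^-=a_2^+$, $a_3^-=-a_3^+$, $b_2^-=-b_2^+<0$, $b_3^-=b_3^+$, the cubic switching Liénard system $$(\dot x,\dot y)=\begin{cases}\big(y-(a_2^+x^2+a_3^+x^3),\ -(b_2^+x^2+b_3^+x^3)\big), & x\ge 0,\\ \big(y-(a_2^-x^2+a_3^-x^3),\ -(b_2^-x^2+b_3^-x^3)\big), & x<0,\end{cases}$$ can have at least $5$ limit cycles bifurcating from the origin by higher-order cubic perturbations. That is, there exist real coefficients $a_2^{\pm},a_3^{\pm},b_2^{\pm},b_3^{\pm}$ satisfying $a_2^-=a_2^+$, $a_3^-=-a_3^+$, $b_2^-=-b_2^+<0$, $b_3^-=b_3^+$, and real perturbation parameters $d$, $\delta_k$ ($1\le k\le 6$), $p_{k2}^{\pm},p_{k3}^{\pm},q_{k2}^{\pm},q_{k3}^{\pm}$ ($1\le k\le 5$), such that for every neighborhood $U$ of the origin there is $\varepsilon_0>0$ such that for all $0<\varepsilon<\varepsilon_0$ the perturbed switching system $$(\dot x,\dot y)=\begin{cases}\Big(y-(a_2^+x^2+a_3^+x^3)+\sum_{k=1}^{6}\varepsilon^{k+1}\delta_k x+\sum_{k=1}^{5}\varepsilon^k(p_{k2}^+x^2+p_{k3}^+x^3),\\ \quad -\varepsilon^2x-(b_2^+x^2+b_3^+x^3)+\sum_{k=1}^{5}\varepsilon^k(q_{k2}^+x^2+q_{k3}^+x^3)\Big), & x\ge 0,\\[1ex] \Big(y-(a_2^-x^2+a_3^-x^3)+d\,\varepsilon^{9}+\sum_{k=1}^{6}\varepsilon^{k+1}\delta_k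 x+\sum_{k=1}^{5}\varepsilon^k(p_{k2}^-x^2+p_{k3}^-x^3),\\ \quad -\varepsilon^2x-(b_2^-x^2+b_3^-x^3)+\sum_{k=1}^{5}\varepsilon^k(q_{k2}^-x^2+q_{k3}^-x^3)\Big), & x<0,\end{cases}$$ has at least $5$ limit cycles contained in $U$.
   Context: The line $x=0$ is the switching manifold. Orbits of a switching system are obtained by concatenating orbit arcs of the vector field for $x\ge0$ and of the vector field for $x<0$ at points of $x=0$ where the two horizontal components have the same sign (crossing points); when $d\neq0$ the perturbed system also has a small sliding segment on $x=0$ near the origin. A limit cycle is a periodic orbit which is isolated among periodic orbits. A nilpotent center at the origin means that the origin is an isolated singular point at which the Jacobian matrix of each of the two systems is nonzero with both eigenvalues zero, and that all orbits near the origin, other than the origin itself, are periodic orbits surrounding it. The paper's ''higher-order cubic perturbations'' are those of the form displayed in the claim: the linear term $-\varepsilon^2x$ together with linear, quadratic and cubic terms in $x$ (and a constant term) with coefficients polynomial in the small parameter $\varepsilon>0$. *)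

(* Defs.v *)
From Stdlib Require Import Reals.
From Coquelicot Require Import Coquelicot.
Open Scope R_scope.

Record switching_system := SwitchingSystem {
  right_field : R * R -> R * R;
  left_field : R * R -> R * R }.

Inductive zone := RightZone | LeftZone.

Definition other_zone (z : zone) : zone :=
  match z with RightZone => LeftZone | LeftZone => RightZone end.

Definition in_zone (z : zone) (p : R * R) : Prop :=
  match z with RightZone => 0 <= fst p | LeftZone => fst p < 0 end.

Definition field (S : switching_system) (z : zone) : R * R -> R * R :=
  match z with RightZone => right_field S | LeftZone => left_field S end.

Definition crossing_point (S : switching_system) (p : R * R) : Prop :=
  fst p = 0 /\ 0 < fst (right_field S p) * fst (left_field S p).

Definition orbit_arc (S : switching_system) (z : zone) (gamma : R -> R * R)
    (a b : R) : Prop :=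
  forall t, a < t < b ->
    in_zone z (gamma t) /\
    is_derive (fun s => fst (gamma s)) t (fst (field S z (gamma t))) /\
    is_derive (fun s => snd (gamma s)) t (snd (field S z (gamma t))).

(* Concatenation of orbit arcs, expressed locally in time: around every instant
   the motion is either a single arc, or two arcs from different zones joined
   at a crossing point.  On a period, compactness turns this into a finite
   concatenation.  Motions along a sliding segment are not solutions here. *)
Definition solution (S : switching_system) (gamma : R -> R * R) : Prop :=
  forall t : R,
    continuous gamma t /\
    exists a b : R, a < t < b /\
      ((exists z, orbit_arc S z gamma a b) \/
       (crossing_point S (gamma t) /\
        exists z, orbit_arc S z gamma a t /\
                  orbit_arc S (other_zone z) gamma t b)).

(* Orbits are subsets of the plane, so that time translates of a solution give
   the same orbit; equilibria are not periodic orbits. *)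
Definition periodic_orbit (S : switching_system) (G : R * R -> Prop) : Prop :=
  exists (gamma : R -> R * R) (T : R),
    0 < T /\ solution S gamma /\
    (forall t, gamma (t + T) = gamma t) /\
    (exists t, gamma t <> gamma 0) /\
    (forall p, G p <-> exists t, gamma t = p).

Definition same_set (G H : R * R -> Prop) : Prop := forall p, G p <-> H p.

Definition limit_cycle (S : switching_system) (G : R * R -> Prop) : Prop :=
  periodic_orbit S G /\
  exists V : R * R -> Prop,
    open V /\ (forall p, G p -> V p) /\
    forall H, periodic_orbit S H -> (exists p, H p /\ V p) -> same_set H G.

Definition at_least_limit_cycles_in (n : nat) (S : switching_system)
    (U : R * R -> Prop) : Prop :=
  exists G : nat -> R * R -> Prop,
    (forall i, (i < n)%nat ->
       limit_cycle S (G i) /\ forall p, G i p -> U p) /\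
    (forall i j, (i < j < n)%nat -> ~ same_set (G i) (G j)).

(* One branch of the perturbed system; [c] is the constant term of the
   horizontal component. *)
Definition perturbed_field (a2 a3 b2 b3 c : R)
    (delta p2 p3 q2 q3 : nat -> R) (eps : R) (p : R * R) : R * R :=
  let (x, y) := p in
  (y - (a2 * x ^ 2 + a3 * x ^ 3) + c
     + sum_f 1 6 (fun k => eps ^ (k + 1) * delta k * x)
     + sum_f 1 5 (fun k => eps ^ k * (p2 k * x ^ 2 + p3 k * x ^ 3)),
   - eps ^ 2 * x - (b2 * x ^ 2 + b3 * x ^ 3)
     + sum_f 1 5 (fun k => eps ^ k * (q2 k * x ^ 2 + q3 k * x ^ 3))).

(* Main.v *)
Require Import Defs.
From Stdlib Require Import Reals Lra Lia Psatz Arith ClassicalEpsilon.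
From Coquelicot Require Import Coquelicot.
Open Scope R_scope.

(** The idea. Put x = eps^2 X, y = eps^3 Y, measure time in units of 1/eps, and write
    mu = eps^3. After the reflection X -> -X with time reversed on the left,
    each half-plane carries a Lienard system on X >= 0,

      X' = Y - F(X),   Y' = - (X + k X^2 + l X^3),

    where k = b_2^+ > 0 is a small constant, l = mu on the right and l = 0 on
    the left ([right_side], [left_side]).  The two F share the term
    mu (al X^2 + be X^3), which alone would give a center, and otherwise are of
    order mu^2.

    Let G be the potential of the restoring force and u = sqrt (2 G) the
    amplitude.  In the coordinates u = r sin, Y = r cos, with the cosine c as
    independent variable, an orbit solves dr/dc = r f(u) / (r - c f(u)), where
    f(u) is F at the point of amplitude u ([slope]).  This equation is regular
    up to the switching line c = 1, c = -1.  A periodic orbit around the origin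
    is a value r0 at c = 1 from which the two half-orbits reach c = -1 with the
    same r.

    The amplitude differs between the sides by the l-term, so the shared part
    of F contributes to the difference of the two f at order mu^2, with the
    powers u^4 and u^5; d, delta_6 and the asymmetric p's contribute the powers
    0 to 3.  Hence f_+ - f_- = mu^2 (psi(u) + O(k)) with an
    arbitrary quintic psi ([udrag_expansion], [udrag'_expansion]), and the displacement is
    mu^2 (M(r0) + O(k)), where M(r) is the integral of psi(r sqrt(1 - c^2))
    ([displacement_approx]).  As the moments of sqrt(1 - c^2) do not vanish, M
    can be made (r - 1)...(r - 5) ([choose_coefficients]).  For k, then mu, small
    enough the displacement has a zero near each of 1, ..., 5, and there the
    total exponents, the integrals of d(slope)/dr, of the two half-orbits differ
    because M' is not small ([exponent_approx], [five_zeros]).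

    It remains to see that such a zero gives a limit cycle.  Let R be the closed
    curve made of the two half-orbits.  The function (r - R(c)) exp(-E(c)), where
    E is the running exponent corrected so as to be continuous on the whole turn,
    is strictly monotone along every motion close to R but off R ([arc_level]).
    A periodic function cannot cross a level in one direction only, so a periodic
    orbit that comes close to R lies on R ([level_zero_everywhere]); it covers
    R, because otherwise the phase along R would be a strictly increasing
    periodic function ([curve_covered]).  A motion that runs along R is obtained
    by inverting time as a function of the angle ([half_path]). *)

(** * Continuity and monotonicity on the line *)

Lemma cont_const (T : UniformSpace) (k : R) (x : T) : continuous (fun _ : T => k) x.
Proof. apply continuous_const. Qed.

Lemma cont_plus (T : UniformSpace) (f g : T -> R) (x : T) :
  continuous f x -> continuous g x -> continuous (fun y => f y + g y) x.
Proof. intros hf hg. exact (continuous_plus f g x hf hg). Qed.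

Lemma cont_opp (T : UniformSpace) (f : T -> R) (x : T) :
  continuous f x -> continuous (fun y => - f y) x.
Proof. intros hf. exact (continuous_opp f x hf). Qed.

Lemma cont_minus (T : UniformSpace) (f g : T -> R) (x : T) :
  continuous f x -> continuous g x -> continuous (fun y => f y - g y) x.
Proof. intros hf hg. exact (continuous_minus f g x hf hg). Qed.

Lemma cont_mult (T : UniformSpace) (f g : T -> R) (x : T) :
  continuous f x -> continuous g x -> continuous (fun y => f y * g y) x.
Proof. intros hf hg. exact (continuous_mult f g x hf hg). Qed.

Lemma cont_comp (T : UniformSpace) (h : R -> R) (f : T -> R) (x : T) :
  continuous f x -> continuous h (f x) -> continuous (fun y => h (f y)) x.
Proof. intros hf hh. exact (continuous_comp f h x hf hh). Qed.

Lemma cont_pow (T : UniformSpace) (f : T -> R) (n : nat) (x : T) :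
  continuous f x -> continuous (fun y => f y ^ n) x.
Proof.
  intros hf; induction n as [|n IH]; simpl; [apply cont_const|].
  now apply cont_mult.
Qed.

Lemma cont_inv (T : UniformSpace) (f : T -> R) (x : T) :
  continuous f x -> f x <> 0 -> continuous (fun y => / f y) x.
Proof.
  intros hf h0. apply (cont_comp T Rinv f x hf).
  apply continuity_pt_filterlim.
  apply (continuity_pt_inv (fun y => y)); [apply derivable_continuous_pt, derivable_pt_id | exact h0].
Qed.

Lemma cont_div (T : UniformSpace) (f g : T -> R) (x : T) :
  continuous f x -> continuous g x -> g x <> 0 -> continuous (fun y => f y / g y) x.
Proof. intros; apply cont_mult; [assumption | now apply cont_inv]. Qed.

Lemma cont_sqrt (T : UniformSpace) (f : T -> R) (x : T) :
  continuous f x -> continuous (fun y => sqrt (f y)) x.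
Proof. intros hf. apply (cont_comp T sqrt f x hf), continuous_sqrt. Qed.

Lemma cont_exp (T : UniformSpace) (f : T -> R) (x : T) :
  continuous f x -> continuous (fun y => exp (f y)) x.
Proof. intros hf. apply (cont_comp T exp f x hf), continuous_exp. Qed.

Lemma cont_abs (T : UniformSpace) (f : T -> R) (x : T) :
  continuous f x -> continuous (fun y => Rabs (f y)) x.
Proof.
  intros hf. apply (cont_comp T Rabs f x hf), continuity_pt_filterlim, Rcontinuity_abs.
Qed.

Lemma cont_max (T : UniformSpace) (f g : T -> R) (x : T) :
  continuous f x -> continuous g x -> continuous (fun y => Rmax (f y) (g y)) x.
Proof.
  intros hf hg.
  apply (continuous_ext (fun y => (f y + g y + Rabs (f y - g y)) * / 2)).
  { intros y; unfold Rmax, Rabs; destruct (Rle_dec _ _), (Rcase_abs _); lra. }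
  apply cont_mult; [apply cont_plus; [now apply cont_plus | now apply cont_abs, cont_minus] | apply cont_const].
Qed.

Lemma cont_min (T : UniformSpace) (f g : T -> R) (x : T) :
  continuous f x -> continuous g x -> continuous (fun y => Rmin (f y) (g y)) x.
Proof.
  intros hf hg.
  apply (continuous_ext (fun y => (f y + g y - Rabs (f y - g y)) * / 2)).
  { intros y; unfold Rmin, Rabs; destruct (Rle_dec _ _), (Rcase_abs _); lra. }
  apply cont_mult; [apply cont_minus; [now apply cont_plus | now apply cont_abs, cont_minus] | apply cont_const].
Qed.

Lemma cont_id (x : R) : continuous (fun y : R => y) x.
Proof. apply continuous_id. Qed.

Lemma cont_fst (p : R * R) : continuous (fun q : R * R => fst q) p.
Proof. destruct p; apply continuous_fst. Qed.

Lemma cont_snd (p : R * R) : continuous (fun q : R * R => snd q) p.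
Proof. destruct p; apply continuous_snd. Qed.

Ltac cont :=
  repeat match goal with
  | h : continuous _ _ |- continuous _ _ => exact h
  | |- continuous (fun _ => ?k) _ => apply cont_const
  | |- continuous (fun x => x) _ => apply cont_id
  | |- continuous (fun x => fst x) _ => apply cont_fst
  | |- continuous (fun x => snd x) _ => apply cont_snd
  | |- continuous (fun x => @?f x / @?g x) _ => apply (cont_div _ f g)
  | |- continuous (fun x => / @?f x) _ => apply (cont_inv _ f)
  | |- continuous (fun x => @?f x - @?g x) _ => apply (cont_minus _ f g)
  | |- continuous (fun x => @?f x + @?g x) _ => apply (cont_plus _ f g)
  | |- continuous (fun x => @?f x * @?g x) _ => apply (cont_mult _ f g)
  | |- continuous (fun x => - @?f x) _ => apply (cont_opp _ f)
  | |- continuous (fun x => @?f x ^ ?n) _ => apply (cont_pow _ f n)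
  | |- continuous (fun x => sqrt (@?f x)) _ => apply (cont_sqrt _ f)
  | |- continuous (fun x => exp (@?f x)) _ => apply (cont_exp _ f)
  | |- continuous (fun x => Rabs (@?f x)) _ => apply (cont_abs _ f)
  | |- continuous (fun x => Rmax (@?f x) (@?g x)) _ => apply (cont_max _ f g)
  | |- continuous (fun x => Rmin (@?f x) (@?g x)) _ => apply (cont_min _ f g)
  end.

Lemma cont_eps (f : R -> R) (x : R) :
  continuous f x <->
  forall e, 0 < e -> exists d, 0 < d /\ forall y, Rabs (y - x) < d -> Rabs (f y - f x) < e.
Proof.
  split.
  - intros hf e he.
    destruct (hf (fun z => Rabs (z - f x) < e)) as [d hd].
    { exists (mkposreal e he). intros z hz; exact hz. }
    exists d; split; [apply cond_pos|]. intros y hy; apply (hd y hy).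
  - intros h P [e he].
    destruct (h e (cond_pos e)) as [d [hd hy]].
    exists (mkposreal d hd). intros y hyd. apply he. apply (hy y hyd).
Qed.

Lemma cont_pt (f : R -> R) (x : R) : continuous f x -> continuity_pt f x.
Proof. intros h; now apply continuity_pt_filterlim. Qed.

Lemma is_derive_cont (f : R -> R) (x l : R) : is_derive f x l -> continuous f x.
Proof. intros h. exact (ex_derive_continuous f x (ex_intro _ l h)). Qed.

Lemma is_derive_eq (f : R -> R) (x l l' : R) : is_derive f x l -> l = l' -> is_derive f x l'.
Proof. now intros h <-. Qed.

Lemma derive_ext_loc (f g : R -> R) (x l : R) :
  locally x (fun t => f t = g t) -> is_derive f x l -> is_derive g x l.
Proof. exact (is_derive_ext_loc f g x l). Qed.

Lemma derive_comp (f g : R -> R) (x df dg : R) :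
  is_derive f (g x) df -> is_derive g x dg -> is_derive (fun y => f (g y)) x (dg * df).
Proof. exact (is_derive_comp f g x df dg). Qed.

Lemma mean_value (f df : R -> R) (a b : R) :
  a < b -> (forall x, a < x < b -> is_derive f x (df x)) ->
  (forall x, a <= x <= b -> continuous f x) ->
  exists c, a < c < b /\ f b - f a = df c * (b - a).
Proof.
  intros hab hd hc.
  assert (pr : forall c, a < c < b -> derivable_pt f c).
  { intros c h; exists (df c); apply is_derive_Reals, hd, h. }
  destruct (MVT f id a b pr (fun c _ => derivable_pt_id c) hab) as [c [P e]].
  - intros c h; apply cont_pt, hc, h.
  - intros c h; apply derivable_continuous_pt, derivable_pt_id.
  - exists c; split; [exact P|].
    rewrite (derive_pt_eq_0 f c (df c) (pr c P)) in e by apply is_derive_Reals, hd, P.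
    rewrite (derive_pt_eq_0 id c 1) in e by apply derivable_pt_lim_id.
    unfold id in e; lra.
Qed.


(** * Periodic functions *)

Definition rising (f : R -> R) (t : R) : Prop :=
  exists d, 0 < d /\ (forall s, t - d < s < t -> f s < f t) /\
                     (forall s, t < s < t + d -> f t < f s).

(** Continuity is not assumed, which allows a phase that is defined by cases.
    The supremum of the points up to which [f] stays above [f a] cannot be less
    than [b], since [f] rises through it. *)
Lemma rising_increasing (f : R -> R) :
  (forall t, rising f t) -> forall a b, a < b -> f a < f b.
Proof.
  intros hr a b hab.
  set (E := fun t => a < t <= b /\ forall s, a < s <= t -> f a < f s).
  destruct (completeness E) as [m [hub hlub]].
  { exists b; intros t [h _]; lra. }
  { destruct (hr a) as [d [hd [_ h]]].
    exists (Rmin b (a + d / 2)).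
    assert (Rmin b (a + d / 2) <= a + d / 2) by apply Rmin_r.
    repeat split.
    - apply Rmin_glb_lt; lra.
    - apply Rmin_l.
    - intros s hs; apply h; lra. }
  assert (hE : forall s, a < s < m -> f a < f s).
  { intros s hs. apply Rnot_le_lt; intros hle.
    assert (m <= s); [|lra]. apply hlub. intros t [ht hlt].
    apply Rnot_lt_le; intros hst. specialize (hlt s ltac:(lra)); lra. }
  assert (ham : a < m).
  { destruct (hr a) as [d [hd [_ h]]].
    apply Rlt_le_trans with (Rmin b (a + d / 2)); [apply Rmin_glb_lt; lra|].
    apply hub. assert (Rmin b (a + d / 2) <= a + d / 2) by apply Rmin_r.
    repeat split.
    - apply Rmin_glb_lt; lra.
    - apply Rmin_l.
    - intros s hs; apply h; lra. }
  assert (hmb : m <= b) by (apply hlub; intros t [h _]; lra).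
  assert (hm : f a < f m).
  { destruct (hr m) as [d [hd [h _]]].
    set (s := Rmax ((a + m) / 2) (m - d / 2)).
    assert (s < m) by (apply Rmax_lub_lt; lra).
    assert ((a + m) / 2 <= s) by apply Rmax_l.
    assert (m - d / 2 <= s) by apply Rmax_r.
    apply Rlt_trans with (f s); [apply hE; lra | apply h; lra]. }
  destruct (Req_dec m b) as [->|hne]; [exact hm|exfalso].
  destruct (hr m) as [d [hd [_ h]]].
  assert (Rmin b (m + d / 2) <= m + d / 2) by apply Rmin_r.
  assert (m < Rmin b (m + d / 2)) by (apply Rmin_glb_lt; lra).
  assert (Rmin b (m + d / 2) <= m); [|lra].
  apply hub. repeat split; [lra | apply Rmin_l |].
  intros s hs. destruct (Rlt_dec s m); [apply hE; lra|].
  destruct (Req_dec s m) as [->|]; [exact hm|].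
  apply Rlt_trans with (f m); [exact hm | apply h; lra].
Qed.

Lemma rising_not_periodic (f : R -> R) (T : R) :
  0 < T -> (forall t, f (t + T) = f t) -> (forall t, rising f t) -> False.
Proof.
  intros hT hp hr. pose proof (rising_increasing f hr 0 (0 + T) ltac:(lra)) as h.
  rewrite hp in h; lra.
Qed.

(** Just after [t0] the function is above the level [f t0], and just before
    [t0 + T] it is below; the end of the first interval above the level would be
    a crossing in the wrong direction. *)
Lemma periodic_no_upcrossing (f : R -> R) (T t0 : R) :
  0 < T -> (forall t, continuous f t) -> (forall t, f (t + T) = f t) ->
  (forall t, f t = f t0 -> rising f t) -> False.
Proof.
  intros hT hc hp hr.
  set (E := fun t => t0 < t <= t0 + T /\ forall s, t0 < s <= t -> f t0 < f s).
  destruct (hr t0 eq_refl) as [d [hd [_ h]]].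
  assert (h0 : E (Rmin (t0 + T) (t0 + d / 2))).
  { assert (Rmin (t0 + T) (t0 + d / 2) <= t0 + d / 2) by apply Rmin_r.
    repeat split.
    - apply Rmin_glb_lt; lra.
    - apply Rmin_l.
    - intros s hs; apply h; lra. }
  destruct (completeness E) as [m [hub hlub]].
  { exists (t0 + T); intros t [h' _]; lra. }
  { eexists; exact h0. }
  assert (hE : forall s, t0 < s < m -> f t0 < f s).
  { intros s hs. apply Rnot_le_lt; intros hle.
    assert (m <= s); [|lra]. apply hlub. intros t [ht hlt].
    apply Rnot_lt_le; intros hst. specialize (hlt s ltac:(lra)); lra. }
  assert (ham : t0 < m) by (pose proof (hub _ h0); destruct h0; lra).
  assert (hmb : m <= t0 + T) by (apply hlub; intros t [h' _]; lra).
  assert (hm : f t0 < f m).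
  { destruct (Rtotal_order (f t0) (f m)) as [hlt|[heq|hgt]]; [exact hlt| |]; exfalso.
    - destruct (hr m (eq_sym heq)) as [e [he [hl _]]].
      set (s := Rmax ((t0 + m) / 2) (m - e / 2)).
      assert (s < m) by (apply Rmax_lub_lt; lra).
      assert ((t0 + m) / 2 <= s) by apply Rmax_l.
      assert (m - e / 2 <= s) by apply Rmax_r.
      specialize (hE s ltac:(lra)); specialize (hl s ltac:(lra)); lra.
    - destruct (proj1 (cont_eps f m) (hc m) (f t0 - f m) ltac:(lra)) as [e [he hl]].
      set (s := Rmax ((t0 + m) / 2) (m - e / 2)).
      assert (s < m) by (apply Rmax_lub_lt; lra).
      assert ((t0 + m) / 2 <= s) by apply Rmax_l.
      assert (m - e / 2 <= s) by apply Rmax_r.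
      specialize (hE s ltac:(lra)).
      specialize (hl s). rewrite Rabs_left in hl by lra. specialize (hl ltac:(lra)).
      apply Rabs_def2 in hl; lra. }
  assert (hne : m <> t0 + T) by (intros ->; rewrite hp in hm; lra).
  destruct (proj1 (cont_eps f m) (hc m) (f m - f t0) ltac:(lra)) as [e [he hl]].
  assert (Rmin (t0 + T) (m + e / 2) <= m + e / 2) by apply Rmin_r.
  assert (m < Rmin (t0 + T) (m + e / 2)) by (apply Rmin_glb_lt; lra).
  assert (Rmin (t0 + T) (m + e / 2) <= m); [|lra].
  apply hub. repeat split; [lra | apply Rmin_l |].
  intros s hs. destruct (Rlt_dec s m); [apply hE; lra|].
  assert (hsm : Rabs (s - m) < e) by (rewrite Rabs_pos_eq; lra).
  specialize (hl s hsm). apply Rabs_def2 in hl; lra.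
Qed.


(** * Inverse functions *)

Lemma expanding (U k : R -> R) (c : R) :
  (forall x, is_derive U x (k x)) -> (forall x, c <= k x) ->
  forall x y, x <= y -> c * (y - x) <= U y - U x.
Proof.
  intros hU hk x y [hxy| ->]; [|lra].
  destruct (mean_value U k x y hxy (fun z _ => hU z)
              (fun z _ => is_derive_cont _ _ _ (hU z))) as [z [_ ->]].
  apply Rmult_le_compat_r; [lra | apply hk].
Qed.

(** The lower bound of the derivative makes [U] onto and its inverse Lipschitz,
    so that difference quotients of the inverse are inverses of difference
    quotients of [U]. *)
Lemma inverse_function (U k : R -> R) (c : R) :
  0 < c -> (forall x, is_derive U x (k x)) -> (forall x, c <= k x) ->
  exists chi : R -> R,
    (forall u, U (chi u) = u) /\ (forall x, chi (U x) = x) /\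
    (forall u, is_derive chi u (/ k (chi u))).
Proof.
  intros hc hU hk.
  pose proof (expanding U k c hU hk) as hex.
  assert (hcont : continuity U) by (intros x; apply cont_pt, is_derive_cont with (1 := hU x)).
  assert (hs : forall u, {x | U x = u}).
  (* [U] takes the value [u] between [- m] and [m], as it grows at least at the rate [c] away from 0. *)
  { intros u. set (m := (Rabs u + Rabs (U 0)) / c).
    assert (hm : c * m = Rabs u + Rabs (U 0)) by (unfold m; field; lra).
    pose proof (Rabs_pos u); pose proof (Rabs_pos (U 0)).
    assert (0 <= m) by (unfold m; apply Rdiv_le_0_compat; lra).
    pose proof (Rle_abs u); pose proof (Rle_abs (U 0)).
    pose proof (Rle_abs (- u)); pose proof (Rle_abs (- U 0)).
    rewrite !Rabs_Ropp in *.
    pose proof (hex 0 m ltac:(lra)); pose proof (hex (- m) 0 ltac:(lra)).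
    destruct (IVT_gen U (- m) m u hcont) as [x [_ hx]].
    - rewrite Rmin_left, Rmax_right by nra. nra.
    - now exists x. }
  set (chi := fun u => proj1_sig (hs u)).
  assert (h1 : forall u, U (chi u) = u) by (intros u; exact (proj2_sig (hs u))).
  assert (hinj : forall x y, Rabs (x - y) <= Rabs (U x - U y) / c).
  { intros x y. apply Rmult_le_reg_l with c; [exact hc|].
    replace (c * (Rabs (U x - U y) / c)) with (Rabs (U x - U y)) by (field; lra).
    destruct (Rle_dec x y).
    - pose proof (hex x y r).
      rewrite Rabs_minus_sym, (Rabs_minus_sym (U x)).
      rewrite (Rabs_pos_eq (y - x)) by lra. rewrite Rabs_pos_eq; nra.
    - pose proof (hex y x ltac:(lra)).
      rewrite (Rabs_pos_eq (x - y)) by lra. rewrite Rabs_pos_eq; nra. }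
  assert (h2 : forall x, chi (U x) = x).
  { intros x. pose proof (hinj (chi (U x)) x) as h. rewrite h1 in h.
    replace (U x - U x) with 0 in h by ring. rewrite Rabs_R0 in h.
    unfold Rdiv in h; rewrite Rmult_0_l in h.
    pose proof (Rabs_pos (chi (U x) - x)).
    assert (Rabs (chi (U x) - x) = 0) by lra.
    destruct (Req_dec (chi (U x) - x) 0) as [|hn]; [lra|].
    apply Rabs_no_R0 in hn; lra. }
  exists chi; split; [exact h1 | split; [exact h2 |]].
  intros u. apply is_derive_Reals. intros e he.
  set (x := chi u).
  pose proof (hk x) as hkx.
  assert (hec : 0 < e * (c * c)) by (apply Rmult_lt_0_compat; [exact he | nra]).
  destruct (proj1 (is_derive_Reals _ _ _) (hU x) _ hec) as [d hd].
  assert (hdc : 0 < d * c) by (apply Rmult_lt_0_compat; [apply cond_pos | exact hc]).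
  exists (mkposreal _ hdc). simpl. intros h hn hh.
  set (y := chi (u + h)).
  assert (hUx : U x = u) by apply h1. assert (hUy : U y = u + h) by apply h1.
  assert (hyx : y - x <> 0).
  { intros he0. replace y with x in hUy by lra. lra. }
  pose proof (hinj y x) as hyxl. rewrite hUx, hUy in hyxl.
  replace (u + h - u) with h in hyxl by ring.
  assert (hlt : Rabs (y - x) < d).
  { apply Rle_lt_trans with (1 := hyxl). apply Rmult_lt_reg_r with c; [exact hc|].
    replace (Rabs h / c * c) with (Rabs h) by (field; lra). exact hh. }
  specialize (hd (y - x) hyx hlt).
  replace (x + (y - x)) with y in hd by ring.
  set (q := (U y - U x) / (y - x)) in *.
  assert (hq : c <= q).
  { unfold q. destruct (Rle_dec x y).
    - pose proof (hex x y r). apply Rmult_le_reg_r with (y - x); [lra|].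
      replace ((U y - U x) / (y - x) * (y - x)) with (U y - U x) by (field; lra). lra.
    - pose proof (hex y x ltac:(lra)). apply Rmult_le_reg_r with (x - y); [lra|].
      replace ((U y - U x) / (y - x) * (x - y)) with (U x - U y) by (field; lra). lra. }
  replace ((y - x) / h) with (/ q)
    by (unfold q; rewrite hUx, hUy; field; repeat split; lra).
  replace (/ q - / k x) with (- (q - k x) / (q * k x)) by (field; lra).
  unfold Rdiv. rewrite Rabs_mult, Rabs_Ropp, Rabs_inv, (Rabs_pos_eq (q * k x)) by nra.
  apply Rmult_lt_reg_r with (q * k x); [nra|].
  rewrite Rmult_assoc, Rinv_l, Rmult_1_r by nra.
  apply Rlt_le_trans with (1 := hd).
  apply Rmult_le_compat_l; [lra|]. apply Rmult_le_compat; lra.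
Qed.


(** * Integrals and the scalar initial value problem *)

Lemma ex_RInt_cont (f : R -> R) (a b : R) : (forall x, continuous f x) -> ex_RInt f a b.
Proof. intros h. apply (ex_RInt_continuous f a b). intros z _; apply h. Qed.

Lemma derive_RInt (f : R -> R) (a x : R) :
  (forall y, continuous f y) -> is_derive (fun y => RInt f a y) x (f x).
Proof.
  intros h. apply (is_derive_RInt f (fun y => RInt f a y) a x).
  - apply filter_forall. intros y. exact (RInt_correct f a y (ex_RInt_cont f a y h)).
  - apply h.
Qed.

Lemma cont_RInt (f : R -> R) (a x : R) :
  (forall y, continuous f y) -> continuous (fun y => RInt f a y) x.
Proof. intros h. exact (is_derive_cont _ _ _ (derive_RInt f a x h)). Qed.

Lemma RInt_bound (f : R -> R) (M c : R) :
  (forall x, continuous f x) -> (forall x, -1 <= x <= 1 -> Rabs (f x) <= M) ->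
  -1 <= c <= 1 -> Rabs (RInt f 1 c) <= 2 * M.
Proof.
  intros hf hM hc.
  assert (0 <= M) by (apply Rle_trans with (2 := hM 1 ltac:(lra)), Rabs_pos).
  rewrite <- (opp_RInt_swap f c 1) by apply ex_RInt_cont, hf.
  change (Rabs (- RInt f c 1) <= 2 * M). rewrite Rabs_Ropp.
  apply Rle_trans with ((1 - c) * M); [|nra].
  apply abs_RInt_le_const; [lra | apply ex_RInt_cont, hf |].
  intros t ht; apply hM; lra.
Qed.

Lemma RInt_sub (f g : R -> R) (a b : R) :
  (forall x, continuous f x) -> (forall x, continuous g x) ->
  RInt f a b - RInt g a b = RInt (fun x => f x - g x) a b.
Proof.
  intros hf hg. symmetry.
  apply (RInt_minus f g a b); now apply ex_RInt_cont.
Qed.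

Lemma RInt_diff_bound (f g : R -> R) (M c : R) :
  (forall x, continuous f x) -> (forall x, continuous g x) ->
  (forall x, -1 <= x <= 1 -> Rabs (f x - g x) <= M) ->
  -1 <= c <= 1 -> Rabs (RInt f 1 c - RInt g 1 c) <= 2 * M.
Proof.
  intros hf hg hM hc. rewrite RInt_sub by assumption.
  apply RInt_bound; [intros x; apply cont_minus; auto | exact hM | exact hc].
Qed.

Lemma add_sub_cancel (a b : R) : a + b - a = b.
Proof. ring. Qed.

Lemma add_sub_add (a b c : R) : a + b - (a + c) = b - c.
Proof. ring. Qed.

(** For a difference [g] of solutions of an integral equation: the right-hand
    side feeds back at most half of the maximum of [g]. *)
Lemma absorb_half (g : R -> R) (A : R) :
  (forall c, continuous g c) ->
  (forall m, (forall c, -1 <= c <= 1 -> Rabs (g c) <= m) ->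
     forall c, -1 <= c <= 1 -> Rabs (g c) <= A + m / 2) ->
  forall c, -1 <= c <= 1 -> Rabs (g c) <= 2 * A.
Proof.
  intros hg h.
  destruct (continuity_ab_maj (fun c => Rabs (g c)) (-1) 1 ltac:(lra)) as [x [hx hx1]].
  { intros c _; apply cont_pt, cont_abs, hg. }
  pose proof (h _ hx x hx1). intros c hc; specialize (hx c hc). lra.
Qed.

Definition clamp (a b x : R) : R := Rmax a (Rmin b x).

Lemma clamp_bounds a b x : a <= b -> a <= clamp a b x <= b.
Proof.
  intros h; unfold clamp; split; [apply Rmax_l | apply Rmax_lub; [exact h | apply Rmin_l]].
Qed.

Lemma clamp_id a b x : a <= x <= b -> clamp a b x = x.
Proof. intros h; unfold clamp. rewrite Rmin_right, Rmax_right; lra. Qed.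

Lemma clamp_lip a b x y : Rabs (clamp a b x - clamp a b y) <= Rabs (x - y).
Proof.
  unfold clamp, Rmax, Rmin; repeat destruct (Rle_dec _ _);
  unfold Rabs; repeat destruct (Rcase_abs _); lra.
Qed.

Lemma cont_clamp (T : UniformSpace) (a b : R) (f : T -> R) (x : T) :
  continuous f x -> continuous (fun y => clamp a b (f y)) x.
Proof. intros h; unfold clamp; cont. Qed.

Section Picard.
Variables (S : R -> R -> R) (B L r0 : R).
Hypothesis S_cont : forall g : R -> R, (forall c, continuous g c) ->
  forall c, continuous (fun x => S x (g x)) c.
Hypothesis S_bound : forall c r, -1 <= c <= 1 -> Rabs (S c r) <= B.
Hypothesis S_lip : forall c r r', -1 <= c <= 1 -> Rabs (S c r - S c r') <= L * Rabs (r - r').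
Hypothesis L_small : 0 <= L <= / 4.

Fixpoint picard_iter (n : nat) : R -> R :=
  match n with
  | O => fun _ => r0
  | Datatypes.S n => fun c => r0 + RInt (fun x => S x (picard_iter n x)) 1 (clamp (-1) 1 c)
  end.

Lemma picard_iter_cont n c : continuous (picard_iter n) c.
Proof.
  revert c; induction n as [|n IH]; intros c; simpl; [cont|].
  apply cont_plus; [cont|].
  apply (cont_comp _ (fun y => RInt (fun x => S x (picard_iter n x)) 1 y)).
  - apply cont_clamp; cont.
  - apply cont_RInt, S_cont, IH.
Qed.

Lemma picard_iter_step n c :
  Rabs (picard_iter (Datatypes.S n) c - picard_iter n c) <= 2 * B * (/ 2) ^ n.
Proof.
  revert c; induction n as [|n IH]; intros c.
  - simpl. rewrite add_sub_cancel.
    rewrite Rmult_1_r. apply RInt_bound.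
    + apply (S_cont (fun _ => r0)). intros; cont.
    + intros x hx; now apply S_bound.
    + apply clamp_bounds; lra.
  - change (picard_iter (Datatypes.S (Datatypes.S n)) c)
      with (r0 + RInt (fun x => S x (picard_iter (Datatypes.S n) x)) 1 (clamp (-1) 1 c)).
    change (picard_iter (Datatypes.S n) c)
      with (r0 + RInt (fun x => S x (picard_iter n x)) 1 (clamp (-1) 1 c)).
    rewrite add_sub_add.
    eapply Rle_trans; [apply RInt_diff_bound with (M := / 4 * (2 * B * (/ 2) ^ n))|].
    + apply S_cont, picard_iter_cont.
    + apply S_cont, picard_iter_cont.
    + intros x hx. eapply Rle_trans; [apply S_lip, hx|].
      apply Rmult_le_compat; [lra | apply Rabs_pos | lra | apply IH].
    + apply clamp_bounds; lra.
    + simpl; lra.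
Qed.

Let B_pos : 0 <= B.
Proof. apply Rle_trans with (2 := S_bound 0 0 ltac:(lra)), Rabs_pos. Qed.

Lemma picard_iter_cauchy n k c :
  Rabs (picard_iter (n + k) c - picard_iter n c) <= 4 * B * (/ 2) ^ n * (1 - (/ 2) ^ k).
Proof.
  induction k as [|k IH].
  - rewrite Nat.add_0_r. replace (_ - _) with 0 by ring. rewrite Rabs_R0; simpl; lra.
  - rewrite Nat.add_succ_r.
    replace (picard_iter (Datatypes.S (n + k)) c - picard_iter n c) with
      ((picard_iter (Datatypes.S (n + k)) c - picard_iter (n + k) c)
       + (picard_iter (n + k) c - picard_iter n c)) by ring.
    eapply Rle_trans; [apply Rabs_triang|].
    pose proof (picard_iter_step (n + k) c) as h. rewrite pow_add in h.
    change ((/ 2) ^ Datatypes.S k) with (/ 2 * (/ 2) ^ k). lra.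
Qed.

Lemma half_pow_pos n : 0 < (/ 2) ^ n.
Proof. apply pow_lt; lra. Qed.

Lemma half_pow_small e : 0 < e -> exists n, 4 * B * (/ 2) ^ n < e.
Proof.
  intros he. destruct (pow_lt_1_zero (/ 2)) with (y := e / (4 * B + 1)) as [n hn].
  - rewrite Rabs_pos_eq; lra.
  - apply Rdiv_lt_0_compat; lra.
  - exists n. specialize (hn n (Nat.le_refl n)).
    rewrite Rabs_pos_eq in hn by apply Rlt_le, half_pow_pos.
    apply Rle_lt_trans with ((4 * B + 1) * (/ 2) ^ n);
      [pose proof (half_pow_pos n); nra|].
    apply (Rmult_lt_compat_l (4 * B + 1)) in hn; [|lra].
    replace ((4 * B + 1) * (e / (4 * B + 1))) with e in hn by (field; lra). exact hn.
Qed.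

(** On an interval of length 2 the Lipschitz constant 1/4 makes the integral
    operator contract by one half in the supremum norm. *)
Lemma picard : exists r : R -> R,
  (forall c, continuous r c) /\
  forall c, -1 <= c <= 1 -> r c = r0 + RInt (fun x => S x (r x)) 1 c.
Proof.
  assert (hl : forall c, exists l, is_lim_seq (fun n => picard_iter n c) (Finite l)).
  { intros c. assert (hx : ex_finite_lim_seq (fun n => picard_iter n c)); [|exact hx].
    apply ex_lim_seq_cauchy_corr. intros e.
    destruct (half_pow_small (e / 2)) as [N hN]; [pose proof (cond_pos e); lra|].
    exists N. intros n m hn hm.
    replace n with (N + (n - N))%nat by lia. replace m with (N + (m - N))%nat by lia.
    pose proof (picard_iter_cauchy N (n - N) c) as h1.
    pose proof (picard_iter_cauchy N (m - N) c) as h2.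
    pose proof (half_pow_pos N); pose proof (half_pow_pos (n - N)); pose proof (half_pow_pos (m - N)).
    assert (0 <= 4 * B * (/ 2) ^ N) by nra.
    apply Rabs_le_between in h1; apply Rabs_le_between in h2.
    apply Rabs_def1; nra. }
  set (r := fun c => real (Lim_seq (fun n => picard_iter n c))).
  assert (hr : forall c, is_lim_seq (fun n => picard_iter n c) (Finite (r c))).
  { intros c; destruct (hl c) as [l h]. unfold r; rewrite (is_lim_seq_unique _ _ h); exact h. }
  assert (hu : forall n c, Rabs (picard_iter n c - r c) <= 4 * B * (/ 2) ^ n).
  { intros n c.
    assert (h := is_lim_seq_le (fun k => Rabs (picard_iter (n + k) c - picard_iter n c))
                   (fun _ => 4 * B * (/ 2) ^ n) (Rabs (r c - picard_iter n c)) (4 * B * (/ 2) ^ n)).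
    rewrite Rabs_minus_sym. apply h.
    - intros k. pose proof (picard_iter_cauchy n k c).
      pose proof (half_pow_pos n); pose proof (half_pow_pos k).
      assert (0 <= 4 * B * (/ 2) ^ n) by nra. nra.
    - apply (is_lim_seq_abs _ (Finite (r c - picard_iter n c))).
      apply is_lim_seq_minus'; [|apply is_lim_seq_const].
      apply (is_lim_seq_ext (fun k => picard_iter (k + n) c));
        [intros k; now rewrite Nat.add_comm|].
      apply (is_lim_seq_incr_n (fun k => picard_iter k c) n), hr.
    - apply is_lim_seq_const. }
  assert (hc : forall c, continuous r c).
  { intros c. apply cont_eps. intros e he.
    destruct (half_pow_small (e / 3) ltac:(lra)) as [n hn].
    destruct (proj1 (cont_eps _ c) (picard_iter_cont n c) (e / 3) ltac:(lra)) as [d [hd h]].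
    exists d; split; [exact hd|]. intros y hy; specialize (h y hy).
    pose proof (hu n y) as h1; pose proof (hu n c) as h2.
    apply Rabs_le_between in h1; apply Rabs_le_between in h2; apply Rabs_def2 in h.
    apply Rabs_def1; lra. }
  exists r; split; [exact hc|]. intros c hcc.
  apply Rminus_diag_uniq. set (z := r c - _).
  assert (hz : forall n, Rabs z <= 4 * B * (/ 2) ^ n).
  { intros n.
    assert (h : Rabs (picard_iter (Datatypes.S n) c - (r0 + RInt (fun x => S x (r x)) 1 c))
                <= 2 * (/ 4 * (4 * B * (/ 2) ^ n))).
    { simpl. rewrite clamp_id by exact hcc.
      rewrite add_sub_add.
      apply RInt_diff_bound; [apply S_cont, picard_iter_cont | apply S_cont, hc | | exact hcc].
      intros x hx. eapply Rle_trans; [apply S_lip, hx|].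
      apply Rmult_le_compat; [lra | apply Rabs_pos | lra | apply hu]. }
    pose proof (hu (Datatypes.S n) c) as h1.
    change ((/ 2) ^ Datatypes.S n) with (/ 2 * (/ 2) ^ n) in h1.
    unfold z. apply Rabs_le_between in h; apply Rabs_le_between in h1.
    apply Rabs_le_between. lra. }
  destruct (Req_dec z 0) as [|hne]; [assumption|].
  destruct (half_pow_small (Rabs z) (Rabs_pos_lt _ hne)) as [n hn].
  specialize (hz n); lra.
Qed.

End Picard.


(** * One half-plane *)

(** The system X' = Y - (c0 + c1 X + c2 X^2 + c3 X^3),
    Y' = - (X + quad X^2 + cub X^3) on X >= 0.  The left half-plane takes this
    form after X -> -X and time reversal. *)
Record side := Side { quad : R; cub : R; c0 : R; c1 : R; c2 : R; c3 : R }.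

Definition admissible (S : side) : Prop := 0 <= quad S <= 1 /\ 0 <= cub S <= 1.

Definition drag (S : side) (X : R) : R := c0 S + c1 S * X + c2 S * X ^ 2 + c3 S * X ^ 3.
Definition drag' (S : side) (X : R) : R := c1 S + 2 * c2 S * X + 3 * c3 S * X ^ 2.
(** [force S X / X] for X >= 0.  The absolute values make the functions below
    even or odd, so that the amplitude is a C^1 bijection of the whole line. *)
Definition stiffness (S : side) (X : R) : R := 1 + quad S * Rabs X + cub S * X ^ 2.
Definition force (S : side) (X : R) : R := X * stiffness S X.
(** Twice the potential energy of the force, divided by X^2. *)
Definition mean_stiffness (S : side) (X : R) : R := 1 + 2 / 3 * quad S * Rabs X + cub S / 2 * X ^ 2.
(** The amplitude: the square root of twice the potential energy. *)
Definition ampl (S : side) (X : R) : R := X * sqrt (mean_stiffness S X).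
Definition ampl' (S : side) (X : R) : R := stiffness S X / sqrt (mean_stiffness S X).

Lemma mean_stiffness_ge1 S X : admissible S -> 1 <= mean_stiffness S X.
Proof.
  intros [hk hl]; unfold mean_stiffness. pose proof (Rabs_pos X); pose proof (pow2_ge_0 X).
  assert (0 <= quad S * Rabs X) by (apply Rmult_le_pos; lra).
  assert (0 <= cub S * X ^ 2) by (apply Rmult_le_pos; lra). lra.
Qed.

Lemma sqrt_ge1 x : 1 <= x -> 1 <= sqrt x <= x.
Proof.
  intros h; assert (h1 : 1 <= sqrt x) by (rewrite <- sqrt_1 at 1; apply sqrt_le_1_alt, h).
  split; [exact h1|]. pose proof (sqrt_sqrt x ltac:(lra)). nra.
Qed.

Lemma stiffness_ge_mean S X : admissible S -> mean_stiffness S X <= stiffness S X.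
Proof.
  intros [hk hl]; unfold mean_stiffness, stiffness. pose proof (Rabs_pos X); pose proof (pow2_ge_0 X).
  assert (0 <= quad S * Rabs X) by (apply Rmult_le_pos; lra).
  assert (0 <= cub S * X ^ 2) by (apply Rmult_le_pos; lra). lra.
Qed.

Lemma stiffness_ge1 S X : admissible S -> 1 <= stiffness S X.
Proof. intros h. pose proof (mean_stiffness_ge1 S X h); pose proof (stiffness_ge_mean S X h); lra. Qed.

Lemma ampl'_ge1 S X : admissible S -> 1 <= ampl' S X.
Proof.
  intros h; unfold ampl'. pose proof (stiffness_ge_mean S X h).
  destruct (sqrt_ge1 _ (mean_stiffness_ge1 S X h)). apply Rmult_le_reg_r with (sqrt (mean_stiffness S X)); [lra|].
  unfold Rdiv; rewrite Rmult_assoc, Rinv_l by lra. lra.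
Qed.

Lemma cont_mean_stiffness S X : continuous (mean_stiffness S) X.
Proof. unfold mean_stiffness; cont. Qed.

Lemma cont_ampl' S X : admissible S -> continuous (ampl' S) X.
Proof.
  intros h; unfold ampl', stiffness, mean_stiffness. cont. fold (mean_stiffness S X).
  destruct (sqrt_ge1 _ (mean_stiffness_ge1 S X h)); lra.
Qed.

Lemma locally_pos x : 0 < x -> locally x (fun y => 0 < y).
Proof. intros h; exists (mkposreal x h). intros y hy. apply Rabs_def2 in hy. unfold minus, plus, opp in hy; simpl in hy. lra. Qed.

Lemma locally_neg x : x < 0 -> locally x (fun y => y < 0).
Proof.
  intros h; assert (h' : 0 < - x) by lra. exists (mkposreal (- x) h').
  intros y hy. apply Rabs_def2 in hy. unfold minus, plus, opp in hy; simpl in hy. lra.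
Qed.

(** At 0, where the absolute value has a corner, the difference quotient of
    [ampl S] is the square root of [mean_stiffness S]. *)
Lemma ampl_derive S X : admissible S -> is_derive (ampl S) X (ampl' S X).
Proof.
  intros h. assert (hq := mean_stiffness_ge1 S X h). destruct (sqrt_ge1 _ hq) as [hs _].
  pose proof (sqrt_sqrt (mean_stiffness S X) ltac:(lra)) as hss.
  destruct (Rtotal_order X 0) as [hX|[hX|hX]].
  - apply (is_derive_ext_loc (fun x => x * sqrt (1 + 2 / 3 * quad S * - x + cub S / 2 * x ^ 2))).
    { apply filter_imp with (2 := locally_neg X hX). intros y hy. unfold ampl, mean_stiffness. now rewrite Rabs_left. }
    unfold ampl', stiffness. unfold mean_stiffness in *. rewrite Rabs_left in * by exact hX. auto_derive; [lra|].
    set (s := sqrt _) in *.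
    apply Rmult_eq_reg_r with s; [|lra]. field_simplify; [|lra|lra].
    unfold Rdiv at 1; nra.
  - subst X. apply is_derive_Reals. intros e he.
    destruct (proj1 (cont_eps _ 0) (cont_sqrt _ _ 0 (cont_mean_stiffness S 0)) e he) as [d [hd hh]].
    exists (mkposreal d hd). intros y hy hyd. specialize (hh y).
    rewrite Rminus_0_r in hh. specialize (hh hyd).
    assert (hq0 : mean_stiffness S 0 = 1) by (unfold mean_stiffness; rewrite Rabs_R0; ring).
    assert (hk0 : ampl' S 0 = 1).
    { unfold ampl'; rewrite hq0, sqrt_1; unfold stiffness; rewrite Rabs_R0; field. }
    rewrite hk0. rewrite hq0, sqrt_1 in hh.
    replace ((ampl S (0 + y) - ampl S 0) / y) with (sqrt (mean_stiffness S y)).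
    + exact hh.
    + unfold ampl. rewrite Rplus_0_l. field. exact hy.
  - apply (is_derive_ext_loc (fun x => x * sqrt (1 + 2 / 3 * quad S * x + cub S / 2 * x ^ 2))).
    { apply filter_imp with (2 := locally_pos X hX). intros y hy. unfold ampl, mean_stiffness. now rewrite Rabs_pos_eq by lra. }
    unfold ampl', stiffness. unfold mean_stiffness in *. rewrite Rabs_pos_eq in * by lra. auto_derive; [lra|].
    set (s := sqrt _) in *.
    apply Rmult_eq_reg_r with s; [|lra]. field_simplify; [|lra|lra].
    unfold Rdiv at 1; nra.
Qed.

(** The inverse function of [ampl S]. *)
Definition chi (S : side) : R -> R :=
  epsilon (inhabits (fun u : R => u)) (fun x : R -> R =>
    (forall u, ampl S (x u) = u) /\ (forall X, x (ampl S X) = X) /\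
    (forall u, is_derive x u (/ ampl' S (x u)))).

Lemma chi_spec S : admissible S ->
  (forall u, ampl S (chi S u) = u) /\ (forall X, chi S (ampl S X) = X) /\
  (forall u, is_derive (chi S) u (/ ampl' S (chi S u))).
Proof.
  intros h. exact (epsilon_spec (inhabits (fun u : R => u)) _
    (inverse_function (ampl S) (ampl' S) 1 Rlt_0_1 (fun x => ampl_derive S x h) (fun x => ampl'_ge1 S x h))).
Qed.

Section Chi.
Variable S : side.
Hypothesis hS : admissible S.

Lemma ampl_chi u : ampl S (chi S u) = u.
Proof. apply (chi_spec S hS). Qed.

Lemma chi_ampl X : chi S (ampl S X) = X.
Proof. apply (chi_spec S hS). Qed.

Lemma chi_derive u : is_derive (chi S) u (/ ampl' S (chi S u)).
Proof. apply (chi_spec S hS). Qed.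

Lemma cont_chi u : continuous (chi S) u.
Proof. exact (is_derive_cont _ _ _ (chi_derive u)). Qed.

(** [chi S u / u], written so that it is also meaningful at [u = 0]. *)
Definition chi_ratio (u : R) : R := / sqrt (mean_stiffness S (chi S u)).

Lemma chi_ratio_bounds u : 0 < chi_ratio u <= 1.
Proof.
  unfold chi_ratio. destruct (sqrt_ge1 _ (mean_stiffness_ge1 S (chi S u) hS)). split.
  - apply Rinv_0_lt_compat; lra.
  - rewrite <- Rinv_1. apply Rinv_le_contravar; lra.
Qed.

Lemma chi_ratio_mul u : chi S u = u * chi_ratio u.
Proof.
  unfold chi_ratio. rewrite <- (ampl_chi u) at 2. unfold ampl.
  destruct (sqrt_ge1 _ (mean_stiffness_ge1 S (chi S u) hS)). field; lra.
Qed.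

Lemma chi_pos u : 0 < u -> 0 < chi S u.
Proof. intros h. rewrite chi_ratio_mul. pose proof (chi_ratio_bounds u). nra. Qed.

Lemma chi_bounds u : 0 <= u -> 0 <= chi S u <= u.
Proof. intros h. rewrite chi_ratio_mul. pose proof (chi_ratio_bounds u). nra. Qed.

Lemma chi_0 : chi S 0 = 0.
Proof. rewrite chi_ratio_mul; ring. Qed.

Lemma chi_lip u v : Rabs (chi S u - chi S v) <= Rabs (u - v).
Proof.
  pose proof (expanding (ampl S) (ampl' S) 1 (fun x => ampl_derive S x hS) (fun x => ampl'_ge1 S x hS)) as h.
  destruct (Rle_dec (chi S u) (chi S v)) as [hl|hl].
  - specialize (h _ _ hl). rewrite !ampl_chi in h.
    rewrite Rabs_minus_sym, (Rabs_minus_sym u).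
    rewrite (Rabs_pos_eq (chi S v - chi S u)), Rabs_pos_eq; lra.
  - specialize (h (chi S v) (chi S u) ltac:(lra)). rewrite !ampl_chi in h.
    rewrite (Rabs_pos_eq (chi S u - chi S v)), Rabs_pos_eq; lra.
Qed.

(** The drag as a function of the amplitude, and its derivative. *)
Definition udrag (u : R) : R := drag S (chi S u).
Definition udrag' (u : R) : R := drag' S (chi S u) / ampl' S (chi S u).

Lemma udrag_derive u : is_derive udrag u (udrag' u).
Proof.
  unfold udrag, udrag'.
  apply (is_derive_eq _ _ (scal (/ ampl' S (chi S u)) (drag' S (chi S u)))).
  - apply (is_derive_comp (drag S) (chi S) u); [|apply chi_derive].
    unfold drag, drag'; auto_derive; [trivial | ring].
  - unfold scal; simpl; unfold mult; simpl. unfold Rdiv; ring.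
Qed.

Lemma cont_udrag u : continuous udrag u.
Proof. exact (is_derive_cont _ _ _ (udrag_derive u)). Qed.

Lemma cont_udrag' u : continuous udrag' u.
Proof.
  unfold udrag'. assert (continuous (fun v => chi S v) u) by apply cont_chi.
  apply cont_div; [unfold drag'; cont | |].
  - apply (cont_comp _ (ampl' S)); [apply cont_chi | now apply cont_ampl'].
  - pose proof (ampl'_ge1 S (chi S u) hS); lra.
Qed.

(** The sine of the angle of [0, PI] whose cosine is [c]. *)
Definition sine (c : R) : R := sqrt (1 - c ^ 2).
(** dr/dc along orbits, in the coordinates ampl = r sin, Y = r cos with c = cos.
    It is the quotient of r' = - force drag / r by
    c' = - force (r - c drag) / r^2. *)
Definition slope (c r : R) : R :=
  r * udrag (r * sine c) / (r - c * udrag (r * sine c)).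
(** The derivative of [slope] in [r]. *)
Definition slope_r (c r : R) : R :=
  (r ^ 2 * (sine c * udrag' (r * sine c)) - c * udrag (r * sine c) ^ 2) / (r - c * udrag (r * sine c)) ^ 2.

Lemma slope_derive c r : r - c * udrag (r * sine c) <> 0 ->
  is_derive (slope c) r (slope_r c r).
Proof.
  intros h0. unfold slope.
  assert (hf : is_derive (fun r => udrag (r * sine c)) r (sine c * udrag' (r * sine c))).
  { apply (is_derive_eq _ _ (scal (sine c) (udrag' (r * sine c)))); [|reflexivity].
    apply (is_derive_comp udrag (fun r => r * sine c) r); [apply udrag_derive|].
    auto_derive; [trivial | ring]. }
  set (w := fun r => udrag (r * sine c)) in *.
  change (is_derive (fun r => r * w r / (r - c * w r)) r (slope_r c r)).
  auto_derive.
  - repeat split; try (eexists; exact hf). exact h0.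
  - replace (Derive (fun x => w x) r) with (sine c * udrag' (r * sine c))
      by (symmetry; apply is_derive_unique, hf).
    unfold slope_r. fold (w r). unfold w in h0 |- *. field. exact h0.
Qed.

End Chi.

Lemma sine_bounds c : 0 <= sine c <= 1.
Proof.
  unfold sine; split; [apply sqrt_pos|].
  apply Rle_trans with (sqrt 1); [apply sqrt_le_1_alt; nra | rewrite sqrt_1; lra].
Qed.


(** * Lipschitz bounds *)

(** Bounds and Lipschitz constants are tracked together because both are needed
    for those of a product. *)
Definition lipb (a b : R) (f : R -> R) (B L : R) : Prop :=
  (forall x, a <= x <= b -> Rabs (f x) <= B) /\
  (forall x y, a <= x <= b -> a <= y <= b -> Rabs (f x - f y) <= L * Rabs (x - y)).

Section Lipb.
Variables a b : R.

Lemma lipb_const k : lipb a b (fun _ => k) (Rabs k) 0.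
Proof. split; intros; [lra | rewrite Rminus_diag, Rabs_R0; lra]. Qed.

Lemma lipb_plus f g B1 L1 B2 L2 : lipb a b f B1 L1 -> lipb a b g B2 L2 ->
  lipb a b (fun x => f x + g x) (B1 + B2) (L1 + L2).
Proof.
  intros [h1 h2] [h3 h4]; split; intros.
  - eapply Rle_trans; [apply Rabs_triang|]. specialize (h1 x H); specialize (h3 x H); lra.
  - replace (f x + g x - (f y + g y)) with ((f x - f y) + (g x - g y)) by ring.
    eapply Rle_trans; [apply Rabs_triang|]. specialize (h2 x y H H0); specialize (h4 x y H H0); lra.
Qed.

Lemma lipb_mult f g B1 L1 B2 L2 : lipb a b f B1 L1 -> lipb a b g B2 L2 ->
  lipb a b (fun x => f x * g x) (B1 * B2) (B1 * L2 + B2 * L1).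
Proof.
  intros [h1 h2] [h3 h4]; split; intros.
  - rewrite Rabs_mult. apply Rmult_le_compat; auto using Rabs_pos.
  - replace (f x * g x - f y * g y) with (f x * (g x - g y) + g y * (f x - f y)) by ring.
    eapply Rle_trans; [apply Rabs_triang|]. rewrite !Rabs_mult, Rmult_plus_distr_r.
    apply Rplus_le_compat; rewrite Rmult_assoc; apply Rmult_le_compat; auto using Rabs_pos.
Qed.

Lemma lipb_inv f B L m : lipb a b f B L -> 0 < m -> (forall x, a <= x <= b -> m <= f x) ->
  lipb a b (fun x => / f x) (/ m) (L * / m ^ 2).
Proof.
  intros [h1 h2] hm hf; split; intros.
  - specialize (hf x H). rewrite Rabs_inv, Rabs_pos_eq by lra.
    apply Rinv_le_contravar; lra.
  - pose proof (hf x H) as hx; pose proof (hf y H0) as hy.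
    replace (/ f x - / f y) with ((f y - f x) * / (f x * f y)) by (field; lra).
    rewrite Rabs_mult, Rabs_minus_sym, Rabs_inv, (Rabs_pos_eq (f x * f y)) by nra.
    replace (L * / m ^ 2 * Rabs (x - y)) with (L * Rabs (x - y) * / m ^ 2) by ring.
    apply Rmult_le_compat; [apply Rabs_pos | | now apply h2 |].
    + apply Rlt_le, Rinv_0_lt_compat; nra.
    + apply Rinv_le_contravar; nra.
Qed.

Lemma lipb_weaken f B L B' L' : lipb a b f B L -> B <= B' -> L <= L' -> lipb a b f B' L'.
Proof.
  intros [h1 h2] hB hL; split; intros.
  - specialize (h1 x H); lra.
  - specialize (h2 x y H H0). pose proof (Rabs_pos (x - y)). nra.
Qed.

Lemma lipb_ext f g B L : (forall x, a <= x <= b -> f x = g x) -> lipb a b f B L -> lipb a b g B L.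
Proof. intros he [h1 h2]; split; intros; rewrite <- ?he by assumption; auto. Qed.

End Lipb.

Lemma lipb_comp a b a' b' f g B1 L1 B2 L2 : lipb a b g B1 L1 -> lipb a' b' f B2 L2 -> 0 <= L2 ->
  (forall x, a <= x <= b -> a' <= g x <= b') -> lipb a b (fun x => f (g x)) B2 (L2 * L1).
Proof.
  intros [_ h2] [h3 h4] hL hg; split; intros.
  - now apply h3, hg.
  - eapply Rle_trans; [apply h4; now apply hg|]. rewrite Rmult_assoc.
    apply Rmult_le_compat_l; auto.
Qed.

(** All estimates below are proportional to the size [h] of the drag. *)
Definition size (S : side) (h : R) : Prop :=
  Rabs (c0 S) <= h /\ Rabs (c1 S) <= h /\ Rabs (c2 S) <= h /\ Rabs (c3 S) <= h.

(** A common bound, in units of the size of the drag, for [slope], for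
    [slope_r] and for the Lipschitz constant of [slope]. *)
Definition bigK : R := 10000000.

Lemma lipb_id a b m : (forall x, a <= x <= b -> Rabs x <= m) -> lipb a b (fun x => x) m 1.
Proof. intros h; split; [exact h | intros; lra]. Qed.

Lemma lipb_sqrt a b f B L : lipb a b f B L -> (forall x, a <= x <= b -> 1 <= f x) ->
  lipb a b (fun x => sqrt (f x)) B L.
Proof.
  intros [h1 h2] hf; split; intros.
  - pose proof (hf x H). destruct (sqrt_ge1 (f x)); [assumption|].
    pose proof (Rle_abs (f x)). specialize (h1 x H). rewrite Rabs_pos_eq; lra.
  - specialize (h2 x y H H0). apply Rle_trans with (2 := h2).
    pose proof (hf x H) as hx; pose proof (hf y H0) as hy.
    destruct (sqrt_ge1 (f x) hx); destruct (sqrt_ge1 (f y) hy).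
    pose proof (sqrt_sqrt (f x) ltac:(lra)); pose proof (sqrt_sqrt (f y) ltac:(lra)).
    set (p := sqrt (f x)) in *; set (q := sqrt (f y)) in *.
    replace (f x - f y) with ((p - q) * (p + q)) by lra.
    rewrite Rabs_mult, (Rabs_pos_eq (p + q)) by lra.
    pose proof (Rabs_pos (p - q)); nra.
Qed.

Lemma lipb_opp a b f B L : lipb a b f B L -> lipb a b (fun x => - f x) B L.
Proof.
  intros [h1 h2]; split; intros; [rewrite Rabs_Ropp; auto|].
  replace (- f x - - f y) with (- (f x - f y)) by ring. rewrite Rabs_Ropp; auto.
Qed.

Section Size.
Variables (S : side) (h : R).
Hypothesis hS : admissible S.
Hypothesis hsize : size S h.

Let h_pos : 0 <= h.
Proof. destruct hsize as [h0 _]. pose proof (Rabs_pos (c0 S)); lra. Qed.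

Let id06 : lipb 0 6 (fun x => x) 6 1.
Proof. apply lipb_id; intros; rewrite Rabs_pos_eq; lra. Qed.

Lemma chi_lipb : lipb 0 6 (chi S) 6 1.
Proof.
  split; intros.
  - pose proof (chi_bounds S hS x). rewrite Rabs_pos_eq; lra.
  - pose proof (chi_lip S hS x y); lra.
Qed.

Lemma chi_range x : 0 <= x <= 6 -> 0 <= chi S x <= 6.
Proof. intros hx. pose proof (chi_bounds S hS x ltac:(lra)); lra. Qed.

Lemma drag_lipb : lipb 0 6 (drag S) (259 * h) (121 * h).
Proof.
  destruct hsize as [h0 [h1 [h2 h3]]]. unfold drag.
  pose proof (lipb_mult _ _ _ _ _ _ _ _ id06 (lipb_mult _ _ _ _ _ _ _ _ id06 (lipb_const 0 6 1))) as hx2.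
  pose proof (lipb_mult _ _ _ _ _ _ _ _ id06 hx2) as hx3.
  eapply lipb_weaken; [|shelve|shelve].
  apply lipb_plus; [apply lipb_plus; [apply lipb_plus|]|].
  - apply lipb_const.
  - apply lipb_mult; [apply lipb_const | exact id06].
  - apply lipb_mult; [apply lipb_const | exact hx2].
  - apply lipb_mult; [apply lipb_const | exact hx3].
  Unshelve.
  all: rewrite Rabs_R1; lra.
Qed.

Lemma drag'_lipb : lipb 0 6 (drag' S) (121 * h) (38 * h).
Proof.
  destruct hsize as [h0 [h1 [h2 h3]]]. unfold drag'.
  pose proof (lipb_mult _ _ _ _ _ _ _ _ id06 (lipb_mult _ _ _ _ _ _ _ _ id06 (lipb_const 0 6 1))) as hx2.
  eapply lipb_weaken; [|shelve|shelve].
  apply lipb_plus; [apply lipb_plus|].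
  - apply lipb_const.
  - apply lipb_mult; [apply lipb_const | exact id06].
  - apply lipb_mult; [apply lipb_const | exact hx2].
  Unshelve.
  all: rewrite !Rabs_mult, Rabs_R1, !(Rabs_pos_eq 2), ?(Rabs_pos_eq 3) by lra; lra.
Qed.

Lemma mean_stiffness_lipb : lipb 0 6 (mean_stiffness S) 23 7.
Proof.
  destruct hS as [hk hl].
  apply (lipb_ext _ _ (fun x => 1 + 2 / 3 * quad S * x + cub S / 2 * (x * (x * 1)))).
  { intros x hx; unfold mean_stiffness. rewrite Rabs_pos_eq by lra. ring. }
  pose proof (lipb_mult _ _ _ _ _ _ _ _ id06 (lipb_mult _ _ _ _ _ _ _ _ id06 (lipb_const 0 6 1))) as hx2.
  eapply lipb_weaken; [|shelve|shelve].
  apply lipb_plus; [apply lipb_plus|].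
  - apply lipb_const.
  - apply lipb_mult; [apply lipb_const | exact id06].
  - apply lipb_mult; [apply lipb_const | exact hx2].
  Unshelve.
  all: rewrite !Rabs_R1, !Rabs_pos_eq by lra; lra.
Qed.

Lemma stiffness_lipb : lipb 0 6 (stiffness S) 43 13.
Proof.
  destruct hS as [hk hl].
  apply (lipb_ext _ _ (fun x => 1 + quad S * x + cub S * (x * (x * 1)))).
  { intros x hx; unfold stiffness. rewrite Rabs_pos_eq by lra. ring. }
  pose proof (lipb_mult _ _ _ _ _ _ _ _ id06 (lipb_mult _ _ _ _ _ _ _ _ id06 (lipb_const 0 6 1))) as hx2.
  eapply lipb_weaken; [|shelve|shelve].
  apply lipb_plus; [apply lipb_plus|].
  - apply lipb_const.
  - apply lipb_mult; [apply lipb_const | exact id06].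
  - apply lipb_mult; [apply lipb_const | exact hx2].
  Unshelve.
  all: rewrite !Rabs_R1, !Rabs_pos_eq by lra; lra.
Qed.

Lemma udrag_lipb : lipb 0 6 (udrag S) (259 * h) (121 * h).
Proof.
  replace (121 * h) with (121 * h * 1) by ring.
  apply (lipb_comp 0 6 0 6 (drag S) (chi S) 6 1 (259 * h) (121 * h) chi_lipb drag_lipb); [lra | apply chi_range].
Qed.

Lemma inv_ampl'_lipb : lipb 0 6 (fun x => / ampl' S x) 23 306.
Proof.
  apply (lipb_ext _ _ (fun x => sqrt (mean_stiffness S x) * / stiffness S x)).
  { intros x _; unfold ampl'. pose proof (stiffness_ge1 S x hS).
    destruct (sqrt_ge1 _ (mean_stiffness_ge1 S x hS)). field; lra. }
  eapply lipb_weaken; [apply lipb_mult|shelve|shelve].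
  - apply lipb_sqrt; [apply mean_stiffness_lipb | intros; now apply mean_stiffness_ge1].
  - apply (lipb_inv 0 6 (stiffness S) 43 13 1); [apply stiffness_lipb | lra | intros; now apply stiffness_ge1].
  Unshelve. all: lra.
Qed.

Lemma udrag'_lipb : lipb 0 6 (udrag' S) (2783 * h) (37900 * h).
Proof.
  apply (lipb_ext _ _ (fun x => (fun y => drag' S y * / ampl' S y) (chi S x))).
  { intros; reflexivity. }
  apply (lipb_weaken 0 6 _ (121 * h * 23) ((121 * h * 306 + 23 * (38 * h)) * 1)); [|lra|lra].
  apply (lipb_comp 0 6 0 6 (fun y => drag' S y * / ampl' S y) (chi S) 6 1 _ _ chi_lipb);
    [|lra|apply chi_range].
  apply lipb_mult; [apply drag'_lipb | apply inv_ampl'_lipb].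
Qed.

Hypothesis hsmall : h * (100 * bigK) <= 1.

Section FixedAngle.
Variable c : R.
Hypothesis hc : -1 <= c <= 1.

Let hs := sine_bounds c.

Let arg_lipb : lipb (/ 2) (11 / 2) (fun r => r * sine c) 6 1.
Proof.
  eapply lipb_weaken; [apply lipb_mult; [apply (lipb_id _ _ (11 / 2)) | apply lipb_const]| |].
  - intros; rewrite Rabs_pos_eq; lra.
  - rewrite Rabs_pos_eq; lra.
  - rewrite Rabs_pos_eq; lra.
Qed.

Lemma arg_range r : / 2 <= r <= 11 / 2 -> 0 <= r * sine c <= 6.
Proof. intros hr. destruct hs; nra. Qed.

Lemma denom_lower r : / 2 <= r <= 11 / 2 -> r - / 8 <= r - c * udrag S (r * sine c) <= r + / 8.
Proof.
  intros hr. destruct udrag_lipb as [hb _]. specialize (hb _ (arg_range r hr)).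
  apply Rabs_le_between in hb. unfold bigK in hsmall.
  assert (259 * h <= / 8) by lra. nra.
Qed.

Let ffr_lipb : lipb (/ 2) (11 / 2) (fun r => udrag S (r * sine c)) (259 * h) (121 * h).
Proof.
  replace (121 * h) with (121 * h * 1) by ring.
  apply (lipb_comp _ _ 0 6 _ (fun r => r * sine c) 6 1 _ _ arg_lipb udrag_lipb); [lra | apply arg_range].
Qed.

Let f1r_lipb : lipb (/ 2) (11 / 2) (fun r => udrag' S (r * sine c)) (2783 * h) (37900 * h).
Proof.
  replace (37900 * h) with (37900 * h * 1) by ring.
  apply (lipb_comp _ _ 0 6 _ (fun r => r * sine c) 6 1 _ _ arg_lipb udrag'_lipb); [lra | apply arg_range].
Qed.

Let r_lipb : lipb (/ 2) (11 / 2) (fun r => r) 6 1.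
Proof. apply lipb_id; intros; rewrite Rabs_pos_eq; lra. Qed.

Let inv_denom_lipb : lipb (/ 2) (11 / 2) (fun r => / (r - c * udrag S (r * sine c))) 3 8.
Proof.
  assert (hca : 0 <= Rabs c <= 1) by (split; [apply Rabs_pos | apply Rabs_le_between; lra]).
  assert (0 <= Rabs c * h <= h) by nra. unfold bigK in hsmall.
  assert (hd : lipb (/ 2) (11 / 2) (fun r => r - c * udrag S (r * sine c)) 7 (1 + 121 * h)).
  { eapply lipb_weaken; [apply lipb_plus; [apply r_lipb | apply lipb_opp, lipb_mult;
      [apply lipb_const | apply ffr_lipb]]|lra|lra]. }
  eapply lipb_weaken; [apply (lipb_inv _ _ _ 7 (1 + 121 * h) (3 / 8) hd)|lra|].
  - lra.
  - intros r hr; pose proof (denom_lower r hr); lra.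
  - simpl; lra.
Qed.

Lemma slope_lipb : lipb (/ 2) (11 / 2) (slope S c) (bigK * h) (bigK * h).
Proof.
  unfold slope, Rdiv.
  eapply lipb_weaken; [apply lipb_mult; [apply lipb_mult; [apply r_lipb | apply ffr_lipb] |
    apply inv_denom_lipb] | |]; unfold bigK; lra.
Qed.

Lemma slope_r_lipb : lipb (/ 2) (11 / 2) (slope_r S c) (bigK * h) (100 * bigK * h).
Proof.
  unfold slope_r, Rdiv.
  apply (lipb_ext _ _ (fun r => (r * r * (sine c * udrag' S (r * sine c))
     + - (c * (udrag S (r * sine c) * udrag S (r * sine c)))) *
     (/ (r - c * udrag S (r * sine c)) * / (r - c * udrag S (r * sine c))))).
  { intros r hr. pose proof (denom_lower r hr). field. lra. }
  assert (hca : 0 <= Rabs c <= 1) by (split; [apply Rabs_pos | apply Rabs_le_between; lra]).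
  assert (hsa : 0 <= Rabs (sine c) <= 1) by (rewrite Rabs_pos_eq; lra).
  assert (hh : 259 * h <= 1) by (unfold bigK in hsmall; lra).
  (* The constants of numerator and denominator are estimated separately, then multiplied. *)
  assert (hnum : lipb (/ 2) (11 / 2) (fun r => r * r * (sine c * udrag' S (r * sine c))
     + - (c * (udrag S (r * sine c) * udrag S (r * sine c)))) (101000 * h) (1400000 * h)).
  { eapply lipb_weaken; [apply lipb_plus; [apply lipb_mult; [apply lipb_mult; apply r_lipb
     | apply lipb_mult; [apply lipb_const | apply f1r_lipb]]
     | apply lipb_opp, lipb_mult; [apply lipb_const | apply lipb_mult; apply ffr_lipb]] | |].
    - assert (Rabs (sine c) * (2783 * h) <= 2783 * h) by nra.
      assert (0 <= 259 * h * (259 * h) <= 259 * h) by nra.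
      assert (Rabs c * (259 * h * (259 * h)) <= 259 * h) by nra. lra.
    - assert (Rabs (sine c) * (2783 * h) <= 2783 * h) by nra.
      assert (Rabs (sine c) * (37900 * h) <= 37900 * h) by nra.
      assert (0 <= 259 * h * (121 * h) <= 121 * h) by nra.
      assert (Rabs c * (259 * h * (121 * h) + 259 * h * (121 * h)) <= 242 * h) by nra.
      lra. }
  eapply lipb_weaken; [apply lipb_mult; [exact hnum | apply lipb_mult; apply inv_denom_lipb] | |];
    unfold bigK; lra.
Qed.

End FixedAngle.
End Size.


(** * Half-orbits *)

(** Clamping [c] and [r] makes the right-hand side of the equation globally
    defined and Lipschitz; by [half_orbit_range] the clamps do not act on the
    half-orbits that start between 3/4 and 21/4. *)
Definition clamp_r (r : R) : R := clamp (/ 2) (11 / 2) r.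
Definition clamp_c (c : R) : R := clamp (-1) 1 c.
Definition slope' (S : side) (c r : R) : R := slope S (clamp_c c) (clamp_r r).
Definition slope_r' (S : side) (c r : R) : R := slope_r S (clamp_c c) (clamp_r r).

Definition half_orbit (S : side) (r0 : R) (r : R -> R) : Prop :=
  (forall c, continuous r c) /\
  forall c, -1 <= c <= 1 -> r c = r0 + RInt (fun x => slope' S x (r x)) 1 c.

Lemma clamp_r_range r : / 2 <= clamp_r r <= 11 / 2.
Proof. apply clamp_bounds; lra. Qed.

Lemma clamp_c_range c : -1 <= clamp_c c <= 1.
Proof. apply clamp_bounds; lra. Qed.

Lemma cont_sine x : continuous sine x.
Proof. unfold sine; cont. Qed.

Lemma bigK_pos : 0 < bigK.
Proof. unfold bigK; lra. Qed.

Section HalfOrbit.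
Variables (S : side) (h : R).
Hypothesis hS : admissible S.
Hypothesis hsize : size S h.
Hypothesis hsmall : h * (100 * bigK) <= 1.

Lemma size_nonneg : 0 <= h.
Proof. destruct hsize as [h0 _]. pose proof (Rabs_pos (c0 S)); lra. Qed.

Lemma denom_pos c r : -1 <= c <= 1 -> / 2 <= r <= 11 / 2 -> 0 < r - c * udrag S (r * sine c).
Proof. intros hc hr. pose proof (denom_lower S h hS hsize hsmall c hc r hr). lra. Qed.

Lemma cont_slope' (g : R -> R) : (forall c, continuous g c) ->
  forall c, continuous (fun x => slope' S x (g x)) c.
Proof.
  intros hg c.
  assert (h1 : continuous (fun x => clamp_c x) c) by (apply cont_clamp; cont).
  assert (h2 : continuous (fun x => clamp_r (g x)) c) by (apply cont_clamp, hg).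
  assert (h3 : continuous (fun x => clamp_r (g x) * sine (clamp_c x)) c).
  { apply cont_mult; [exact h2|]. apply (cont_comp _ sine); [exact h1 | apply cont_sine]. }
  assert (h4 : continuous (fun x => udrag S (clamp_r (g x) * sine (clamp_c x))) c).
  { apply (cont_comp _ (udrag S)); [exact h3 | now apply cont_udrag]. }
  unfold slope', slope. cont.
  pose proof (denom_pos (clamp_c c) (clamp_r (g c)) (clamp_c_range c) (clamp_r_range (g c))). lra.
Qed.

Lemma cont_slope_r' (g : R -> R) : (forall c, continuous g c) ->
  forall c, continuous (fun x => slope_r' S x (g x)) c.
Proof.
  intros hg c.
  assert (h1 : continuous (fun x => clamp_c x) c) by (apply cont_clamp; cont).
  assert (h2 : continuous (fun x => clamp_r (g x)) c) by (apply cont_clamp, hg).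
  assert (h5 : continuous (fun x => sine (clamp_c x)) c).
  { apply (cont_comp _ sine); [exact h1 | apply cont_sine]. }
  assert (h3 : continuous (fun x => clamp_r (g x) * sine (clamp_c x)) c) by now apply cont_mult.
  assert (h4 : continuous (fun x => udrag S (clamp_r (g x) * sine (clamp_c x))) c).
  { apply (cont_comp _ (udrag S)); [exact h3 | now apply cont_udrag]. }
  assert (h6 : continuous (fun x => udrag' S (clamp_r (g x) * sine (clamp_c x))) c).
  { apply (cont_comp _ (udrag' S)); [exact h3 | now apply cont_udrag']. }
  unfold slope_r', slope_r. cont.
  pose proof (denom_pos (clamp_c c) (clamp_r (g c)) (clamp_c_range c) (clamp_r_range (g c))).
  apply pow_nonzero. lra.
Qed.

Lemma slope'_bound c r : Rabs (slope' S c r) <= bigK * h.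
Proof. apply (slope_lipb S h hS hsize hsmall (clamp_c c) (clamp_c_range c)), clamp_r_range. Qed.

Lemma slope'_lip c r r' : Rabs (slope' S c r - slope' S c r') <= bigK * h * Rabs (r - r').
Proof.
  eapply Rle_trans.
  - apply (slope_lipb S h hS hsize hsmall (clamp_c c) (clamp_c_range c)); apply clamp_r_range.
  - apply Rmult_le_compat_l; [|apply clamp_lip].
    pose proof size_nonneg; pose proof bigK_pos; nra.
Qed.

Lemma slope_r'_bound c r : Rabs (slope_r' S c r) <= bigK * h.
Proof. apply (slope_r_lipb S h hS hsize hsmall (clamp_c c) (clamp_c_range c)), clamp_r_range. Qed.

Lemma slope_r'_lip c r r' : Rabs (slope_r' S c r - slope_r' S c r') <= 100 * bigK * h * Rabs (r - r').
Proof.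
  eapply Rle_trans.
  - apply (slope_r_lipb S h hS hsize hsmall (clamp_c c) (clamp_c_range c)); apply clamp_r_range.
  - apply Rmult_le_compat_l; [|apply clamp_lip].
    pose proof size_nonneg; pose proof bigK_pos; nra.
Qed.

Lemma half_orbit_exists r0 : exists r, half_orbit S r0 r.
Proof.
  apply (picard (slope' S) (bigK * h) (bigK * h) r0).
  - apply cont_slope'.
  - intros; apply slope'_bound.
  - intros; apply slope'_lip.
  - pose proof size_nonneg; pose proof bigK_pos; split; nra.
Qed.

Section Props.
Variables (r0 : R) (r : R -> R).
Hypothesis hr : half_orbit S r0 r.
Hypothesis hr0 : 3 / 4 <= r0 <= 21 / 4.

Lemma half_orbit_start : r 1 = r0.
Proof. destruct hr as [_ e]. rewrite e by lra. rewrite RInt_point. apply Rplus_0_r. Qed.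

Lemma half_orbit_near c : -1 <= c <= 1 -> Rabs (r c - r0) <= 2 * (bigK * h).
Proof.
  intros hc. destruct hr as [hcont e]. rewrite e, add_sub_cancel by exact hc.
  apply RInt_bound; [now apply cont_slope' | intros; apply slope'_bound | exact hc].
Qed.

Lemma half_orbit_range c : -1 <= c <= 1 -> / 2 < r c < 11 / 2.
Proof.
  intros hc. pose proof (half_orbit_near c hc) as hn. apply Rabs_le_between in hn.
  pose proof size_nonneg. nra.
Qed.

Lemma half_orbit_derive c : -1 < c < 1 -> is_derive r c (slope S c (r c)).
Proof.
  intros hc. destruct hr as [hcont e].
  apply (is_derive_ext_loc (fun c => r0 + RInt (fun x => slope' S x (r x)) 1 c)).
  - apply (locally_interval _ c (-1) 1); simpl; [lra|lra|].
    intros y h1 h2; simpl in *. symmetry; apply e; lra.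
  - apply (is_derive_eq _ _ (0 + slope' S c (r c))).
    + apply (is_derive_plus (fun _ => r0) (fun c => RInt (fun x => slope' S x (r x)) 1 c) c);
        [exact (@is_derive_const R_AbsRing R_NormedModule r0 c) | apply (derive_RInt (fun x => slope' S x (r x))), cont_slope', hcont].
    + rewrite Rplus_0_l. unfold slope', clamp_c, clamp_r.
      pose proof (half_orbit_range c ltac:(lra)). rewrite !clamp_id by lra. reflexivity.
Qed.

End Props.

Lemma half_orbit_dependence r0 r0' r r' : half_orbit S r0 r -> half_orbit S r0' r' ->
  forall c, -1 <= c <= 1 -> Rabs (r c - r' c) <= 2 * Rabs (r0 - r0').
Proof.
  intros [hc e] [hc' e'].
  apply absorb_half; [intros; now apply cont_minus|].
  intros m hm c hcc. rewrite e, e' by exact hcc.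
  match goal with |- Rabs (r0 + ?u - (r0' + ?v)) <= _ =>
    apply Rle_trans with (Rabs ((r0 - r0') + (u - v))) end.
  - right; f_equal.
    generalize (RInt (fun x => slope' S x (r x)) 1 c : R), (RInt (fun x => slope' S x (r' x)) 1 c : R).
    simpl; intros; ring.
  - eapply Rle_trans; [apply Rabs_triang|]. apply Rplus_le_compat_l.
    apply Rle_trans with (2 * (bigK * h * m)).
    + apply RInt_diff_bound; [now apply cont_slope' | now apply cont_slope' | | exact hcc].
      intros x hx. eapply Rle_trans; [apply slope'_lip|].
      apply Rmult_le_compat_l; [pose proof size_nonneg; pose proof bigK_pos; nra | now apply hm].
    + assert (0 <= m) by (apply Rle_trans with (2 := hm 1 ltac:(lra)), Rabs_pos). nra.
Qed.

End HalfOrbit.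

(** Continuous dependence on the system: the Lipschitz constant of the slope is
    small, so a difference [E] of the slopes is amplified by a fixed factor. *)
Lemma half_orbit_compare S S' h E r0 r r' :
  admissible S -> admissible S' -> size S h -> size S' h -> h * (100 * bigK) <= 1 ->
  (forall c r, -1 <= c <= 1 -> / 2 <= r <= 11 / 2 -> Rabs (slope S c r - slope S' c r) <= E) ->
  half_orbit S r0 r -> half_orbit S' r0 r' ->
  forall c, -1 <= c <= 1 -> Rabs (r c - r' c) <= 4 * E.
Proof.
  intros hS hS' hz hz' hsm hE [hc e] [hc' e'] c hcc.
  replace (4 * E) with (2 * (2 * E)) by ring.
  revert c hcc. apply absorb_half; [intros; now apply cont_minus|].
  intros m hm c hcc. rewrite e, e', add_sub_add by exact hcc.
  apply Rle_trans with (2 * (E + bigK * h * m)).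
  - apply RInt_diff_bound; [now apply (cont_slope' S h) | now apply (cont_slope' S' h) | | exact hcc].
    intros x hx.
    replace (slope' S x (r x) - slope' S' x (r' x)) with
      ((slope' S x (r x) - slope' S' x (r x)) + (slope' S' x (r x) - slope' S' x (r' x))) by ring.
    eapply Rle_trans; [apply Rabs_triang|]. apply Rplus_le_compat.
    + apply hE; [apply clamp_c_range | apply clamp_r_range].
    + eapply Rle_trans; [apply (slope'_lip S' h); assumption|].
      apply Rmult_le_compat_l; [pose proof (size_nonneg S h hz); pose proof bigK_pos; nra | now apply hm].
  - assert (0 <= m) by (apply Rle_trans with (2 := hm 1 ltac:(lra)), Rabs_pos). nra.
Qed.


(** * Comparison of the two half-planes *)

Lemma Rabs_mult_le a b A B : Rabs a <= A -> Rabs b <= B -> Rabs (a * b) <= A * B.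
Proof. intros; rewrite Rabs_mult. apply Rmult_le_compat; auto using Rabs_pos. Qed.

Lemma Rabs_plus_le a b A B : Rabs a <= A -> Rabs b <= B -> Rabs (a + b) <= A + B.
Proof. intros; eapply Rle_trans; [apply Rabs_triang | lra]. Qed.

Lemma Rabs_minus_le a b A B : Rabs a <= A -> Rabs b <= B -> Rabs (a - b) <= A + B.
Proof. intros. unfold Rminus. apply Rabs_plus_le; [|rewrite Rabs_Ropp]; assumption. Qed.

(** The integrals run from 1 to -1, in the direction of motion. *)
Definition melnikov (psi : R -> R) (r : R) : R := RInt (fun c => psi (r * sine c)) 1 (-1).
Definition melnikov_r (psi' : R -> R) (r : R) : R := RInt (fun c => sine c * psi' (r * sine c)) 1 (-1).

Section Compare.
Variables (Sp Sm : side) (h : R).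
Hypotheses (wp : admissible Sp) (wm : admissible Sm) (zp : size Sp h) (zm : size Sm h).
Hypothesis hsmall : h * (100 * bigK) <= 1.

Let h0 := size_nonneg Sp h zp.

Section AtPoint.
Variables c r : R.
Hypotheses (hc : -1 <= c <= 1) (hr : / 2 <= r <= 11 / 2).

Let u := r * sine c.
Let df := udrag Sp u - udrag Sm u.
Let df1 := udrag' Sp u - udrag' Sm u.
Let p := / (r - c * udrag Sp u).
Let q := / (r - c * udrag Sm u).

Let hu : 0 <= u <= 6.
Proof. apply arg_range; assumption. Qed.

Let hcR : Rabs c <= 1.
Proof. apply Rabs_le_between; lra. Qed.

Let hrR : Rabs r <= 6.
Proof. apply Rabs_le_between; lra. Qed.

Let hsR : Rabs (sine c) <= 1.
Proof. pose proof (sine_bounds c). apply Rabs_le_between; lra. Qed.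

Let fp_le : Rabs (udrag Sp u) <= 259 * h.
Proof. now apply (udrag_lipb Sp h). Qed.

Let fm_le : Rabs (udrag Sm u) <= 259 * h.
Proof. now apply (udrag_lipb Sm h). Qed.

Let f1m_le : Rabs (udrag' Sm u) <= 2783 * h.
Proof. now apply (udrag'_lipb Sm h). Qed.

Let inv_le (S : side) : admissible S -> size S h -> Rabs (/ (r - c * udrag S u)) <= 3.
Proof.
  intros w z. pose proof (denom_lower S h w z hsmall c hc r hr) as hd. fold u in hd.
  rewrite Rabs_inv, Rabs_pos_eq by lra.
  replace 3 with (/ / 3) by field. apply Rinv_le_contravar; lra.
Qed.

Let p_le : Rabs p <= 3.
Proof. now apply inv_le. Qed.

Let q_le : Rabs q <= 3.
Proof. now apply inv_le. Qed.

Let dp := denom_pos Sp h wp zp hsmall c r hc hr.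
Let dq := denom_pos Sm h wm zm hsmall c r hc hr.

(** By the exact identity in the proof, the difference of the slopes minus that
    of the drags carries one more factor of the size of the drag. *)
Lemma slope_diff : Rabs (slope Sp c r - slope Sm c r - df) <= 100000 * h * Rabs df.
Proof.
  replace (slope Sp c r - slope Sm c r - df)
    with (df * (c * (p * (q * (r * (udrag Sp u + udrag Sm u) - c * (udrag Sp u * udrag Sm u))))));
    [|unfold slope, df, p, q; fold u; fold u in dp, dq; field; split; lra].
  apply Rle_trans with (Rabs df * (1 * (3 * (3 * (6 * (259 * h + 259 * h) + 1 * (259 * h * (259 * h))))))).
  - repeat first [ assumption | apply Rle_refl | apply Rabs_mult_le | apply Rabs_minus_le | apply Rabs_plus_le ].
  - rewrite (Rmult_comm _ (Rabs df)). apply Rmult_le_compat_l; [apply Rabs_pos|].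
    unfold bigK in hsmall. assert (259 * h * (259 * h) <= 259 * h) by nra. lra.
Qed.

(** The same mechanism for the derivatives in [r]. *)
Lemma slope_r_diff :
  Rabs (slope_r Sp c r - slope_r Sm c r - sine c * df1) <= bigK * h * (Rabs df + Rabs df1).
Proof.
  replace (slope_r Sp c r - slope_r Sm c r - sine c * df1)
    with (df1 * (sine c * (c * (udrag Sp u * (p * (r * p + 1)))))
          + df * ((r * (r * (sine c * udrag' Sm u)) - c * (udrag Sm u * udrag Sm u)) * (c * (p * (q * (p + q))))
          - c * ((udrag Sp u + udrag Sm u) * (p * p))));
    [|unfold slope_r, df, df1, p, q; fold u; fold u in dp, dq; field; split; lra].
  apply Rle_trans with (Rabs df1 * (1 * (1 * (259 * h * (3 * (6 * 3 + 1)))))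
    + Rabs df * ((6 * (6 * (1 * (2783 * h))) + 1 * (259 * h * (259 * h))) * (1 * (3 * (3 * (3 + 3))))
       + 1 * ((259 * h + 259 * h) * (3 * 3)))).
  - repeat first [ assumption | apply Rle_refl | apply Rabs_mult_le | apply Rabs_minus_le | apply Rabs_plus_le
     | rewrite Rabs_R1; apply Rle_refl ].
  - assert (259 * h * (259 * h) <= 259 * h) by (unfold bigK in hsmall; nra).
    pose proof (Rabs_pos df); pose proof (Rabs_pos df1).
    assert (0 <= h * Rabs df) by now apply Rmult_le_pos.
    assert (0 <= h * Rabs df1) by now apply Rmult_le_pos.
    assert (259 * h * (259 * h) * Rabs df <= 259 * h * Rabs df) by (apply Rmult_le_compat_r; lra).
    unfold bigK. nra.
Qed.

End AtPoint.

Variables (psi psi' : R -> R) (P m2 e : R).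
Hypotheses (hpsi : lipb 0 6 psi P P) (hdpsi : lipb 0 6 psi' P P).
Hypotheses (cont_psi : forall u, continuous psi u) (cont_dpsi : forall u, continuous psi' u).
Hypotheses (hm2 : 0 <= m2) (he : 0 <= e <= 1).
Hypothesis approx0 : forall u, 0 <= u <= 6 -> Rabs (udrag Sp u - udrag Sm u - m2 * psi u) <= m2 * e.
Hypothesis approx1 : forall u, 0 <= u <= 6 -> Rabs (udrag' Sp u - udrag' Sm u - m2 * psi' u) <= m2 * e.

Let hP : 0 <= P.
Proof. apply Rle_trans with (2 := proj1 hpsi 0 ltac:(lra)), Rabs_pos. Qed.

Let diff_le (f phi : R -> R) u : 0 <= u <= 6 -> Rabs (phi u) <= P -> Rabs (f u - m2 * phi u) <= m2 * e ->
  Rabs (f u) <= m2 * (P + 1).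
Proof.
  intros hu hp ha. replace (f u) with ((f u - m2 * phi u) + m2 * phi u) by ring.
  apply Rle_trans with (m2 * e + m2 * P); [|nra].
  apply Rabs_plus_le; [exact ha|]. apply Rabs_mult_le; [rewrite Rabs_pos_eq; lra | exact hp].
Qed.

Let df_le u : 0 <= u <= 6 -> Rabs (udrag Sp u - udrag Sm u) <= m2 * (P + 1).
Proof. intros hu. apply (diff_le (fun u => udrag Sp u - udrag Sm u) psi u hu); [now apply hpsi | now apply approx0]. Qed.

Let df1_le u : 0 <= u <= 6 -> Rabs (udrag' Sp u - udrag' Sm u) <= m2 * (P + 1).
Proof. intros hu. apply (diff_le (fun u => udrag' Sp u - udrag' Sm u) psi' u hu); [now apply hdpsi | now apply approx1]. Qed.

Lemma slope_diff_le c r : -1 <= c <= 1 -> / 2 <= r <= 11 / 2 ->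
  Rabs (slope Sp c r - slope Sm c r) <= 2 * (m2 * (P + 1)).
Proof.
  intros hc hr. pose proof (slope_diff c r hc hr) as hd.
  pose proof (df_le _ (arg_range c r hr)) as hf.
  replace (slope Sp c r - slope Sm c r) with
    ((slope Sp c r - slope Sm c r - (udrag Sp (r * sine c) - udrag Sm (r * sine c)))
      + (udrag Sp (r * sine c) - udrag Sm (r * sine c))) by ring.
  eapply Rle_trans; [apply Rabs_plus_le; [exact hd | exact hf]|].
  unfold bigK in hsmall. pose proof (Rabs_pos (udrag Sp (r * sine c) - udrag Sm (r * sine c))). nra.
Qed.

Variables (r0 : R) (rp rm : R -> R).
Hypotheses (hrp : half_orbit Sp r0 rp) (hrm : half_orbit Sm r0 rm).
Hypothesis hr0 : 3 / 4 <= r0 <= 21 / 4.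

Let gap c : -1 <= c <= 1 -> Rabs (rp c - rm c) <= 8 * (m2 * (P + 1)).
Proof.
  intros hc. replace (8 * (m2 * (P + 1))) with (4 * (2 * (m2 * (P + 1)))) by ring.
  revert c hc. apply (half_orbit_compare Sp Sm h _ r0); try assumption. apply slope_diff_le.
Qed.

Let near_r0 phi c : lipb 0 6 phi P P -> -1 <= c <= 1 ->
  Rabs (phi (rp c * sine c) - phi (r0 * sine c)) <= P * (2 * (bigK * h)).
Proof.
  intros hphi hc. pose proof (half_orbit_range Sp h wp zp hsmall r0 rp hrp hr0 c hc) as hrr.
  eapply Rle_trans; [apply hphi; apply arg_range; lra|].
  apply Rmult_le_compat_l; [exact hP|].
  replace (rp c * sine c - r0 * sine c) with ((rp c - r0) * sine c) by ring.
  rewrite Rabs_mult. pose proof (sine_bounds c). rewrite (Rabs_pos_eq (sine c)) by lra.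
  pose proof (half_orbit_near Sp h wp zp hsmall r0 rp hrp c hc).
  pose proof (Rabs_pos (rp c - r0)). nra.
Qed.

(** The difference of the slopes along the two half-orbits is split into the
    effect of the gap between the half-orbits, the error of [slope_diff], the
    error of the expansion [approx0], and the motion of [r] away from [r0]. *)
Lemma displacement_approx :
  Rabs (rp (-1) - rm (-1) - m2 * melnikov psi r0) <= m2 * (100 * bigK * (P + 1)) * (e + h).
Proof.
  destruct hrp as [cp ep]; destruct hrm as [cm em].
  rewrite ep, em, add_sub_add by lra.
  assert (hci : forall x, continuous (fun c => psi (r0 * sine c)) x).
  { intros x. apply (cont_comp _ psi); [|apply cont_psi]. cont; apply cont_sine. }
  assert (hscal : m2 * melnikov psi r0 = RInt (fun c => m2 * psi (r0 * sine c)) 1 (-1)).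
  { symmetry. apply (RInt_scal (fun c => psi (r0 * sine c)) 1 (-1) m2), ex_RInt_cont, hci. }
  rewrite hscal, RInt_sub by (apply (cont_slope' _ h); assumption).
  eapply Rle_trans; [apply RInt_diff_bound with
    (M := bigK * h * (8 * (m2 * (P + 1))) + (100000 * h * (m2 * (P + 1)) + (m2 * e + m2 * (P * (2 * (bigK * h))))))|].
  - intros x; apply cont_minus; [apply (cont_slope' Sp h) | apply (cont_slope' Sm h)]; assumption.
  - intros x; apply (cont_mult _ (fun _ => m2)); [apply cont_const | apply hci].
  - intros c hc.
    pose proof (half_orbit_range Sp h wp zp hsmall r0 rp hrp hr0 c hc) as hrr.
    replace (slope' Sp c (rp c) - slope' Sm c (rm c) - m2 * psi (r0 * sine c)) with
      ((slope' Sm c (rp c) - slope' Sm c (rm c)) +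
       ((slope' Sp c (rp c) - slope' Sm c (rp c) - (udrag Sp (rp c * sine c) - udrag Sm (rp c * sine c))) +
       ((udrag Sp (rp c * sine c) - udrag Sm (rp c * sine c) - m2 * psi (rp c * sine c)) +
         m2 * (psi (rp c * sine c) - psi (r0 * sine c))))) by ring.
    apply Rabs_plus_le; [|apply Rabs_plus_le; [|apply Rabs_plus_le]].
    + eapply Rle_trans; [apply (slope'_lip Sm h); assumption|].
      apply Rmult_le_compat_l; [pose proof bigK_pos; nra | now apply gap].
    + unfold slope', clamp_c, clamp_r. rewrite !clamp_id by lra.
      eapply Rle_trans; [apply slope_diff; lra|].
      apply Rmult_le_compat_l; [lra|]. apply df_le, arg_range; lra.
    + apply approx0, arg_range; lra.
    + apply Rabs_mult_le; [rewrite Rabs_pos_eq; lra | now apply near_r0].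
  - lra.
  - assert (0 <= m2 * (P + 1)) by nra.
    assert (0 <= m2 * P) by nra.
    assert (0 <= m2 * (P + 1) * h) by now apply Rmult_le_pos.
    assert (0 <= m2 * P * h) by now apply Rmult_le_pos.
    assert (0 <= m2 * e) by nra. assert (0 <= m2 * P * e) by nra. assert (0 <= m2 * h) by nra.
    unfold bigK. nra.
Qed.

Lemma exponent_approx :
  Rabs (RInt (fun c => slope_r' Sp c (rp c)) 1 (-1) - RInt (fun c => slope_r' Sm c (rm c)) 1 (-1)
        - m2 * melnikov_r psi' r0) <= m2 * (10000 * bigK * (P + 1)) * (e + h).
Proof.
  destruct hrp as [cp ep]; destruct hrm as [cm em].
  assert (hci : forall x, continuous (fun c => sine c * psi' (r0 * sine c)) x).
  { intros x. apply cont_mult; [apply cont_sine|].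
    apply (cont_comp _ psi'); [|apply cont_dpsi]. cont; apply cont_sine. }
  assert (hscal : m2 * melnikov_r psi' r0 = RInt (fun c => m2 * (sine c * psi' (r0 * sine c))) 1 (-1)).
  { symmetry. apply (RInt_scal (fun c => sine c * psi' (r0 * sine c)) 1 (-1) m2), ex_RInt_cont, hci. }
  rewrite hscal, RInt_sub by (apply (cont_slope_r' _ h); assumption).
  eapply Rle_trans; [apply RInt_diff_bound with
    (M := 100 * bigK * h * (8 * (m2 * (P + 1))) + (bigK * h * (m2 * (P + 1) + m2 * (P + 1))
           + 1 * (m2 * e + m2 * (P * (2 * (bigK * h))))))|].
  - intros x; apply cont_minus; [apply (cont_slope_r' Sp h) | apply (cont_slope_r' Sm h)]; assumption.
  - intros x; apply (cont_mult _ (fun _ => m2)); [apply cont_const | apply hci].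
  - intros c hc.
    pose proof (half_orbit_range Sp h wp zp hsmall r0 rp hrp hr0 c hc) as hrr.
    replace (slope_r' Sp c (rp c) - slope_r' Sm c (rm c) - m2 * (sine c * psi' (r0 * sine c))) with
      ((slope_r' Sm c (rp c) - slope_r' Sm c (rm c)) +
       ((slope_r' Sp c (rp c) - slope_r' Sm c (rp c) - sine c * (udrag' Sp (rp c * sine c) - udrag' Sm (rp c * sine c))) +
        sine c * ((udrag' Sp (rp c * sine c) - udrag' Sm (rp c * sine c) - m2 * psi' (rp c * sine c)) +
         m2 * (psi' (rp c * sine c) - psi' (r0 * sine c))))) by ring.
    apply Rabs_plus_le; [|apply Rabs_plus_le; [|apply Rabs_mult_le; [|apply Rabs_plus_le]]].
    + eapply Rle_trans; [apply (slope_r'_lip Sm h); assumption|].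
      apply Rmult_le_compat_l; [pose proof bigK_pos; nra | now apply gap].
    + unfold slope_r', clamp_c, clamp_r. rewrite !clamp_id by lra.
      eapply Rle_trans; [apply slope_r_diff; lra|].
      apply Rmult_le_compat_l; [pose proof bigK_pos; nra|].
      apply Rplus_le_compat; [apply df_le | apply df1_le]; apply arg_range; lra.
    + pose proof (sine_bounds c). rewrite Rabs_pos_eq; lra.
    + apply approx1, arg_range; lra.
    + apply Rabs_mult_le; [rewrite Rabs_pos_eq; lra | now apply near_r0].
  - lra.
  - assert (0 <= m2 * (P + 1)) by nra.
    assert (0 <= m2 * P) by nra.
    assert (0 <= m2 * (P + 1) * h) by now apply Rmult_le_pos.
    assert (0 <= m2 * P * h) by now apply Rmult_le_pos.
    assert (0 <= m2 * e) by nra. assert (0 <= m2 * P * e) by nra. assert (0 <= m2 * h) by nra.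
    unfold bigK. nra.
Qed.

End Compare.


(** * Expansion in the two small parameters *)

(** [k] is the quadratic coefficient of the force, [m] = eps^3, and [u] an
    amplitude.  As [m <= k], errors in both parameters are measured by [k]. *)
Definition param_dom (k m u : R) : Prop := 0 < k <= 1 /\ 0 < m <= k /\ 0 <= u <= 6.

(** Equality up to O(k), uniformly on the domain, between bounded quantities.
    It is a congruence for the ring operations, so that a limit is computed by
    replacing every ingredient by its limit. *)
Definition near (x y : R -> R -> R -> R) : Prop :=
  exists C, 0 <= C /\ forall k m u, param_dom k m u ->
    Rabs (x k m u - y k m u) <= C * k /\ Rabs (x k m u) <= C /\ Rabs (y k m u) <= C.

Lemma near_const a : near (fun _ _ _ => a) (fun _ _ _ => a).
Proof.
  exists (Rabs a); split; [apply Rabs_pos|]. intros k m u [hk _].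
  rewrite Rminus_diag, Rabs_R0. pose proof (Rabs_pos a). repeat split; nra.
Qed.

Lemma near_arg : near (fun _ _ u => u) (fun _ _ u => u).
Proof.
  exists 6; split; [lra|]. intros k m u [hk [_ hu]].
  rewrite Rminus_diag, Rabs_R0, Rabs_pos_eq by lra. repeat split; nra.
Qed.

Lemma near_kap : near (fun k _ _ => k) (fun _ _ _ => 0).
Proof.
  exists 1; split; [lra|]. intros k m u [hk _].
  rewrite Rminus_0_r, Rabs_R0, Rabs_pos_eq by lra. repeat split; lra.
Qed.

Lemma near_mu : near (fun _ m _ => m) (fun _ _ _ => 0).
Proof.
  exists 1; split; [lra|]. intros k m u [hk [hm _]].
  rewrite Rminus_0_r, Rabs_R0, Rabs_pos_eq by lra. repeat split; lra.
Qed.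

Lemma near_plus x y x' y' : near x x' -> near y y' ->
  near (fun k m u => x k m u + y k m u) (fun k m u => x' k m u + y' k m u).
Proof.
  intros [C [hC h]] [C' [hC' h']]. exists (C + C'); split; [lra|]. intros k m u hd.
  destruct (h k m u hd) as [h1 [h2 h3]]; destruct (h' k m u hd) as [h1' [h2' h3']].
  split; [|split; now apply Rabs_plus_le].
  replace (x k m u + y k m u - (x' k m u + y' k m u))
    with ((x k m u - x' k m u) + (y k m u - y' k m u)) by ring.
  rewrite Rmult_plus_distr_r. now apply Rabs_plus_le.
Qed.

Lemma near_opp x x' : near x x' -> near (fun k m u => - x k m u) (fun k m u => - x' k m u).
Proof.
  intros [C [hC h]]. exists C; split; [lra|]. intros k m u hd.
  destruct (h k m u hd) as [h1 [h2 h3]]. rewrite !Rabs_Ropp.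
  replace (- x k m u - - x' k m u) with (- (x k m u - x' k m u)) by ring.
  now rewrite Rabs_Ropp.
Qed.

Lemma near_minus x y x' y' : near x x' -> near y y' ->
  near (fun k m u => x k m u - y k m u) (fun k m u => x' k m u - y' k m u).
Proof. intros h h'. unfold Rminus. apply near_plus; [exact h | now apply near_opp]. Qed.

Lemma near_mult x y x' y' : near x x' -> near y y' ->
  near (fun k m u => x k m u * y k m u) (fun k m u => x' k m u * y' k m u).
Proof.
  intros [C [hC h]] [C' [hC' h']]. exists (2 * (C * C')); split; [nra|]. intros k m u hd.
  destruct (h k m u hd) as [h1 [h2 h3]]; destruct (h' k m u hd) as [h1' [h2' h3']].
  assert (0 <= C * C') by nra.
  split; [|split].
  - replace (x k m u * y k m u - x' k m u * y' k m u)
      with ((x k m u - x' k m u) * y k m u + x' k m u * (y k m u - y' k m u)) by ring.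
    replace (2 * (C * C') * k) with (C * k * C' + C * (C' * k)) by ring.
    apply Rabs_plus_le; now apply Rabs_mult_le.
  - apply Rle_trans with (C * C'); [now apply Rabs_mult_le | lra].
  - apply Rle_trans with (C * C'); [now apply Rabs_mult_le | lra].
Qed.

Lemma near_pow x x' n : near x x' -> near (fun k m u => x k m u ^ n) (fun k m u => x' k m u ^ n).
Proof. intros h; induction n; simpl; [apply near_const | now apply near_mult]. Qed.

Lemma near_inv x x' a : 0 < a -> near x x' ->
  (forall k m u, param_dom k m u -> a <= x k m u /\ a <= x' k m u) ->
  near (fun k m u => / x k m u) (fun k m u => / x' k m u).
Proof.
  intros ha [C [hC h]] hl. exists (C * / (a * a) + / a).
  assert (0 < / a) by now apply Rinv_0_lt_compat.
  assert (0 < / (a * a)) by (apply Rinv_0_lt_compat; nra).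
  split; [nra|]. intros k m u hd. destruct hd as [hk hd'].
  destruct (h k m u (conj hk hd')) as [h1 _]; destruct (hl k m u (conj hk hd')) as [l1 l2].
  assert (hi : forall z, a <= z -> Rabs (/ z) <= C * / (a * a) + / a).
  { intros z hz. rewrite Rabs_inv, Rabs_pos_eq by lra.
    apply Rle_trans with (/ a); [now apply Rinv_le_contravar | nra]. }
  split; [|split; now apply hi].
  replace (/ x k m u - / x' k m u) with ((x k m u - x' k m u) * (- / (x k m u * x' k m u)))
    by (field; lra).
  apply Rle_trans with (C * k * / (a * a)); [|nra].
  apply Rabs_mult_le; [exact h1|].
  rewrite Rabs_Ropp, Rabs_inv, Rabs_pos_eq by nra. apply Rinv_le_contravar; nra.
Qed.

Lemma near_ext x y x' y' : (forall k m u, param_dom k m u -> x k m u = x' k m u) ->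
  (forall k m u, param_dom k m u -> y k m u = y' k m u) -> near x y -> near x' y'.
Proof.
  intros hx hy [C [hC h]]. exists C; split; [exact hC|]. intros k m u hd.
  rewrite <- hx, <- hy by exact hd. now apply h.
Qed.

Ltac near := repeat first
  [ eassumption | apply near_const | apply near_arg | apply near_kap | apply near_mu
  | apply near_minus | apply near_plus | apply near_mult | apply near_opp | apply near_pow ].

Section Expansion.
Variables (al be de p2 p3 dd : R).

(** The drag on either side: al and be are the even part of order [m], the rest
    has order [m ^ 2].  The linear term changes sign on the left, because the
    reflection turns x into -x and leaves x^2 and |x|^3 unchanged. *)
Definition right_side (k m : R) : side :=
  Side k m 0 (- (m ^ 2 * de)) (m * al - m ^ 2 * p2) (m * be - m ^ 2 * p3).
Definition left_side (k m : R) : side :=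
  Side k 0 (- (m ^ 2 * dd)) (m ^ 2 * de) (m * al) (m * be).

(** The limit of the difference of the drags divided by [m ^ 2].  The last two
    terms come from al X^2 + be X^3: the two positions with the amplitude u
    differ by m u^3 / 4 to leading order. *)
Definition psi (u : R) : R :=
  dd - 2 * de * u - p2 * u ^ 2 - p3 * u ^ 3 - al / 2 * u ^ 4 - 3 / 4 * be * u ^ 5.
Definition psi' (u : R) : R :=
  - 2 * de - 2 * p2 * u - 3 * p3 * u ^ 2 - 2 * al * u ^ 3 - 15 / 4 * be * u ^ 4.

Lemma right_admissible k m u : param_dom k m u -> admissible (right_side k m).
Proof. intros [hk [hm _]]; unfold admissible; simpl; lra. Qed.

Lemma left_admissible k m u : param_dom k m u -> admissible (left_side k m).
Proof. intros [hk [hm _]]; unfold admissible; simpl; lra. Qed.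

Let np k m u := chi_ratio (right_side k m) u.
Let nm k m u := chi_ratio (left_side k m) u.
(** [m * dn] is the relative difference of the positions with the same
    amplitude on the two sides. *)
Let dn k m u := (nm k m u - np k m u) / m.

Lemma chi_ratio_eq S u : admissible S -> 0 <= u ->
  chi_ratio S u ^ 2 * (1 + 2 / 3 * quad S * (u * chi_ratio S u) + cub S / 2 * (u * chi_ratio S u) ^ 2) = 1.
Proof.
  intros hS hu. pose proof (chi_ratio_mul S hS u) as hc. pose proof (chi_bounds S hS u hu) as hb.
  pose proof (mean_stiffness_ge1 S (chi S u) hS) as hq.
  assert (he : mean_stiffness S (chi S u) = 1 + 2 / 3 * quad S * (u * chi_ratio S u) + cub S / 2 * (u * chi_ratio S u) ^ 2).
  { unfold mean_stiffness. rewrite Rabs_pos_eq by lra. now rewrite <- hc. }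
  rewrite <- he. unfold chi_ratio. destruct (sqrt_ge1 _ hq).
  rewrite <- (sqrt_sqrt (mean_stiffness S (chi S u))) at 2 by lra. field; lra.
Qed.

Let np_eq k m u : param_dom k m u ->
  0 < np k m u <= 1 /\
  np k m u ^ 2 * (1 + 2 / 3 * k * (u * np k m u) + m / 2 * (u * np k m u) ^ 2) = 1.
Proof.
  intros hd. split; [apply chi_ratio_bounds, (right_admissible k m u hd)|].
  apply (chi_ratio_eq (right_side k m) u (right_admissible k m u hd)). destruct hd; lra.
Qed.

Let nm_eq k m u : param_dom k m u ->
  0 < nm k m u <= 1 /\ nm k m u ^ 2 * (1 + 2 / 3 * k * (u * nm k m u)) = 1.
Proof.
  intros hd. split; [apply chi_ratio_bounds, (left_admissible k m u hd)|].
  assert (hu : 0 <= u) by (destruct hd; lra).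
  pose proof (chi_ratio_eq (left_side k m) u (left_admissible k m u hd) hu) as h.
  fold (nm k m u) in h. cbn [quad cub left_side] in h. rewrite <- h at 2. field.
Qed.

Let lower n k m u : param_dom k m u -> 0 < n <= 1 -> 0 <= m ->
  n ^ 2 * (1 + 2 / 3 * k * (u * n) + m / 2 * (u * n) ^ 2) = 1 -> / 5 <= n /\ 1 - n <= 22 * k.
Proof.
  intros [hk [hm hu]] hn _ he.
  assert (0 <= u * n <= 6) by nra.
  assert (0 <= k * (u * n) <= 6 * k) by nra.
  assert (0 <= (u * n) ^ 2 <= 36) by nra.
  assert (0 <= m * (u * n) ^ 2 <= 36 * k) by nra.
  assert (n ^ 2 <= 1) by nra.
  set (z := 2 / 3 * k * (u * n) + m / 2 * (u * n) ^ 2) in *.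
  assert (0 <= z <= 22 * k) by (unfold z; lra).
  replace (1 + 2 / 3 * k * (u * n) + m / 2 * (u * n) ^ 2) with (1 + z) in he by (unfold z; ring).
  split; [|nra]. apply Rnot_lt_le; intros hlt.
  assert (n ^ 2 < / 25) by nra. nra.
Qed.

Let near_np : near np (fun _ _ _ => 1).
Proof.
  exists 22; split; [lra|]. intros k m u hd. destruct (np_eq k m u hd) as [h1 h2].
  destruct (lower _ k m u hd h1 ltac:(destruct hd; lra) h2). rewrite Rabs_R1.
  rewrite Rabs_minus_sym, !Rabs_pos_eq by lra. lra.
Qed.

Let nm_lower k m u : param_dom k m u -> / 5 <= nm k m u /\ 1 - nm k m u <= 22 * k.
Proof.
  intros hd. destruct (nm_eq k m u hd) as [h1 h2].
  destruct hd as [hk [hm hu]].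
  assert (0 <= u * nm k m u <= 6) by nra.
  assert (0 <= k * (u * nm k m u) <= 6 * k) by nra.
  assert (nm k m u ^ 2 <= 1) by nra.
  split; [|nra]. apply Rnot_lt_le; intros hlt.
  assert (nm k m u ^ 2 < / 25) by nra. nra.
Qed.

Let np_lower k m u : param_dom k m u -> / 5 <= np k m u.
Proof.
  intros hd. destruct (np_eq k m u hd) as [h1 h2].
  now apply (lower _ k m u hd h1 ltac:(destruct hd; lra) h2).
Qed.

Let near_nm : near nm (fun _ _ _ => 1).
Proof.
  exists 22; split; [lra|]. intros k m u hd. destruct (nm_eq k m u hd) as [h1 h2].
  destruct (nm_lower k m u hd). rewrite Rabs_R1.
  rewrite Rabs_minus_sym, !Rabs_pos_eq by lra. lra.
Qed.

Let dn_eq k m u : param_dom k m u -> np k m u = nm k m u - m * dn k m u.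
Proof. intros [hk [hm _]]. unfold dn. field; lra. Qed.

(** Both potential energies equal u^2 / 2; in the difference of these two
    relations only the cubic term of the right side is left besides a multiple
    of [dn]. *)
Let near_dn : near dn (fun _ _ u => u ^ 2 / 4).
Proof.
  apply (near_ext
    (fun k m u => (/ 2 * u ^ 2 * np k m u ^ 4) *
       / (nm k m u + np k m u + 2 / 3 * k * u * (nm k m u ^ 2 + nm k m u * np k m u + np k m u ^ 2)))
    (fun k m u => (/ 2 * u ^ 2 * 1 ^ 4) * / (1 + 1 + 2 / 3 * 0 * u * (1 ^ 2 + 1 * 1 + 1 ^ 2)))).
  - intros k m u hd. destruct (np_eq k m u hd) as [h1 h2]; destruct (nm_eq k m u hd) as [h3 h4].
    destruct hd as [hk [hm hu]]. unfold dn.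
    set (a := nm k m u) in *; set (b := np k m u) in *.
    assert (0 <= k * u) by nra. assert (0 <= a ^ 2 + a * b + b ^ 2) by nra.
    assert (0 <= k * u * (a ^ 2 + a * b + b ^ 2)) by now apply Rmult_le_pos.
    assert (hQ : 0 < a + b + 2 / 3 * k * u * (a ^ 2 + a * b + b ^ 2)) by lra.
    apply Rmult_eq_reg_r with (m * (a + b + 2 / 3 * k * u * (a ^ 2 + a * b + b ^ 2))); [|nra].
    field_simplify; [|lra|lra]. nra.
  - intros; field.
  - apply near_mult; [near|]. apply (near_inv _ _ (/ 5)); [lra | near |].
    intros k m u hd. pose proof (np_lower k m u hd); destruct (nm_lower k m u hd).
    destruct hd as [hk [hm hu]].
    set (a := nm k m u) in *; set (b := np k m u) in *.
    assert (0 <= k * u) by nra. assert (0 <= a ^ 2 + a * b + b ^ 2) by nra.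
    assert (0 <= k * u * (a ^ 2 + a * b + b ^ 2)) by now apply Rmult_le_pos. lra.
Qed.

Lemma udrag_expansion : exists C, 0 <= C /\ forall k m u, param_dom k m u ->
  Rabs (udrag (right_side k m) u - udrag (left_side k m) u - m ^ 2 * psi u) <= m ^ 2 * (C * k).
Proof.
  assert (h : near (fun k m u =>
     dd - de * (u * np k m u) - p2 * (u * np k m u) ^ 2 - p3 * (u * np k m u) ^ 3 - de * (u * nm k m u)
     - al * u ^ 2 * dn k m u * (nm k m u + np k m u)
     - be * u ^ 3 * dn k m u * (nm k m u ^ 2 + nm k m u * np k m u + np k m u ^ 2))
   (fun k m u =>
     dd - de * (u * 1) - p2 * (u * 1) ^ 2 - p3 * (u * 1) ^ 3 - de * (u * 1)
     - al * u ^ 2 * (u ^ 2 / 4) * (1 + 1)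
     - be * u ^ 3 * (u ^ 2 / 4) * (1 ^ 2 + 1 * 1 + 1 ^ 2))).
  { near. }
  destruct h as [C [hC h]]. exists C; split; [exact hC|]. intros k m u hd.
  destruct (h k m u hd) as [h' _].
  match type of h' with Rabs (?X - ?Y) <= _ =>
    replace (udrag (right_side k m) u - udrag (left_side k m) u - m ^ 2 * psi u) with (m ^ 2 * (X - Y)) end.
  - apply Rabs_mult_le; [|exact h']. rewrite Rabs_pos_eq; [lra | nra].
  - unfold udrag. rewrite (chi_ratio_mul _ (right_admissible k m u hd)), (chi_ratio_mul _ (left_admissible k m u hd)).
    fold (np k m u) (nm k m u). rewrite (dn_eq k m u hd). unfold drag, psi; simpl c0; simpl c1; simpl c2; simpl c3.
    field.
Qed.

Let jp k m u := / (np k m u * (1 + k * (u * np k m u) + m * (u * np k m u) ^ 2)).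
Let jm k m u := / (nm k m u * (1 + k * (u * nm k m u))).

Let denoms k m u : param_dom k m u ->
  / 5 <= np k m u * (1 + k * (u * np k m u) + m * (u * np k m u) ^ 2) /\
  / 5 <= nm k m u * (1 + k * (u * nm k m u)).
Proof.
  intros hd. pose proof (np_lower k m u hd); destruct (nm_lower k m u hd).
  destruct hd as [hk [hm hu]].
  assert (0 <= u * np k m u) by nra. assert (0 <= u * nm k m u) by nra.
  assert (0 <= k * (u * np k m u)) by nra. assert (0 <= k * (u * nm k m u)) by nra.
  assert (0 <= (u * np k m u) ^ 2) by apply pow2_ge_0.
  assert (0 <= m * (u * np k m u) ^ 2) by nra. split; nra.
Qed.

Let near_jp : near jp (fun _ _ _ => 1).
Proof.
  apply (near_ext jp (fun _ _ u => / (1 * (1 + 0 * (u * 1) + 0 * (u * 1) ^ 2)))); [reflexivity | intros; field |].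
  apply (near_inv _ _ (/ 5)); [lra | near |].
  intros k m u hd. split; [now apply denoms | lra].
Qed.

Let near_jm : near jm (fun _ _ _ => 1).
Proof.
  apply (near_ext jm (fun _ _ u => / (1 * (1 + 0 * (u * 1))))); [reflexivity | intros; field |].
  apply (near_inv _ _ (/ 5)); [lra | near |].
  intros k m u hd. split; [now apply denoms | lra].
Qed.

Lemma udrag'_ratio S u : admissible S -> 0 <= u ->
  udrag' S u = drag' S (u * chi_ratio S u) * / (chi_ratio S u * (1 + quad S * (u * chi_ratio S u) + cub S * (u * chi_ratio S u) ^ 2)).
Proof.
  intros hS hu. unfold udrag', ampl'. pose proof (chi_ratio_mul S hS u) as hc. pose proof (chi_bounds S hS u hu) as hb.
  pose proof (stiffness_ge1 S (chi S u) hS) as hD. destruct (sqrt_ge1 _ (mean_stiffness_ge1 S (chi S u) hS)).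
  assert (he : stiffness S (chi S u) = 1 + quad S * (u * chi_ratio S u) + cub S * (u * chi_ratio S u) ^ 2).
  { unfold stiffness. rewrite Rabs_pos_eq by lra. now rewrite <- hc. }
  rewrite <- he, <- hc. unfold chi_ratio. field. split; lra.
Qed.

Lemma udrag'_expansion : exists C, 0 <= C /\ forall k m u, param_dom k m u ->
  Rabs (udrag' (right_side k m) u - udrag' (left_side k m) u - m ^ 2 * psi' u) <= m ^ 2 * (C * k).
Proof.
  assert (h : near (fun k m u =>
     jp k m u * (- de - 2 * p2 * (u * np k m u) - 3 * p3 * (u * np k m u) ^ 2) - de * jm k m u
     - jp k m u * (2 * al * u * dn k m u + 3 * be * u ^ 2 * dn k m u * (np k m u + nm k m u))
     + (2 * al * (u * nm k m u) + 3 * be * (u * nm k m u) ^ 2) * (jp k m u * jm k m u *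
         (dn k m u + k * u * dn k m u * (nm k m u + np k m u) - u ^ 2 * np k m u ^ 3)))
   (fun k m u =>
     1 * (- de - 2 * p2 * (u * 1) - 3 * p3 * (u * 1) ^ 2) - de * 1
     - 1 * (2 * al * u * (u ^ 2 / 4) + 3 * be * u ^ 2 * (u ^ 2 / 4) * (1 + 1))
     + (2 * al * (u * 1) + 3 * be * (u * 1) ^ 2) * (1 * 1 *
         (u ^ 2 / 4 + 0 * u * (u ^ 2 / 4) * (1 + 1) - u ^ 2 * 1 ^ 3)))).
  { near. }
  destruct h as [C [hC h]]. exists C; split; [exact hC|]. intros k m u hd.
  destruct (h k m u hd) as [h' _].
  match type of h' with Rabs (?X - ?Y) <= _ =>
    replace (udrag' (right_side k m) u - udrag' (left_side k m) u - m ^ 2 * psi' u) with (m ^ 2 * (X - Y)) end.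
  - apply Rabs_mult_le; [|exact h']. rewrite Rabs_pos_eq; [lra | nra].
  - pose proof hd as [hk [hm hu]].
    rewrite (udrag'_ratio _ u (right_admissible k m u hd)), (udrag'_ratio _ u (left_admissible k m u hd)) by lra.
    fold (np k m u) (nm k m u). destruct (denoms k m u hd) as [d1 d2]. unfold jp, jm.
    rewrite (dn_eq k m u hd) in *. unfold drag', psi'; simpl quad; simpl cub; simpl c0; simpl c1; simpl c2; simpl c3.
    set (a := nm k m u) in *; set (b := dn k m u) in *.
    replace (1 + k * (u * a) + 0 * (u * a) ^ 2) with (1 + k * (u * a)) by ring.
    match type of d1 with _ <= ?x * ?y => assert (x <> 0 /\ y <> 0) by (split; intros e0; rewrite e0 in d1; lra) end.
    match type of d2 with _ <= ?x * ?y => assert (x <> 0 /\ y <> 0) by (split; intros e0; rewrite e0 in d2; lra) end.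
    field. tauto.
Qed.

End Expansion.


(** * Five simple zeros of the displacement *)

(** Negative, as the integral runs from 1 to -1. *)
Definition moment (j : nat) : R := RInt (fun c => sine c ^ j) 1 (-1).

Lemma moment_neg j : moment j < 0.
Proof.
  assert (hc : forall x, continuous (fun c => sine c ^ j) x).
  { intros x; cont; apply cont_sine. }
  unfold moment. rewrite <- (opp_RInt_swap (fun c => sine c ^ j) (-1) 1) by now apply ex_RInt_cont.
  change (- RInt (fun c => sine c ^ j) (-1) 1 < 0).
  apply Ropp_lt_gt_0_contravar, RInt_gt_0; [lra | | intros; apply hc].
  intros x hx. apply pow_lt, sqrt_lt_R0. nra.
Qed.

Lemma RInt_lincomb (f g : R -> R) (a : R) :
  (forall x, continuous f x) -> (forall x, continuous g x) ->
  RInt (fun c => a * f c + g c) 1 (-1) = a * RInt f 1 (-1) + RInt g 1 (-1).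
Proof.
  intros hf hg.
  assert (haf : forall x, continuous (fun c => a * f c) x).
  { intros x; apply (cont_mult _ (fun _ => a)); [apply cont_const | apply hf]. }
  transitivity (RInt (fun c => a * f c) 1 (-1) + RInt g 1 (-1)).
  - apply (RInt_plus (fun c => a * f c) g); now apply ex_RInt_cont.
  - f_equal. apply (RInt_scal f 1 (-1) a); now apply ex_RInt_cont.
Qed.

Lemma melnikov_moments al be de p2 p3 dd r :
  melnikov (psi al be de p2 p3 dd) r =
  dd * moment 0 - 2 * de * moment 1 * r - p2 * moment 2 * r ^ 2 - p3 * moment 3 * r ^ 3
  - al / 2 * moment 4 * r ^ 4 - 3 / 4 * be * moment 5 * r ^ 5.
Proof.
  assert (hc : forall j x, continuous (fun c => sine c ^ j) x) by (intros; cont; apply cont_sine).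
  transitivity (RInt (fun c => dd * sine c ^ 0 + (- 2 * de * r * sine c ^ 1 + (- p2 * r ^ 2 * sine c ^ 2
     + (- p3 * r ^ 3 * sine c ^ 3 + (- al / 2 * r ^ 4 * sine c ^ 4 + (- 3 / 4 * be * r ^ 5 * sine c ^ 5 + 0)))))) 1 (-1)).
  - apply RInt_ext. intros x _. unfold psi. simpl; field.
  - rewrite !RInt_lincomb by (intros; cont; apply cont_sine).
    rewrite RInt_const. unfold moment, scal; simpl; unfold mult; simpl. field.
Qed.

Lemma melnikov_r_moments al be de p2 p3 r :
  melnikov_r (psi' al be de p2 p3) r =
  - 2 * de * moment 1 - 2 * p2 * moment 2 * r - 3 * p3 * moment 3 * r ^ 2
  - 4 * (al / 2) * moment 4 * r ^ 3 - 5 * (3 / 4 * be) * moment 5 * r ^ 4.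
Proof.
  assert (hc : forall j x, continuous (fun c => sine c ^ j) x) by (intros; cont; apply cont_sine).
  transitivity (RInt (fun c => - 2 * de * sine c ^ 1 + (- 2 * p2 * r * sine c ^ 2
     + (- 3 * p3 * r ^ 2 * sine c ^ 3 + (- 2 * al * r ^ 3 * sine c ^ 4 + (- 15 / 4 * be * r ^ 4 * sine c ^ 5 + 0))))) 1 (-1)).
  - apply RInt_ext. intros x _. unfold psi'. simpl; field.
  - rewrite !RInt_lincomb by (intros; cont; apply cont_sine).
    rewrite RInt_const. unfold moment, scal; simpl; unfold mult; simpl. field.
Qed.

(** The coefficients of (r - 1)...(r - 5) = r^5 - 15 r^4 + 85 r^3 - 225 r^2
    + 274 r - 120, each divided by its moment. *)
Lemma choose_coefficients : exists al be de p2 p3 dd,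
  (forall r, melnikov (psi al be de p2 p3 dd) r = (r - 1) * (r - 2) * (r - 3) * (r - 4) * (r - 5)) /\
  (forall r, melnikov_r (psi' al be de p2 p3) r = 5 * r ^ 4 - 60 * r ^ 3 + 255 * r ^ 2 - 450 * r + 274).
Proof.
  exists (30 / moment 4), (- (4 / 3) / moment 5), (- 137 / moment 1), (225 / moment 2),
    (- 85 / moment 3), (- 120 / moment 0).
  pose proof (moment_neg 0); pose proof (moment_neg 1); pose proof (moment_neg 2);
  pose proof (moment_neg 3); pose proof (moment_neg 4); pose proof (moment_neg 5).
  split; intros r; rewrite ?melnikov_moments, ?melnikov_r_moments; field; repeat split; lra.
Qed.

Definition lip (f : R -> R) : Prop := exists B, lipb 0 6 f B B.

Lemma lip_const a : lip (fun _ => a).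
Proof.
  exists (Rabs a). eapply lipb_weaken; [apply lipb_const | lra | apply Rabs_pos].
Qed.

Lemma lip_id : lip (fun x => x).
Proof. exists 6. split; intros; [rewrite Rabs_pos_eq; lra | pose proof (Rabs_pos (x - y)); lra]. Qed.

Lemma lip_plus f g : lip f -> lip g -> lip (fun x => f x + g x).
Proof. intros [B h] [C h']. exists (B + C). now apply lipb_plus. Qed.

Lemma lip_opp f : lip f -> lip (fun x => - f x).
Proof. intros [B h]. exists B. now apply lipb_opp. Qed.

Lemma lip_minus f g : lip f -> lip g -> lip (fun x => f x - g x).
Proof. intros h h'. unfold Rminus. apply lip_plus; [exact h | now apply lip_opp]. Qed.

Lemma lip_mult f g : lip f -> lip g -> lip (fun x => f x * g x).
Proof.
  intros [B h] [C h']. exists (B * C + C * B).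
  assert (0 <= B) by (apply Rle_trans with (2 := proj1 h 0 ltac:(lra)), Rabs_pos).
  assert (0 <= C) by (apply Rle_trans with (2 := proj1 h' 0 ltac:(lra)), Rabs_pos).
  eapply lipb_weaken; [apply (lipb_mult _ _ _ _ _ _ _ _ h h')| nra | nra].
Qed.

Lemma lip_pow f n : lip f -> lip (fun x => f x ^ n).
Proof. intros h; induction n; simpl; [apply lip_const | now apply lip_mult]. Qed.

Ltac lip := repeat first [ apply lip_const | apply lip_id | apply lip_minus | apply lip_plus
  | apply lip_mult | apply lip_opp | apply lip_pow ].

Lemma psi_lip al be de p2 p3 dd : exists P, 0 <= P /\
  lipb 0 6 (psi al be de p2 p3 dd) P P /\ lipb 0 6 (psi' al be de p2 p3) P P.
Proof.
  assert (h1 : lip (psi al be de p2 p3 dd)) by (unfold psi; lip).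
  assert (h2 : lip (psi' al be de p2 p3)) by (unfold psi'; lip).
  destruct h1 as [B h1]; destruct h2 as [C h2].
  assert (0 <= B) by (apply Rle_trans with (2 := proj1 h1 0 ltac:(lra)), Rabs_pos).
  assert (0 <= C) by (apply Rle_trans with (2 := proj1 h2 0 ltac:(lra)), Rabs_pos).
  exists (B + C). split; [lra | split].
  - apply (lipb_weaken _ _ _ B B); [assumption | lra | lra].
  - apply (lipb_weaken _ _ _ C C); [assumption | lra | lra].
Qed.

(** A zero of the displacement near [i] that is simple, in the form in which
    it is used: the total exponents of the two half-orbits differ. *)
Definition zero_near (Sp Sm : side) (i : R) : Prop :=
  exists r0 rp rm, i - / 100 <= r0 <= i + / 100 /\
    half_orbit Sp r0 rp /\ half_orbit Sm r0 rm /\ rp (-1) = rm (-1) /\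
    RInt (fun c => slope_r' Sp c (rp c)) 1 (-1) - RInt (fun c => slope_r' Sm c (rm c)) 1 (-1) <> 0.

Lemma root_polynomial_sign i : (i < 5)%nat ->
  (forall r, INR i + 1 - / 100 <= r <= INR i + 1 + / 100 ->
     1 <= Rabs (5 * r ^ 4 - 60 * r ^ 3 + 255 * r ^ 2 - 450 * r + 274)) /\
  let q r := (r - 1) * (r - 2) * (r - 3) * (r - 4) * (r - 5) in
  let a := INR i + 1 - / 100 in let b := INR i + 1 + / 100 in
  (q a <= - / 50 /\ / 50 <= q b \/ / 50 <= q a /\ q b <= - / 50).
Proof.
  intros hi. split.
  - intros r hr. set (t := r - (INR i + 1)).
    replace r with (INR i + 1 + t) by (unfold t; ring).
    assert (ht : - / 100 <= t <= / 100) by (unfold t; lra). clearbody t; clear r hr.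
    assert (0 <= t ^ 2 <= / 10000) by nra.
    assert (- / 10000 <= t ^ 3 <= / 10000) by (split; nra).
    assert (0 <= t ^ 4 <= / 10000) by (split; nra).
    unfold Rabs; destruct (Rcase_abs _);
      do 5 (destruct i as [|i]; [simpl in *; lra|]); lia.
  - simpl. do 5 (destruct i as [|i]; [simpl; lra|]); lia.
Qed.

(** The approximate displacement has opposite signs at i - 1/100 and i + 1/100,
    and the displacement is continuous, so it has a zero; there the difference of
    the exponents is close to a value of modulus at least [m2]. *)
Lemma zero_of_displacement Sp Sm h m2 i :
  admissible Sp -> admissible Sm -> size Sp h -> size Sm h -> h * (100 * bigK) <= 1 -> 0 < m2 -> (i < 5)%nat ->
  (forall r0 rp rm, 3 / 4 <= r0 <= 21 / 4 -> half_orbit Sp r0 rp -> half_orbit Sm r0 rm ->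
    Rabs (rp (-1) - rm (-1) - m2 * ((r0 - 1) * (r0 - 2) * (r0 - 3) * (r0 - 4) * (r0 - 5))) <= m2 * / 100 /\
    Rabs (RInt (fun c => slope_r' Sp c (rp c)) 1 (-1) - RInt (fun c => slope_r' Sm c (rm c)) 1 (-1)
        - m2 * (5 * r0 ^ 4 - 60 * r0 ^ 3 + 255 * r0 ^ 2 - 450 * r0 + 274)) <= m2 * / 100) ->
  zero_near Sp Sm (INR i + 1).
Proof.
  intros wp wm zp zm hsm hm2 hi happ.
  destruct (root_polynomial_sign i hi) as [hder hsgn].
  assert (hir : 0 <= INR i <= 4).
  { split; [apply pos_INR|]. replace 4 with (INR 4) by (simpl; lra). apply le_INR; lia. }
  set (gp := fun r0 => proj1_sig (constructive_indefinite_description _ (half_orbit_exists Sp h wp zp hsm r0))).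
  set (gm := fun r0 => proj1_sig (constructive_indefinite_description _ (half_orbit_exists Sm h wm zm hsm r0))).
  assert (hgp : forall r0, half_orbit Sp r0 (gp r0)).
  { intros r0; exact (proj2_sig (constructive_indefinite_description _ (half_orbit_exists Sp h wp zp hsm r0))). }
  assert (hgm : forall r0, half_orbit Sm r0 (gm r0)).
  { intros r0; exact (proj2_sig (constructive_indefinite_description _ (half_orbit_exists Sm h wm zm hsm r0))). }
  clearbody gp gm.
  set (D := fun r0 => gp r0 (-1) - gm r0 (-1)).
  assert (hD : continuity D).
  { intros x. apply cont_pt, cont_eps. intros e he. exists (e / 5); split; [lra|]. intros y hy.
    apply Rle_lt_trans with (2 * Rabs (y - x) + 2 * Rabs (y - x)); [|pose proof (Rabs_pos (y - x)); lra].
    unfold D. replace (gp y (-1) - gm y (-1) - (gp x (-1) - gm x (-1)))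
      with ((gp y (-1) - gp x (-1)) - (gm y (-1) - gm x (-1))) by ring.
    apply Rabs_minus_le;
      [apply (half_orbit_dependence Sp h) | apply (half_orbit_dependence Sm h)]; auto; lra. }
  set (a := INR i + 1 - / 100) in *. set (b := INR i + 1 + / 100) in *.
  assert (hab : 3 / 4 <= a <= b /\ b <= 21 / 4) by (unfold a, b; lra).
  destruct (IVT_gen D a b 0 hD) as [r0 [hr0 hz]].
  { destruct (happ a (gp a) (gm a) ltac:(lra) (hgp a) (hgm a)) as [ha _].
    destruct (happ b (gp b) (gm b) ltac:(lra) (hgp b) (hgm b)) as [hb _].
    fold (D a) in ha. fold (D b) in hb.
    apply Rabs_le_between in ha; apply Rabs_le_between in hb.
    simpl in hsgn. destruct hsgn as [[h1 h2]|[h1 h2]].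
    - assert (D a <= 0) by nra. assert (0 <= D b) by nra. rewrite Rmin_left, Rmax_right; lra.
    - assert (0 <= D a) by nra. assert (D b <= 0) by nra. rewrite Rmin_right, Rmax_left; lra. }
  rewrite Rmin_left, Rmax_right in hr0 by lra.
  exists r0, (gp r0), (gm r0). split; [exact hr0|]. split; [apply hgp|]. split; [apply hgm|].
  split; [unfold D in hz; lra|].
  destruct (happ r0 (gp r0) (gm r0) ltac:(lra) (hgp r0) (hgm r0)) as [_ h2].
  intros e0. match type of h2 with Rabs (?x - m2 * ?y) <= _ =>
    change (x = 0) in e0; rewrite e0 in h2; pose proof (hder r0 hr0) as h3; set (z := y) in * end.
  rewrite Rminus_0_l, Rabs_Ropp, Rabs_mult, Rabs_pos_eq in h2 by lra. nra.
Qed.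

(** The constant of the expansion depends on the coefficients only, so [k] can be
    fixed first, and [m] is then taken small in terms of [k] and the
    coefficients. *)
Theorem five_zeros : exists al be de p2 p3 dd k, 0 < k <= 1 /\
  exists m0, 0 < m0 /\ forall m, 0 < m < m0 -> m <= k /\
    exists h, h * (100 * bigK) <= 1 /\
      size (right_side al be de p2 p3 k m) h /\ size (left_side al be de dd k m) h /\
      forall i, (i < 5)%nat ->
        zero_near (right_side al be de p2 p3 k m) (left_side al be de dd k m) (INR i + 1).
Proof.
  destruct choose_coefficients as [al [be [de [p2 [p3 [dd [hM hM']]]]]]].
  exists al, be, de, p2, p3, dd.
  destruct (psi_lip al be de p2 p3 dd) as [P [hP [hpsi hdpsi]]].
  destruct (udrag_expansion al be de p2 p3 dd) as [C1 [hC1 e1]].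
  destruct (udrag'_expansion al be de p2 p3 dd) as [C2 [hC2 e2]].
  set (C := C1 + C2 + 1).
  set (Q := 10000 * bigK * (P + 1)).
  assert (hQ : 1 <= Q) by (unfold Q, bigK; nra).
  assert (hC : 1 <= C) by (unfold C; lra).
  (* [Q] bounds the constants of both approximations and [C] that of the expansions. *)
  set (k := / (1000 * Q * C)).
  assert (hQC : 1 <= Q * C) by nra.
  assert (hk : 0 < k) by (apply Rinv_0_lt_compat; nra).
  assert (hk1 : k * (1000 * Q * C) = 1) by (unfold k; field; split; lra).
  assert (hkC : C * k <= / 1000 /\ Q * (C * k) <= / 1000).
  { split; [|nra]. assert (0 < C * k) by nra. nra. }
  exists k. split; [split; [exact hk | nra]|].
  set (A := Rabs al + Rabs be + Rabs de + Rabs p2 + Rabs p3 + Rabs dd).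
  assert (hA : 0 <= A).
  { unfold A. pose proof (Rabs_pos al); pose proof (Rabs_pos be); pose proof (Rabs_pos de);
    pose proof (Rabs_pos p2); pose proof (Rabs_pos p3); pose proof (Rabs_pos dd). lra. }
  set (m0 := Rmin k (/ (1000 * Q * (A + 1)))).
  assert (hQA : 1 <= Q * (A + 1)) by nra.
  assert (hm0 : 0 < m0) by (apply Rmin_glb_lt; [exact hk | apply Rinv_0_lt_compat; nra]).
  exists m0. split; [exact hm0|]. intros m hm.
  assert (hmk : m <= k) by (pose proof (Rmin_l k (/ (1000 * Q * (A + 1)))); fold m0 in H; lra).
  split; [exact hmk|].
  assert (hmA : m * (1000 * Q * (A + 1)) <= 1).
  { pose proof (Rmin_r k (/ (1000 * Q * (A + 1)))) as hr; fold m0 in hr.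
    apply Rle_trans with (/ (1000 * Q * (A + 1)) * (1000 * Q * (A + 1))); [|rewrite Rinv_l; nra].
    apply Rmult_le_compat_r; nra. }
  assert (hm1 : m <= 1) by nra.
  exists (m * A).
  assert (hQh : Q * (m * A) <= / 1000) by nra.
  assert (hsm : m * A * (100 * bigK) <= 1).
  { assert (0 <= m * A) by nra. unfold Q in hQh. assert (0 < bigK) by apply bigK_pos.
    assert (100 * bigK <= 10000 * bigK * (P + 1)) by nra. nra. }
  assert (hd : forall u, 0 <= u <= 6 -> param_dom k m u) by (intros u hu; unfold param_dom; repeat split; nra).
  assert (wp : admissible (right_side al be de p2 p3 k m)) by (apply (right_admissible _ _ _ _ _ k m 0), hd; lra).
  assert (wm : admissible (left_side al be de dd k m)) by (apply (left_admissible _ _ _ _ k m 0), hd; lra).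
  assert (hsz : forall x y, Rabs x + Rabs y <= A -> Rabs (m * x - m ^ 2 * y) <= m * A
                   /\ Rabs (m ^ 2 * x) <= m * A).
  { intros x y hxy. pose proof (Rabs_pos x); pose proof (Rabs_pos y).
    assert (0 <= m ^ 2 <= m) by nra. split.
    - apply Rle_trans with (m * Rabs x + m ^ 2 * Rabs y); [|nra].
      apply Rabs_minus_le; rewrite Rabs_mult, (Rabs_pos_eq (m ^ 2)) || rewrite Rabs_mult, (Rabs_pos_eq m); lra.
    - rewrite Rabs_mult, Rabs_pos_eq by lra. nra. }
  pose proof (Rabs_pos al); pose proof (Rabs_pos be); pose proof (Rabs_pos de);
  pose proof (Rabs_pos p2); pose proof (Rabs_pos p3); pose proof (Rabs_pos dd).
  assert (hsz0 : forall x, Rabs x <= A -> Rabs (m * x) <= m * A).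
  { intros x hx. rewrite Rabs_mult, Rabs_pos_eq by lra. apply Rmult_le_compat_l; lra. }
  assert (zp : size (right_side al be de p2 p3 k m) (m * A)).
  { unfold size; simpl c0; simpl c1; simpl c2; simpl c3. rewrite Rabs_R0, Rabs_Ropp.
    split; [nra|]. split; [|split].
    - apply (hsz de 0). rewrite Rabs_R0; unfold A; lra.
    - apply hsz; unfold A; lra.
    - apply hsz; unfold A; lra. }
  assert (zm : size (left_side al be de dd k m) (m * A)).
  { unfold size; simpl c0; simpl c1; simpl c2; simpl c3. rewrite Rabs_Ropp.
    split; [|split; [|split]].
    - apply (hsz dd 0). rewrite Rabs_R0; unfold A; lra.
    - apply (hsz de 0). rewrite Rabs_R0; unfold A; lra.
    - apply hsz0; unfold A; lra.
    - apply hsz0; unfold A; lra. }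
  split; [exact hsm|]. split; [exact zp|]. split; [exact zm|].
  intros i hi. apply (zero_of_displacement _ _ (m * A) (m ^ 2)); try assumption; [nra|].
  intros r0 rp rm hr0 hrp hrm. rewrite <- hM, <- hM'.
  assert (hpc : forall u, continuous (psi al be de p2 p3 dd) u) by (intros u; unfold psi; cont; lra).
  assert (hdc : forall u, continuous (psi' al be de p2 p3) u) by (intros u; unfold psi'; cont; lra).
  assert (hm2 : 0 <= m ^ 2) by nra.
  assert (hap0 : forall u, 0 <= u <= 6 ->
    Rabs (udrag (right_side al be de p2 p3 k m) u - udrag (left_side al be de dd k m) u
          - m ^ 2 * psi al be de p2 p3 dd u) <= m ^ 2 * (C * k)).
  { intros u hu. eapply Rle_trans; [apply e1, hd, hu|]. apply Rmult_le_compat_l; [exact hm2|].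
    unfold C; nra. }
  assert (hap1 : forall u, 0 <= u <= 6 ->
    Rabs (udrag' (right_side al be de p2 p3 k m) u - udrag' (left_side al be de dd k m) u
          - m ^ 2 * psi' al be de p2 p3 u) <= m ^ 2 * (C * k)).
  { intros u hu. eapply Rle_trans; [apply e2, hd, hu|]. apply Rmult_le_compat_l; [exact hm2|].
    unfold C; nra. }
  assert (he : 0 <= C * k <= 1) by nra.
  assert (hfin : 10000 * bigK * (P + 1) * (C * k + m * A) <= / 100) by (fold Q; lra).
  assert (hnn : 0 <= bigK * (P + 1) * (C * k + m * A)).
  { pose proof bigK_pos. assert (0 <= m * A) by nra. repeat apply Rmult_le_pos; lra. }
  split.
  - eapply Rle_trans; [apply (displacement_approx _ _ (m * A) wp wm zp zm hsm _ P (m ^ 2) (C * k)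
      hpsi hpc hm2 he hap0 r0 rp rm hrp hrm hr0)|].
    rewrite Rmult_assoc. apply Rmult_le_compat_l; lra.
  - eapply Rle_trans; [apply (exponent_approx _ _ (m * A) wp wm zp zm hsm _ _ P (m ^ 2) (C * k)
      hpsi hdpsi hdc hm2 he hap0 hap1 r0 rp rm hrp hrm hr0)|].
    rewrite Rmult_assoc. apply Rmult_le_compat_l; lra.
Qed.


(** * Coordinates along orbit arcs *)

Definition zsign (z : zone) : R := match z with RightZone => 1 | LeftZone => -1 end.

(** In the coordinates X = x / sx (reflected on the left), Y = y / sy, and up to
    the time factor [w], the field on each side is that of [sd z]. *)
Definition adapted (SS : switching_system) (sx sy w : R) (sd : zone -> side) : Prop :=
  forall z x y, 0 <= zsign z * x ->
    field SS z (x, y) =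
      (sx * w * (y / sy - drag (sd z) (zsign z * x / sx)),
       - zsign z * (sy * w) * force (sd z) (zsign z * x / sx)).

Lemma ampl_sqr_derive S X : admissible S -> is_derive (fun x => ampl S x ^ 2) X (2 * force S X).
Proof.
  intros hS. apply (is_derive_eq _ _ (scal (ampl' S X) (2 * ampl S X))).
  - apply (is_derive_comp (fun u => u ^ 2) (ampl S) X); [auto_derive; [trivial | ring] | now apply ampl_derive].
  - unfold scal; simpl; unfold mult; simpl. unfold ampl', force, ampl.
    destruct (sqrt_ge1 _ (mean_stiffness_ge1 S X hS)). field; lra.
Qed.

Lemma cont_ampl S X : admissible S -> continuous (ampl S) X.
Proof. intros hS. exact (is_derive_cont _ _ _ (ampl_derive S X hS)). Qed.

Lemma ampl_ge S X : admissible S -> 0 < X -> X <= ampl S X.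
Proof. intros hS hX. unfold ampl. destruct (sqrt_ge1 _ (mean_stiffness_ge1 S X hS)). nra. Qed.

Section Coordinates.
Variables sx sy : R.
Hypotheses (hsx : 0 < sx) (hsy : 0 < sy).

Definition xabs (p : R * R) : R := Rabs (fst p) / sx.
Definition ysc (p : R * R) : R := snd p / sy.
Definition radius (S : side) (p : R * R) : R := sqrt (ysc p ^ 2 + ampl S (xabs p) ^ 2).
(** The lower bound 1/4 keeps the cosine continuous at the origin; the curves of
    interest stay at radius at least 1/2. *)
Definition cosine (S : side) (p : R * R) : R := ysc p / Rmax (/ 4) (radius S p).

Lemma cont_xabs p : continuous xabs p.
Proof. unfold xabs; cont; lra. Qed.

Lemma cont_ysc p : continuous ysc p.
Proof. unfold ysc; cont; lra. Qed.

Lemma cont_radius S p : admissible S -> continuous (radius S) p.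
Proof.
  intros hS. unfold radius.
  assert (continuous (fun q => ampl S (xabs q)) p).
  { apply (cont_comp _ (ampl S) xabs); [apply cont_xabs | now apply cont_ampl]. }
  assert (continuous (fun q => ysc q) p) by apply cont_ysc. cont.
Qed.

Lemma max_quarter r : / 4 <= Rmax (/ 4) r.
Proof. apply Rmax_l. Qed.

Lemma cont_cosine S p : admissible S -> continuous (cosine S) p.
Proof.
  intros hS. unfold cosine.
  assert (continuous (fun q => radius S q) p) by now apply cont_radius.
  assert (continuous (fun q => ysc q) p) by apply cont_ysc. cont.
  pose proof (max_quarter (radius S p)); lra.
Qed.

Lemma ysc_le_radius S p : Rabs (ysc p) <= radius S p.
Proof.
  unfold radius. rewrite <- (sqrt_Rsqr_abs (ysc p)). apply sqrt_le_1_alt.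
  unfold Rsqr. pose proof (pow2_ge_0 (ampl S (xabs p))). lra.
Qed.

Lemma cosine_bounds S p : -1 <= cosine S p <= 1.
Proof.
  unfold cosine. pose proof (ysc_le_radius S p) as h. pose proof (Rmax_r (/ 4) (radius S p)).
  pose proof (max_quarter (radius S p)). apply Rabs_le_between in h.
  split; apply Rmult_le_reg_r with (Rmax (/ 4) (radius S p)); try lra;
  unfold Rdiv; rewrite Rmult_assoc, Rinv_l; lra.
Qed.

Lemma radius_sqr S p : radius S p ^ 2 = ysc p ^ 2 + ampl S (xabs p) ^ 2.
Proof.
  unfold radius. rewrite pow2_sqrt; [reflexivity|].
  pose proof (pow2_ge_0 (ysc p)); pose proof (pow2_ge_0 (ampl S (xabs p))); lra.
Qed.

Lemma cosine_far S p : / 4 <= radius S p -> cosine S p * radius S p = ysc p.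
Proof. intros h. unfold cosine. rewrite Rmax_right by exact h. field. lra. Qed.

Lemma radius_sine S p : admissible S -> / 4 <= radius S p -> radius S p * sine (cosine S p) = ampl S (xabs p).
Proof.
  intros hS h. pose proof (cosine_bounds S p) as hc. pose proof (cosine_far S p h) as hy.
  pose proof (radius_sqr S p) as hr.
  assert (hU : 0 <= ampl S (xabs p)).
  { unfold ampl. apply Rmult_le_pos; [|apply sqrt_pos]. unfold xabs.
    apply Rdiv_le_0_compat; [apply Rabs_pos | exact hsx]. }
  apply Rsqr_inj; [apply Rmult_le_pos; [lra | apply sine_bounds] | exact hU |].
  unfold Rsqr. replace (radius S p * sine (cosine S p) * (radius S p * sine (cosine S p)))
    with (radius S p ^ 2 * (sine (cosine S p) * sine (cosine S p))) by ring.
  unfold sine. rewrite sqrt_sqrt by nra.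
  replace (radius S p ^ 2 * (1 - cosine S p ^ 2)) with (radius S p ^ 2 - (cosine S p * radius S p) ^ 2) by ring.
  rewrite hy, hr. ring.
Qed.

Lemma xabs_chi S p : admissible S -> / 4 <= radius S p -> chi S (radius S p * sine (cosine S p)) = xabs p.
Proof. intros hS h. rewrite radius_sine by assumption. now apply chi_ampl. Qed.

Lemma radius_axis S p : fst p = 0 -> radius S p = Rabs (ysc p).
Proof.
  intros h. unfold radius, xabs. rewrite h, Rabs_R0. unfold Rdiv at 1. rewrite Rmult_0_l.
  unfold ampl. rewrite Rmult_0_l. rewrite <- sqrt_Rsqr_abs. f_equal. unfold Rsqr; ring.
Qed.

Lemma cosine_axis S p : fst p = 0 -> / 4 <= Rabs (ysc p) ->
  (0 < ysc p /\ cosine S p = 1) \/ (ysc p < 0 /\ cosine S p = -1).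
Proof.
  intros h h4. pose proof (cosine_far S p) as hc. rewrite radius_axis in hc by exact h.
  specialize (hc h4). unfold Rabs in *. destruct (Rcase_abs (ysc p)); [right | left]; split; nra.
Qed.

Section Along.
Variables (SS : switching_system) (w : R) (sd : zone -> side) (z : zone).
Hypotheses (hw : 0 < w) (had : adapted SS sx sy w sd) (hS : admissible (sd z)).
Variables (gam : R -> R * R) (t : R).
Let S := sd z.
Let sg0 := zsign z.
Hypothesis hx : 0 < sg0 * fst (gam t).
Hypothesis dx : is_derive (fun s => fst (gam s)) t (fst (field SS z (gam t))).
Hypothesis dy : is_derive (fun s => snd (gam s)) t (snd (field SS z (gam t))).
Hypothesis hfar : / 4 < radius S (gam t).

Let X := xabs (gam t).
Let Y := ysc (gam t).
Let r := radius S (gam t).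
Let c := cosine S (gam t).

Let hsg : sg0 * sg0 = 1.
Proof. unfold sg0; destruct z; simpl; ring. Qed.

Let xabs_eq x : 0 < sg0 * x -> Rabs x = sg0 * x.
Proof.
  clear. intros h. unfold sg0 in *. destruct z; simpl in *.
  - rewrite Rabs_pos_eq; lra.
  - rewrite Rabs_left; lra.
Qed.

Let cont_x : continuous (fun s => fst (gam s)) t.
Proof. exact (is_derive_cont _ _ _ dx). Qed.

Let field_eq : field SS z (gam t) =
  (sx * w * (Y - drag S X), - sg0 * (sy * w) * force S X).
Proof.
  pose proof (had z (fst (gam t)) (snd (gam t)) ltac:(unfold sg0 in hx; lra)) as h.
  rewrite <- surjective_pairing in h. rewrite h. unfold X, Y, xabs, ysc.
  rewrite xabs_eq by exact hx. reflexivity.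
Qed.

Lemma xabs_derive : is_derive (fun s => xabs (gam s)) t (sg0 * w * (Y - drag S X)).
Proof.
  apply (derive_ext_loc (fun s => sg0 / sx * fst (gam s))).
  - assert (hc : continuous (fun s => sg0 * fst (gam s)) t) by (cont).
    pose proof (hc _ (locally_pos _ hx)) as hl. unfold filtermap in hl.
    apply filter_imp with (2 := hl). intros s hs. unfold xabs. rewrite xabs_eq by exact hs. field; lra.
  - rewrite field_eq in dx; simpl in dx.
    apply (is_derive_eq _ _ (sg0 / sx * (sx * w * (Y - drag S X)))); [|field; lra].
    apply (is_derive_scal (fun s => fst (gam s)) t (sg0 / sx)), dx.
Qed.

Lemma ysc_derive : is_derive (fun s => ysc (gam s)) t (- sg0 * w * force S X).
Proof.
  apply (derive_ext_loc (fun s => / sy * snd (gam s))); [apply filter_forall; intros; unfold ysc; field; lra|].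
  rewrite field_eq in dy; simpl in dy.
  apply (is_derive_eq _ _ (/ sy * (- sg0 * (sy * w) * force S X))); [|field; lra].
  apply (is_derive_scal (fun s => snd (gam s)) t (/ sy)), dy.
Qed.

(** r r' = Y Y' + force X', in which the products Y force cancel. *)
Lemma radius_derive : is_derive (fun s => radius S (gam s)) t (- sg0 * w * force S X * drag S X / r).
Proof.
  assert (h2 : is_derive (fun s => ampl S (xabs (gam s)) ^ 2) t (sg0 * w * (Y - drag S X) * (2 * force S X))).
  { apply (is_derive_comp (fun x => ampl S x ^ 2) (fun s => xabs (gam s)) t); [|apply xabs_derive].
    now apply ampl_sqr_derive. }
  unfold radius.
  assert (h1 : is_derive (fun s => ysc (gam s) ^ 2) t (2 * Y * (- sg0 * w * force S X))).
  { apply (is_derive_eq _ _ (scal (- sg0 * w * force S X) (2 * Y))).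
    - apply (is_derive_comp (fun x => x ^ 2) (fun s => ysc (gam s)) t); [|apply ysc_derive].
      auto_derive; [trivial | unfold Y; ring].
    - unfold scal; simpl; unfold mult; simpl; ring. }
  apply (is_derive_eq _ _ ((2 * Y * (- sg0 * w * force S X) + sg0 * w * (Y - drag S X) * (2 * force S X)) /
     (2 * sqrt (ysc (gam t) ^ 2 + ampl S (xabs (gam t)) ^ 2)))).
  - apply (is_derive_sqrt (fun s => ysc (gam s) ^ 2 + ampl S (xabs (gam s)) ^ 2)).
    + exact (is_derive_plus _ _ _ _ _ h1 h2).
    + pose proof (radius_sqr S (gam t)). nra.
  - fold (radius S (gam t)). fold r. unfold r. field. lra.
Qed.

Lemma cosine_derive : is_derive (fun s => cosine S (gam s)) t
  (- sg0 * w * force S X / r ^ 2 * (r - c * drag S X)).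
Proof.
  apply (derive_ext_loc (fun s => ysc (gam s) / radius S (gam s))).
  - pose proof (is_derive_cont _ _ _ radius_derive) as hc.
    assert (hc' : continuous (fun s => radius S (gam s) - / 4) t) by cont.
    assert (hp : 0 < radius S (gam t) - / 4) by lra.
    pose proof (hc' _ (locally_pos _ hp)) as hl. unfold filtermap in hl.
    apply filter_imp with (2 := hl). intros s hs. unfold cosine. rewrite Rmax_right by lra. reflexivity.
  - pose proof (cosine_far S (gam t) ltac:(lra)) as hcf. fold c r Y in hcf.
    fold r in hfar.
    apply (is_derive_eq _ _ ((- sg0 * w * force S X * r - Y * (- sg0 * w * force S X * drag S X / r)) / r ^ 2)).
    + apply (is_derive_div (fun s => ysc (gam s)) (fun s => radius S (gam s)) t);
        [apply ysc_derive | apply radius_derive | fold r; lra].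
    + rewrite <- hcf. field. lra.
Qed.

Lemma force_pos : 0 < force S X.
Proof.
  unfold force. apply Rmult_lt_0_compat.
  - unfold X, xabs. rewrite xabs_eq by exact hx. apply Rdiv_lt_0_compat; assumption.
  - pose proof (stiffness_ge1 S X hS); lra.
Qed.

Lemma cosine_inside : -1 < c < 1.
Proof.
  pose proof (cosine_bounds S (gam t)) as hb. fold c in hb.
  pose proof (radius_sine S (gam t) hS ltac:(lra)) as h. fold c in h.
  assert (hX : 0 < xabs (gam t)).
  { unfold xabs. rewrite xabs_eq by exact hx. apply Rdiv_lt_0_compat; assumption. }
  pose proof (ampl_ge S _ hS hX) as hU. fold S in hU.
  assert (c <> 1 /\ c <> -1); [|lra].
  split; intros e; unfold sine in h; rewrite e in h;
  [replace (1 - 1 ^ 2) with 0 in h by ring | replace (1 - (-1) ^ 2) with 0 in h by ring];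
  rewrite sqrt_0 in h; lra.
Qed.

End Along.
End Coordinates.

(** * A transversal function near a closed curve *)

Lemma locally_interval_eps (P : R -> Prop) t : locally t P ->
  exists d, 0 < d /\ forall s, t - d < s < t + d -> P s.
Proof.
  intros [d hd]. exists d; split; [apply cond_pos|]. intros s hs. apply hd.
  apply Rabs_def1; unfold minus, plus, opp; simpl; lra.
Qed.

Lemma cont_locally_pos (f : R -> R) t : continuous f t -> 0 < f t -> locally t (fun s => 0 < f s).
Proof. intros hc hp. exact (hc _ (locally_pos _ hp)). Qed.

Lemma increasing_of_derive (f : R -> R) (a b : R) : a < b ->
  (forall s, a <= s <= b -> continuous f s) ->
  (forall s, a < s < b -> exists l, is_derive f s l /\ 0 < l) -> f a < f b.
Proof.
  intros hab hc hder.
  destruct (mean_value f (Derive f) a b hab) as [x [hx e]].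
  - intros x hx. destruct (hder x hx) as [l [h _]]. apply Derive_correct. now exists l.
  - exact hc.
  - destruct (hder x hx) as [l [h hl]]. rewrite (is_derive_unique _ _ _ h) in e. nra.
Qed.

Lemma rising_of_derive (f : R -> R) (t d : R) :
  0 < d -> (forall s, t - d < s < t + d -> continuous f s) ->
  (forall s, t - d < s < t + d -> s <> t -> exists l, is_derive f s l /\ 0 < l) -> rising f t.
Proof.
  intros hd hc hder. exists d; split; [exact hd|].
  split; intros s hs; apply increasing_of_derive; try lra.
  1, 3: intros x hx; apply hc; lra.
  1, 2: intros x hx; apply hder; lra.
Qed.

(** A crossing point is the only instant of a motion that need not be interior
    to an arc. *)
Lemma solution_arcs SS gam t : solution SS gam ->
  exists a b, a < t < b /\ forall s, a < s < b -> s <> t ->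
    exists z a' b', a' < s < b' /\ orbit_arc SS z gam a' b'.
Proof.
  intros hs. destruct (hs t) as [_ [a [b [hab [[z hz]|[_ [z [h1 h2]]]]]]]]; exists a, b; split; try exact hab.
  - intros s h _. now exists z, a, b.
  - intros s h hne. destruct (Rlt_le_dec s t).
    + exists z, a, t. split; [lra | exact h1].
    + exists (other_zone z), t, b. split; [lra | exact h2].
Qed.

Section Cycle.
Variables (SS : switching_system) (sx sy w : R) (sd : zone -> side) (h r0 rate : R) (orb : zone -> R -> R).
Hypotheses (hsx : 0 < sx) (hsy : 0 < sy) (hw : 0 < w) (had : adapted SS sx sy w sd).
Hypotheses (hwf : forall z, admissible (sd z)) (hsize : forall z, size (sd z) h) (hsmall : h * (100 * bigK) <= 1).
Hypothesis hR : forall z, half_orbit (sd z) r0 (orb z).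
Hypothesis hr0 : 3 / 4 <= r0 <= 21 / 4.
Hypothesis hmatch : orb RightZone (-1) = orb LeftZone (-1).

(** The integral of [slope_r] along a half-orbit is the logarithm of its
    contraction factor.  The shift by [rate], with opposite signs on the two
    sides, makes the totals agree ([hbal]), so that [level] below is continuous
    after a full turn. *)
Definition exponent_density (z : zone) (c : R) : R := slope_r' (sd z) c (orb z c) - zsign z * rate.
Definition exponent (z : zone) (c : R) : R := RInt (exponent_density z) 1 c.

Hypothesis hkk : rate <> 0.
Hypothesis hbal : exponent RightZone (-1) = exponent LeftZone (-1).

Let rad z p := radius sx sy (sd z) p.
Let cosn z p := cosine sx sy (sd z) p.
Let yy p := ysc sy p.

Lemma cont_exponent_density z c : continuous (exponent_density z) c.
Proof.
  unfold exponent_density. apply (cont_minus _ (fun c => slope_r' (sd z) c (orb z c))); [|apply cont_const].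
  apply (cont_slope_r' (sd z) h (hwf z) (hsize z) hsmall). apply hR.
Qed.

Lemma cont_exponent z c : continuous (exponent z) c.
Proof. apply cont_RInt, cont_exponent_density. Qed.

Lemma exponent_derive z c : is_derive (exponent z) c (exponent_density z c).
Proof. apply derive_RInt, cont_exponent_density. Qed.

Lemma exponent_1 z : exponent z 1 = 0.
Proof. apply (RInt_point (V := R_CompleteNormedModule)). Qed.

Definition exponent_max : R := 2 * (bigK * h + Rabs rate).

Lemma exponent_bound z c : -1 <= c <= 1 -> Rabs (exponent z c) <= exponent_max.
Proof.
  intros hc. apply RInt_bound; [apply cont_exponent_density | | exact hc].
  intros x hx. unfold exponent_density. apply Rabs_minus_le.
  - apply (slope_r'_bound (sd z) h); auto.
  - destruct z; simpl; [rewrite Rmult_1_l; lra|].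
    replace (-1 * rate) with (- rate) by ring. rewrite Rabs_Ropp; lra.
Qed.

Definition offset (z : zone) (p : R * R) : R := rad z p - orb z (cosn z p).
Definition weight (z : zone) (p : R * R) : R := exp (- exponent z (cosn z p)).
(** Chosen so that [Rabs (level p) < width] implies
    [Rabs (offset z p) < Rabs rate] and a radius between 1/2 and 11/2. *)
Definition width : R := Rmin (Rabs rate) (/ 8) * exp (- exponent_max).
(** The truncation from below makes both sides agree on the whole switching line:
    near the origin, where the cosines on the line are not 1 or -1, both are
    equal to [- width]. *)
Definition level_in (z : zone) (p : R * R) : R := Rmax (- width) (offset z p * weight z p).
Definition level (p : R * R) : R := if Rle_dec 0 (fst p) then level_in RightZone p else level_in LeftZone p.

Lemma min_pos : 0 < Rmin (Rabs rate) (/ 8).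
Proof. apply Rmin_glb_lt; [now apply Rabs_pos_lt | lra]. Qed.

Lemma width_pos : 0 < width.
Proof. apply Rmult_lt_0_compat; [apply min_pos | apply exp_pos]. Qed.

Lemma weight_lower z p : exp (- exponent_max) <= weight z p.
Proof.
  unfold weight. pose proof (exponent_bound z (cosn z p) (cosine_bounds sx sy (sd z) p)) as hb.
  apply Rabs_le_between in hb.
  destruct (Rle_lt_or_eq_dec (- exponent_max) (- exponent z (cosn z p))) as [hl|he]; [lra | |rewrite he; lra].
  apply Rlt_le, exp_increasing, hl.
Qed.

Lemma weight_pos z p : 0 < weight z p.
Proof. apply exp_pos. Qed.

Lemma cont_rad z p : continuous (rad z) p.
Proof. apply cont_radius; auto. Qed.

Lemma cont_cosn z p : continuous (cosn z) p.
Proof. apply cont_cosine; auto. Qed.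

Lemma cont_offset z p : continuous (offset z) p.
Proof.
  unfold offset. apply cont_minus; [apply cont_rad|].
  apply (cont_comp _ (orb z)); [apply cont_cosn | apply hR].
Qed.

Lemma cont_weight z p : continuous (weight z) p.
Proof.
  unfold weight. apply cont_exp, cont_opp.
  apply (cont_comp _ (exponent z)); [apply cont_cosn | apply cont_exponent].
Qed.

Lemma cont_level_in z p : continuous (level_in z) p.
Proof. unfold level_in. apply cont_max; [apply cont_const | apply cont_mult; [apply cont_offset | apply cont_weight]]. Qed.

Lemma orb_range z c : -1 <= c <= 1 -> 73 / 100 <= orb z c <= 527 / 100.
Proof.
  intros hc. pose proof (half_orbit_near (sd z) h (hwf z) (hsize z) hsmall r0 (orb z) (hR z) c hc) as hn.
  apply Rabs_le_between in hn. pose proof (size_nonneg (sd z) h (hsize z)). pose proof bigK_pos. nra.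
Qed.

Lemma orb_1 z : orb z 1 = r0.
Proof. exact (half_orbit_start (sd z) r0 (orb z) (hR z)). Qed.

Lemma level_in_axis p : fst p = 0 -> level_in RightZone p = level_in LeftZone p.
Proof.
  intros hp. destruct (Rle_dec (/ 4) (Rabs (yy p))) as [h4|h4].
  - unfold level_in, offset, weight. unfold rad. rewrite !radius_axis by exact hp.
    destruct (cosine_axis sx sy (sd RightZone) p hp h4) as [[hy e1]|[hy e1]];
    destruct (cosine_axis sx sy (sd LeftZone) p hp h4) as [[hy' e2]|[hy' e2]]; try lra;
    unfold cosn; rewrite e1, e2.
    + now rewrite !orb_1, !exponent_1.
    + now rewrite hmatch, hbal.
  - assert (hlow : forall z, level_in z p = - width); [|now rewrite !hlow].
    intros z. unfold level_in. apply Rmax_left.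
    pose proof (weight_lower z p) as hwl. pose proof (exp_pos (- exponent_max)).
    assert (hd : offset z p <= - / 8).
    { unfold offset, rad. rewrite radius_axis by exact hp. change (ysc sy p) with (yy p).
      pose proof (orb_range z (cosn z p) (cosine_bounds sx sy (sd z) p)). lra. }
    unfold width. pose proof (Rmin_r (Rabs rate) (/ 8)). pose proof min_pos. nra.
Qed.

Lemma cont_glue (f g : R * R -> R) p :
  continuous f p -> continuous g p -> (fst p = 0 -> f p = g p) ->
  continuous (fun q => if Rle_dec 0 (fst q) then f q else g q) p.
Proof.
  intros hf hg he.
  destruct (Rtotal_order (fst p) 0) as [hlt|[h0|hgt]].
  - apply (continuous_ext_loc _ g); [|exact hg].
    pose proof (cont_fst p _ (locally_neg _ hlt)) as hl. unfold filtermap in hl.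
    apply filter_imp with (2 := hl). intros q hq. destruct (Rle_dec 0 (fst q)) as [hn|]; [destruct (Rlt_not_le _ _ hq hn) | reflexivity].
  - intros P hP. unfold filtermap.
    destruct (Rle_dec 0 (fst p)) as [_|]; [|lra].
    pose proof (hf P hP) as h1. rewrite he in hP by exact h0. pose proof (hg P hP) as h2.
    unfold filtermap in h1, h2. pose proof (filter_and _ _ h1 h2) as h3.
    apply filter_imp with (2 := h3). intros q [hq1 hq2]. destruct (Rle_dec 0 (fst q)); assumption.
  - apply (continuous_ext_loc _ f); [|exact hf].
    pose proof (cont_fst p _ (locally_pos _ hgt)) as hl. unfold filtermap in hl.
    apply filter_imp with (2 := hl). intros q hq. destruct (Rle_dec 0 (fst q)) as [|hn]; [reflexivity | destruct (hn (Rlt_le _ _ hq))].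
Qed.

Lemma cont_level p : continuous level p.
Proof. unfold level. apply cont_glue; [apply cont_level_in | apply cont_level_in | apply level_in_axis]. Qed.

Lemma level_zone z p : 0 <= zsign z * fst p -> level p = level_in z p.
Proof.
  intros hz. unfold level. destruct (Rle_dec 0 (fst p)) as [hp|hp]; destruct z; simpl in hz; try reflexivity.
  - apply level_in_axis; lra.
  - lra.
Qed.

Lemma level_in_inside z p : Rabs (level_in z p) < width ->
  level_in z p = offset z p * weight z p /\ Rabs (offset z p) < Rabs rate /\ Rabs (offset z p) < / 8 /\ / 2 < rad z p < 11 / 2.
Proof.
  intros hW. assert (he : level_in z p = offset z p * weight z p).
  { unfold level_in in *. unfold Rmax in *. destruct (Rle_dec _ _) as [|]; [reflexivity|].
    rewrite Rabs_Ropp, Rabs_pos_eq in hW by (apply Rlt_le, width_pos). lra. }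
  split; [exact he|]. rewrite he, Rabs_mult, (Rabs_pos_eq (weight z p)) in hW by apply Rlt_le, weight_pos.
  pose proof (weight_lower z p) as hwl. pose proof (exp_pos (- exponent_max)) as hep.
  assert (hd : Rabs (offset z p) < Rmin (Rabs rate) (/ 8)).
  { apply Rnot_le_lt; intros hc. pose proof min_pos. unfold width in hW.
    assert (Rmin (Rabs rate) (/ 8) * exp (- exponent_max) <= Rabs (offset z p) * weight z p); [|lra].
    apply Rmult_le_compat; lra. }
  pose proof (Rmin_r (Rabs rate) (/ 8)); pose proof (Rmin_l (Rabs rate) (/ 8)).
  split; [lra|]. split; [lra|].
  assert (h8 : Rabs (offset z p) < / 8) by lra. apply Rabs_def2 in h8. unfold offset in h8.
  pose proof (orb_range z (cosn z p) (cosine_bounds sx sy (sd z) p)). lra.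
Qed.

(** On an arc of the closed right half-plane, a point of the switching line would
    be a minimum of x, hence x' = 0 there; but x' is close to Y, which is of
    modulus at least 1/2. *)
Lemma arc_off_axis z gam a b t : orbit_arc SS z gam a b -> a < t < b ->
  Rabs (level (gam t)) < width -> 0 < zsign z * fst (gam t).
Proof.
  intros harc hab hW. destruct (harc t hab) as [hz [dx _]].
  destruct z; simpl in *; [|lra].
  destruct (Req_dec (fst (gam t)) 0) as [e|]; [exfalso|lra].
  rewrite (level_zone RightZone) in hW by (simpl; lra).
  destruct (level_in_inside RightZone (gam t) hW) as [_ [_ [_ hr]]].
  assert (hd : fst (field SS RightZone (gam t)) = 0).
  { apply is_derive_Reals in dx. simpl.
    assert (pr : derivable_pt (fun s => fst (gam s)) t) by (eexists; exact dx).
    rewrite <- (derive_pt_eq_0 _ _ _ pr dx).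
    apply (deriv_minimum (fun s => fst (gam s)) a b t pr); [lra | lra |].
    intros x h1 h2. destruct (harc x (conj h1 h2)) as [h3 _]. simpl in h3. lra. }
  pose proof (had RightZone (fst (gam t)) (snd (gam t)) ltac:(simpl; lra)) as hf.
  rewrite <- surjective_pairing in hf. rewrite hf, e in hd; simpl in hd.
  replace (1 * 0 / sx) with 0 in hd by (field; lra).
  unfold rad in hr. rewrite radius_axis in hr by exact e. unfold ysc in hr.
  destruct (hsize RightZone) as [hc0 _]. unfold drag in hd.
  assert (hz0 : snd (gam t) / sy = c0 (sd RightZone)).
  { assert (0 < sx * w) by now apply Rmult_lt_0_compat. nra. }
  rewrite hz0 in hr. unfold bigK in hsmall. lra.
Qed.

Lemma arc_cosine z gam a b t : orbit_arc SS z gam a b -> a < t < b ->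
  Rabs (level (gam t)) < width ->
  exists l, is_derive (fun s => cosn z (gam s)) t l /\ zsign z * l < 0.
Proof.
  intros harc hab hW. pose proof (arc_off_axis z gam a b t harc hab hW) as hx.
  destruct (harc t hab) as [_ [dx dy]].
  rewrite (level_zone z) in hW by lra. destruct (level_in_inside z _ hW) as [_ [_ [_ hr]]].
  eexists. split.
  - apply (cosine_derive sx sy hsx hsy SS w sd z had (hwf z) gam t hx dx dy). unfold rad in hr; lra.
  - pose proof (force_pos sx hsx sd z (hwf z) gam t hx) as hg.
    pose proof (cosine_bounds sx sy (sd z) (gam t)) as hc.
    set (c := cosine sx sy (sd z) (gam t)) in *.
    assert (hF : Rabs (drag (sd z) (xabs sx (gam t))) <= 259 * h).
    { rewrite <- (xabs_chi sx sy hsx (sd z) (gam t) (hwf z)) by (unfold rad in hr; lra).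
      unfold rad in hr. apply (udrag_lipb (sd z) h (hwf z) (hsize z)), arg_range; lra. }
    apply Rabs_le_between in hF. unfold rad in hr.
    set (r := radius sx sy (sd z) (gam t)) in *. set (F := drag _ _) in *. set (g := force _ _) in *.
    assert (259 * h <= / 8) by (unfold bigK in hsmall; lra).
    assert (0 < r - c * F) by nra.
    assert (hss : zsign z * zsign z = 1) by (destruct z; simpl; ring).
    replace (zsign z * (- zsign z * w * g / r ^ 2 * (r - c * F)))
      with (- ((zsign z * zsign z) * (w * g * / r ^ 2 * (r - c * F)))) by (field; lra).
    rewrite hss, Rmult_1_l. apply Ropp_lt_gt_0_contravar.
    assert (0 < / r ^ 2) by (apply Rinv_0_lt_compat; nra).
    clearbody g. repeat apply Rmult_lt_0_compat; assumption.
Qed.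

(** The logarithmic derivative of [offset] with respect to the cosine is
    [slope_r] on the curve, up to an error bounded by the offset itself.  The
    weight removes [slope_r] and leaves [zsign z * rate], which dominates the
    error; and the cosine decreases on the right and increases on the left. *)
Lemma arc_level z gam a b t : orbit_arc SS z gam a b -> a < t < b ->
  (forall s, continuous gam s) -> Rabs (level (gam t)) < width -> level (gam t) <> 0 ->
  exists l, is_derive (fun s => level (gam s)) t l /\ l * (rate * level (gam t)) < 0.
Proof.
  intros harc hab hgam hW hne. pose proof (arc_off_axis z gam a b t harc hab hW) as hx.
  destruct (arc_cosine z gam a b t harc hab hW) as [l [hl hls]].
  destruct (harc t hab) as [_ [dx dy]].
  pose proof hW as hWz. rewrite (level_zone z) in hWz by lra.
  destruct (level_in_inside z _ hWz) as [hWe [hdk [_ hr]]].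
  rewrite (level_zone z) in hne |- * by lra. rewrite hWe in hne |- *.
  set (p := gam t) in *.
  pose proof (cosine_inside sx sy hsx sd z (hwf z) gam t hx ltac:(unfold rad, p in hr; lra)) as hci.
  fold p in hci. change (cosine sx sy (sd z) p) with (cosn z p) in hci.
  set (c := cosn z p) in *. set (r := rad z p) in *.
  assert (hrd : is_derive (fun s => rad z (gam s)) t (slope (sd z) c r * l)).
  { pose proof (cosine_derive sx sy hsx hsy SS w sd z had (hwf z) gam t hx dx dy
      ltac:(unfold r, rad, p in hr; lra)) as hl2.
    assert (hle : l = - zsign z * w * force (sd z) (xabs sx p) / r ^ 2 * (r - c * drag (sd z) (xabs sx p))).
    { rewrite <- (is_derive_unique _ _ _ hl). apply is_derive_unique, hl2. }
    eapply is_derive_eq; [apply (radius_derive sx sy hsx hsy SS w sd z had (hwf z) gam t hx dx dy);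
      unfold r, rad, p in hr; lra|].
    fold p. change (radius sx sy (sd z) p) with r. rewrite hle. unfold slope.
    pose proof (xabs_chi sx sy hsx (sd z) p (hwf z) ltac:(unfold r, rad in hr; lra)) as hxc.
    change (radius sx sy (sd z) p) with r in hxc. change (cosine sx sy (sd z) p) with c in hxc.
    pose proof (denom_pos (sd z) h (hwf z) (hsize z) hsmall c r ltac:(lra) ltac:(lra)) as hdp.
    unfold udrag in *. rewrite hxc in *. field. split; lra. }
  assert (hRd : is_derive (fun s => orb z (cosn z (gam s))) t (l * slope (sd z) c (orb z c))).
  { apply (derive_comp (orb z) (fun s => cosn z (gam s))); [|exact hl].
    apply (half_orbit_derive (sd z) h (hwf z) (hsize z) hsmall r0); auto. }
  assert (hwt : is_derive (fun s => weight z (gam s)) t (l * - exponent_density z c * weight z p)).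
  { apply (is_derive_eq _ _ ((l * - exponent_density z c) * exp (- exponent z c))); [|reflexivity].
    unfold weight. apply (derive_comp exp (fun s => - exponent z (cosn z (gam s)))).
    - apply is_derive_Reals, derivable_pt_lim_exp.
    - apply (derive_comp (fun c => - exponent z c) (fun s => cosn z (gam s))); [|exact hl].
      apply (is_derive_opp (exponent z) c (exponent_density z c)), exponent_derive. }
  exists ((slope (sd z) c r * l - l * slope (sd z) c (orb z c)) * weight z p
          + offset z p * (l * - exponent_density z c * weight z p)).
  split.
  - apply (derive_ext_loc (fun s => offset z (gam s) * weight z (gam s))).
    + assert (hcx : continuous (fun s => zsign z * fst (gam s)) t).
      { apply (cont_mult _ (fun _ => zsign z)); [apply cont_const|].
        exact (is_derive_cont _ _ _ dx). }
      assert (hcW : continuous (fun s => width - Rabs (level (gam s))) t).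
      { apply (cont_minus _ (fun _ => width)); [apply cont_const|]. apply cont_abs.
        apply (continuous_comp gam level); [apply hgam | apply cont_level]. }
      assert (hWp : 0 < width - Rabs (level (gam t))) by (fold p; lra).
      pose proof (filter_and _ _ (cont_locally_pos _ _ hcx hx) (cont_locally_pos _ _ hcW hWp)) as hl3.
      apply filter_imp with (2 := hl3). intros s [h1 h2].
      rewrite (level_zone z) in h2 |- * by lra. symmetry. apply level_in_inside. lra.
    + apply (is_derive_eq _ _ ((slope (sd z) c r * l - l * slope (sd z) c (orb z c)) * weight z (gam t)
          + offset z (gam t) * (l * - exponent_density z c * weight z p))); [|reflexivity].
      apply (is_derive_mult (fun s => offset z (gam s)) (fun s => weight z (gam s)) t); [|exact hwt|].
      * exact (is_derive_minus _ _ _ _ _ hrd hRd).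
      * intros; apply Rmult_comm.
  - pose proof (weight_pos z p) as hwp.
    assert (hdne : offset z p <> 0) by (intros e; apply hne; rewrite e; ring).
    assert (hsl : exists th, Rabs th <= Rabs (offset z p) /\
      slope (sd z) c r - slope (sd z) c (orb z c) = (slope_r (sd z) c (orb z c) + th) * offset z p).
    (* The mean value theorem gives a derivative at a point [xi] between the curve and [r], and [slope_r] is Lipschitz. *)
    { destruct (MVT_gen (slope (sd z) c) (orb z c) r (slope_r (sd z) c)) as [xi [hxi e]].
      - intros x hx'. apply slope_derive; [apply hwf|].
        assert (/ 2 <= x <= 11 / 2).
        { pose proof (orb_range z c ltac:(lra)). unfold Rmin, Rmax in hx'. destruct (Rle_dec _ _); lra. }
        pose proof (denom_pos (sd z) h (hwf z) (hsize z) hsmall c x ltac:(lra) ltac:(lra)). lra.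
      - intros x hx'. apply cont_pt. eapply is_derive_cont, slope_derive; [apply hwf|].
        assert (/ 2 <= x <= 11 / 2).
        { pose proof (orb_range z c ltac:(lra)). unfold Rmin, Rmax in hx'. destruct (Rle_dec _ _); lra. }
        pose proof (denom_pos (sd z) h (hwf z) (hsize z) hsmall c x ltac:(lra) ltac:(lra)). lra.
      - exists (slope_r (sd z) c xi - slope_r (sd z) c (orb z c)). split.
        + pose proof (orb_range z c ltac:(lra)) as hRr.
          assert (hxir : / 2 <= xi <= 11 / 2).
          { unfold Rmin, Rmax in hxi. destruct (Rle_dec _ _); lra. }
          destruct (slope_r_lipb (sd z) h (hwf z) (hsize z) hsmall c ltac:(lra)) as [_ hlip].
          eapply Rle_trans; [apply hlip; lra|].
          apply Rle_trans with (1 * Rabs (xi - orb z c)).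
          { apply Rmult_le_compat_r; [apply Rabs_pos | lra]. }
          rewrite Rmult_1_l. change (offset z p) with (r - orb z c).
          unfold Rmin, Rmax in hxi. unfold Rabs; destruct (Rcase_abs _), (Rcase_abs _), (Rle_dec _ _); lra.
        + rewrite e. change (offset z p) with (r - orb z c). ring. }
    destruct hsl as [th [hth hsl]].
    assert (hexpo : exponent_density z c = slope_r (sd z) c (orb z c) - zsign z * rate).
    { unfold exponent_density, slope_r', clamp_c, clamp_r. pose proof (orb_range z c ltac:(lra)).
      rewrite !clamp_id by lra. reflexivity. }
    replace ((slope (sd z) c r * l - l * slope (sd z) c (orb z c)) * weight z p
          + offset z p * (l * - exponent_density z c * weight z p)) with
      (l * weight z p * ((slope (sd z) c r - slope (sd z) c (orb z c)) - exponent_density z c * offset z p)) by ring.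
    rewrite hsl, hexpo.
    replace (l * weight z p * ((slope_r (sd z) c (orb z c) + th) * offset z p
       - (slope_r (sd z) c (orb z c) - zsign z * rate) * offset z p) * (rate * (offset z p * weight z p)))
      with ((weight z p ^ 2 * offset z p ^ 2) * (l * rate * (th + zsign z * rate))) by ring.
    assert (0 < weight z p ^ 2 * offset z p ^ 2).
    { apply Rmult_lt_0_compat; [nra|]. apply Rsqr_pos_lt in hdne. unfold Rsqr in hdne; lra. }
    assert (hthk : Rabs th < Rabs rate) by lra.
    assert (l * rate * (th + zsign z * rate) < 0); [|nra].
    destruct z; simpl in hls |- *; unfold Rabs in hthk; destruct (Rcase_abs th), (Rcase_abs rate);
      first [ assert (0 < rate * (th + 1 * rate)) by nra; nra | assert (0 < - rate * (th + -1 * rate)) by nra; nra ].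
Qed.

Section Periodic.
Variables (gam : R -> R * R) (T : R).
Hypotheses (hT : 0 < T) (hsol : solution SS gam) (hper : forall t, gam (t + T) = gam t).

Let hgam : forall s, continuous gam s.
Proof. intros s; apply (hsol s). Qed.

Lemma cont_level_gam s : continuous (fun s => level (gam s)) s.
Proof. apply (continuous_comp gam level); [apply hgam | apply cont_level]. Qed.

Lemma level_rising t : Rabs (level (gam t)) < width -> level (gam t) <> 0 ->
  rising (fun s => - (rate * level (gam t)) * level (gam s)) t.
Proof.
  intros hW hne. destruct (solution_arcs SS gam t hsol) as [a [b [hab harcs]]].
  set (w0 := level (gam t)) in *.
  assert (hcW : continuous (fun s => width - Rabs (level (gam s))) t).
  { apply (cont_minus _ (fun _ => width)); [apply cont_const|]. apply cont_abs, cont_level_gam. }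
  assert (hcp : continuous (fun s => w0 * level (gam s)) t).
  { apply (cont_mult _ (fun _ => w0)); [apply cont_const | apply cont_level_gam]. }
  assert (hp1 : 0 < width - Rabs (level (gam t))) by (fold w0; lra).
  assert (hp2 : 0 < w0 * level (gam t)).
  { fold w0. apply Rsqr_pos_lt in hne. exact hne. }
  destruct (locally_interval_eps _ t (filter_and _ _ (cont_locally_pos _ _ hcW hp1) (cont_locally_pos _ _ hcp hp2)))
    as [d [hd hnear]].
  set (d' := Rmin d (Rmin (t - a) (b - t))).
  assert (hd' : 0 < d') by (repeat apply Rmin_glb_lt; lra).
  pose proof (Rmin_l d (Rmin (t - a) (b - t))) as m1. pose proof (Rmin_r d (Rmin (t - a) (b - t))) as m2.
  pose proof (Rmin_l (t - a) (b - t)) as m3. pose proof (Rmin_r (t - a) (b - t)) as m4. fold d' in m1, m2.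
  apply (rising_of_derive _ t d'); [exact hd' | |].
  - intros s _. apply (cont_mult _ (fun _ => - (rate * w0))); [apply cont_const | apply cont_level_gam].
  - intros s hs hst. destruct (harcs s ltac:(lra) hst) as [z [a' [b' [hs' harc]]]].
    destruct (hnear s ltac:(lra)) as [n1 n2].
    assert (hWs : Rabs (level (gam s)) < width) by lra.
    assert (hns : level (gam s) <> 0) by (intros e; rewrite e in n2; lra).
    destruct (arc_level z gam a' b' s harc hs' hgam hWs hns) as [l [hl hneg]].
    exists (- (rate * w0) * l). split.
    + apply (is_derive_scal (fun s => level (gam s)) s (- (rate * w0)) l hl).
    + assert (0 < (- (rate * w0) * l) * (level (gam s) * level (gam s))); [|nra].
      replace (- (rate * w0) * l * (level (gam s) * level (gam s)))
        with (- (l * (rate * level (gam s))) * (w0 * level (gam s))) by ring.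
      apply Rmult_lt_0_compat; lra.
Qed.

(** Otherwise the level function along the motion would cross the value
    [level (gam t)] always in the same direction. *)
Lemma level_zero_of_small t : Rabs (level (gam t)) < width -> level (gam t) = 0.
Proof.
  intros hW. destruct (Req_dec (level (gam t)) 0) as [|hne]; [assumption | exfalso].
  set (k0 := - (rate * level (gam t))).
  assert (hk0 : k0 <> 0) by (unfold k0; apply Ropp_neq_0_compat, Rmult_integral_contrapositive_currified; assumption).
  (* The sign of [k0] is such that [k0] times the level increases. *)
  apply (periodic_no_upcrossing (fun s => k0 * level (gam s)) T t hT).
  - intros s. apply (cont_mult _ (fun _ => k0)); [apply cont_const | apply cont_level_gam].
  - intros s. now rewrite hper.
  - intros s hs. apply Rmult_eq_reg_l in hs; [|exact hk0].
    unfold k0. rewrite <- hs. apply level_rising; rewrite hs; assumption.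
Qed.

Lemma level_zero_everywhere t0 : Rabs (level (gam t0)) < width -> forall t, level (gam t) = 0.
Proof.
  intros h0 t. apply level_zero_of_small in h0. apply level_zero_of_small.
  apply Rnot_le_lt; intros hle.
  assert (hc : continuity (fun s => Rabs (level (gam s)))).
  { intros s. apply cont_pt, cont_abs, cont_level_gam. }
  destruct (IVT_gen (fun s => Rabs (level (gam s))) t0 t (width / 2) hc) as [s [_ hs]].
  - rewrite h0, Rabs_R0. pose proof width_pos. rewrite Rmin_left, Rmax_right; lra.
  - pose proof width_pos. assert (hz : level (gam s) = 0) by (apply level_zero_of_small; lra).
    rewrite hz, Rabs_R0 in hs. lra.
Qed.

(** * Periodic motions on the curve cover it *)

Hypothesis hC : forall t, level (gam t) = 0.

Lemma level_zero_small p : level p = 0 -> Rabs (level p) < width.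
Proof. intros ->. rewrite Rabs_R0. apply width_pos. Qed.

Lemma curve_point z p : level p = 0 -> 0 <= zsign z * fst p ->
  rad z p = orb z (cosn z p) /\ / 2 < rad z p < 11 / 2.
Proof.
  intros hp hz. rewrite (level_zone z) in hp by exact hz.
  destruct (level_in_inside z p) as [he [_ [_ hr]]]; [rewrite hp, Rabs_R0; apply width_pos|].
  split; [|exact hr]. rewrite hp in he. pose proof (weight_pos z p).
  symmetry in he. apply Rmult_integral in he. unfold offset in he. destruct he; lra.
Qed.

Lemma curve_point_inj z p q : level p = 0 -> level q = 0 -> 0 <= zsign z * fst p -> 0 <= zsign z * fst q ->
  cosn z p = cosn z q -> p = q.
Proof.
  intros hp hq hzp hzq e. destruct (curve_point z p hp hzp) as [e1 h1].
  destruct (curve_point z q hq hzq) as [e2 h2].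
  assert (er : rad z p = rad z q) by (rewrite e1, e2, e; reflexivity).
  unfold rad, cosn in *.
  pose proof (cosine_far sx sy (sd z) p ltac:(lra)) as y1.
  pose proof (cosine_far sx sy (sd z) q ltac:(lra)) as y2.
  pose proof (xabs_chi sx sy hsx (sd z) p (hwf z) ltac:(lra)) as x1.
  pose proof (xabs_chi sx sy hsx (sd z) q (hwf z) ltac:(lra)) as x2.
  rewrite e, er in y1, x1. rewrite x2 in x1. rewrite y2 in y1. clear e e1 e2 er y2 x2 h1 h2.
  unfold ysc, xabs in *. destruct p as [xp yp], q as [xq yq]; simpl in *.
  assert (hy : yp = yq).
  { apply Rmult_eq_reg_r with (/ sy); [exact (eq_sym y1) | apply Rinv_neq_0_compat; lra]. }
  assert (hx : Rabs xp = Rabs xq).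
  { apply Rmult_eq_reg_r with (/ sx); [exact (eq_sym x1) | apply Rinv_neq_0_compat; lra]. }
  subst yq. f_equal. unfold Rabs in hx. destruct z; simpl in *; destruct (Rcase_abs xp), (Rcase_abs xq); lra.
Qed.

Lemma curve_left_inside p : level p = 0 -> fst p < 0 -> -1 < cosn LeftZone p < 1.
Proof.
  intros hp hx. destruct (curve_point LeftZone p hp ltac:(simpl; lra)) as [_ hr].
  unfold cosn, rad in *. pose proof (cosine_bounds sx sy (sd LeftZone) p) as hb.
  pose proof (radius_sine sx sy hsx (sd LeftZone) p (hwf _) ltac:(lra)) as hs.
  assert (hX : 0 < xabs sx p).
  { unfold xabs. apply Rdiv_lt_0_compat; [apply Rabs_pos_lt; lra | exact hsx]. }
  pose proof (ampl_ge (sd LeftZone) _ (hwf _) hX) as hU.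
  set (c := cosine sx sy (sd LeftZone) p) in *.
  assert (c <> 1 /\ c <> -1); [|lra].
  split; intros e; unfold sine in hs; rewrite e in hs;
  [replace (1 - 1 ^ 2) with 0 in hs by ring | replace (1 - (-1) ^ 2) with 0 in hs by ring];
  rewrite sqrt_0 in hs; lra.
Qed.

(** Runs from 0 at the top through 2 at the bottom to 4; it jumps at the top. *)
Definition phase (p : R * R) : R :=
  if Rle_dec 0 (fst p) then 1 - cosn RightZone p else 3 + cosn LeftZone p.

Lemma phase_right p : 0 <= fst p -> phase p = 1 - cosn RightZone p.
Proof. intros hp. unfold phase. destruct (Rle_dec 0 (fst p)); [reflexivity | contradiction]. Qed.

Lemma phase_left p : fst p < 0 -> phase p = 3 + cosn LeftZone p.
Proof. intros hp. unfold phase. destruct (Rle_dec 0 (fst p)); [lra | reflexivity]. Qed.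

Lemma phase_inj p q : level p = 0 -> level q = 0 -> phase p = phase q -> p = q.
Proof.
  intros hp hq e.
  pose proof (cosine_bounds sx sy (sd RightZone) p) as b1.
  pose proof (cosine_bounds sx sy (sd RightZone) q) as b2. fold (cosn RightZone p) in b1.
  change (cosine sx sy (sd RightZone) p) with (cosn RightZone p) in b1.
  change (cosine sx sy (sd RightZone) q) with (cosn RightZone q) in b2.
  destruct (Rle_lt_dec 0 (fst p)) as [h1|h1]; destruct (Rle_lt_dec 0 (fst q)) as [h2|h2].
  - rewrite !phase_right in e by assumption. apply (curve_point_inj RightZone); simpl; try lra; assumption.
  - rewrite phase_right, phase_left in e by assumption. pose proof (curve_left_inside q hq h2). lra.
  - rewrite phase_left, phase_right in e by assumption. pose proof (curve_left_inside p hp h1). lra.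
  - rewrite !phase_left in e by assumption. apply (curve_point_inj LeftZone); simpl; try lra; assumption.
Qed.

Lemma cont_cosn_gam z t : continuous (fun s => cosn z (gam s)) t.
Proof. apply (continuous_comp gam (cosn z)); [apply hgam | apply cont_cosn]. Qed.

Lemma arc_cosine_monotone z a b s1 s2 : orbit_arc SS z gam a b -> a <= s1 -> s1 < s2 -> s2 <= b ->
  zsign z * cosn z (gam s2) < zsign z * cosn z (gam s1).
Proof.
  intros harc h1 h2 h3.
  assert (hup : - zsign z * cosn z (gam s1) < - zsign z * cosn z (gam s2)); [|lra].
  apply (increasing_of_derive (fun s => - zsign z * cosn z (gam s))); [exact h2 | |].
  - intros s _. apply (cont_mult _ (fun _ => - zsign z)); [apply cont_const | apply cont_cosn_gam].
  - intros s hs. destruct (arc_cosine z gam a b s harc ltac:(lra) (level_zero_small _ (hC s))) as [l [hl hneg]].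
    exists (- zsign z * l). split; [|lra].
    apply (is_derive_scal (fun s => cosn z (gam s)) s (- zsign z) l hl).
Qed.

Lemma axis_cosine t : fst (gam t) = 0 ->
  (forall z, cosn z (gam t) = 1) \/ (forall z, cosn z (gam t) = -1).
Proof.
  intros hx. destruct (curve_point RightZone (gam t) (hC t) ltac:(simpl; lra)) as [_ hr].
  unfold rad in hr. rewrite radius_axis in hr by exact hx.
  destruct (Rtotal_order (ysc sy (gam t)) 0) as [hy|[hy|hy]].
  - right. intros z. destruct (cosine_axis sx sy (sd z) (gam t) hx ltac:(lra)) as [[]|[_ e]]; [lra | exact e].
  - rewrite hy, Rabs_R0 in hr; lra.
  - left. intros z. destruct (cosine_axis sx sy (sd z) (gam t) hx ltac:(lra)) as [[_ e]|[]]; [exact e | lra].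
Qed.

Lemma cosn_bounds z p : -1 <= cosn z p <= 1.
Proof. apply cosine_bounds. Qed.

Lemma cont_phase t : (fst (gam t) = 0 -> cosn RightZone (gam t) = -1 /\ cosn LeftZone (gam t) = -1) ->
  continuous (fun s => phase (gam s)) t.
Proof.
  intros he. apply (continuous_comp gam phase); [apply hgam|].
  unfold phase. apply cont_glue.
  - apply (cont_minus _ (fun _ => 1)); [apply cont_const | apply cont_cosn].
  - apply (cont_plus _ (fun _ => 3)); [apply cont_const | apply cont_cosn].
  - intros h0. destruct (he h0) as [-> ->]. ring.
Qed.

Lemma phase_rising t : (fst (gam t) = 0 -> cosn RightZone (gam t) = -1) ->
  rising (fun s => phase (gam s)) t.
Proof.
  intros hbot.
  assert (hzone : forall z a b t', a < t' < b -> orbit_arc SS z gam a b -> 0 < zsign z * fst (gam t')).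
  { intros z a b t' h1 h2. apply (arc_off_axis z gam a b t' h2 h1), level_zero_small, hC. }
  destruct (hsol t) as [_ [a [b [hab [[z hz]|[[h0 _] [z [h1 h2]]]]]]]].
  - exists (Rmin (t - a) (b - t)).
    pose proof (Rmin_l (t - a) (b - t)); pose proof (Rmin_r (t - a) (b - t)).
    split; [apply Rmin_glb_lt; lra|].
    assert (hph : forall s, a < s < b -> phase (gam s) = (match z with RightZone => 1 | LeftZone => 3 end) - zsign z * cosn z (gam s)).
    { intros s hs. pose proof (hzone z a b s hs hz). destruct z; simpl in *.
      - rewrite phase_right by lra. ring.
      - rewrite phase_left by lra. ring. }
    split; intros s hs; rewrite !hph by lra.
    + pose proof (arc_cosine_monotone z a b s t hz ltac:(lra) ltac:(lra) ltac:(lra)). lra.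
    + pose proof (arc_cosine_monotone z a b t s hz ltac:(lra) ltac:(lra) ltac:(lra)). lra.
  - specialize (hbot h0). destruct (axis_cosine t h0) as [hc|hc]; [rewrite hc in hbot; lra|].
    destruct z.
    + exists (Rmin (t - a) (b - t)).
      pose proof (Rmin_l (t - a) (b - t)); pose proof (Rmin_r (t - a) (b - t)).
      split; [apply Rmin_glb_lt; lra|]. rewrite (phase_right (gam t)), hbot by lra.
      split; intros s hs.
      * pose proof (hzone RightZone a t s ltac:(lra) h1) as hx. simpl in hx. rewrite phase_right by lra.
        pose proof (arc_cosine_monotone RightZone a t s t h1 ltac:(lra) ltac:(lra) ltac:(lra)) as hm.
        simpl in hm. rewrite hbot in hm. lra.
      * pose proof (hzone LeftZone t b s ltac:(lra) h2) as hx. simpl in hx. rewrite phase_left by lra.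
        pose proof (arc_cosine_monotone LeftZone t b t s h2 ltac:(lra) ltac:(lra) ltac:(lra)) as hm.
        simpl in hm. rewrite hc in hm. lra.
    + exfalso. pose proof (arc_cosine_monotone LeftZone a t ((a + t) / 2) t h1 ltac:(lra) ltac:(lra) ltac:(lra)) as hm.
      simpl in hm. rewrite hc in hm. pose proof (cosn_bounds LeftZone (gam ((a + t) / 2))). lra.
Qed.

Lemma top_crossing t : fst (gam t) = 0 -> cosn RightZone (gam t) = 1 ->
  exists d, 0 < d /\ (forall s, t - d < s < t -> phase (gam s) = 3 + cosn LeftZone (gam s) /\ phase (gam s) < 4)
    /\ (forall s, t < s < t + d -> phase (gam s) = 1 - cosn RightZone (gam s) /\ 0 < phase (gam s)).
Proof.
  intros h0 htop.
  assert (hzone : forall z a b t', a < t' < b -> orbit_arc SS z gam a b -> 0 < zsign z * fst (gam t')).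
  { intros z a b t' h1 h2. apply (arc_off_axis z gam a b t' h2 h1), level_zero_small, hC. }
  destruct (axis_cosine t h0) as [hc|hc]; [|rewrite hc in htop; lra].
  destruct (hsol t) as [_ [a [b [hab [[z hz]|[_ [z [h1 h2]]]]]]]].
  - pose proof (hzone z a b t hab hz) as hx. rewrite h0, Rmult_0_r in hx. lra.
  - destruct z.
    + exfalso. pose proof (arc_cosine_monotone RightZone a t ((a + t) / 2) t h1 ltac:(lra) ltac:(lra) ltac:(lra)) as hm.
      simpl in hm. rewrite hc in hm. pose proof (cosn_bounds RightZone (gam ((a + t) / 2))). lra.
    + exists (Rmin (t - a) (b - t)).
      pose proof (Rmin_l (t - a) (b - t)); pose proof (Rmin_r (t - a) (b - t)).
      split; [apply Rmin_glb_lt; lra|]. split; intros s hs.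
      * pose proof (hzone LeftZone a t s ltac:(lra) h1) as hx. simpl in hx. rewrite phase_left by lra.
        pose proof (arc_cosine_monotone LeftZone a t s t h1 ltac:(lra) ltac:(lra) ltac:(lra)) as hm.
        simpl in hm. rewrite hc in hm. lra.
      * pose proof (hzone RightZone t b s ltac:(lra) h2) as hx. simpl in hx. rewrite phase_right by lra.
        pose proof (arc_cosine_monotone RightZone t b t s h2 ltac:(lra) ltac:(lra) ltac:(lra)) as hm.
        simpl in hm. rewrite hc in hm. lra.
Qed.

(** If the point [q] were missed, the phase could be cut at [q] instead of at the
    top, and the cut phase would increase strictly for all times. *)
Lemma curve_covered q : level q = 0 -> exists t, gam t = q.
Proof.
  intros hq. destruct (Classical_Prop.classic (exists t, gam t = q)) as [|hno]; [assumption | exfalso].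
  assert (hne : forall t, phase (gam t) <> phase q).
  { intros t e. apply hno. exists t. now apply phase_inj. }
  set (a := phase q) in *.
  assert (ha : 0 <= a < 4).
  { unfold a. destruct (Rle_lt_dec 0 (fst q)) as [hx|hx].
    - rewrite phase_right by exact hx. pose proof (cosn_bounds RightZone q). lra.
    - rewrite phase_left by exact hx. pose proof (curve_left_inside q hq hx). lra. }
  (* The phase cut at [q] has values in (a, a + 4]. *)
  set (lift := fun v => if Rle_dec v a then v + 4 else v).
  assert (hlow : forall v, v <= a -> lift v = v + 4).
  { intros v hv. unfold lift. destruct (Rle_dec v a); [reflexivity | contradiction]. }
  assert (hhigh : forall v, a < v -> lift v = v).
  { intros v hv. unfold lift. destruct (Rle_dec v a); [lra | reflexivity]. }
  apply (rising_not_periodic (fun s => lift (phase (gam s))) T hT).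
  - intros t. now rewrite hper.
  - intros t.
    assert (hcase : (fst (gam t) = 0 -> cosn RightZone (gam t) = -1) \/
                    (fst (gam t) = 0 /\ cosn RightZone (gam t) = 1)).
    { destruct (Req_dec (fst (gam t)) 0) as [h0|]; [|left; lra].
      destruct (axis_cosine t h0) as [hc|hc]; [right; split; auto | left; auto]. }
    destruct hcase as [hbot|[h0 htop]].
    + destruct (phase_rising t hbot) as [d [hd [hl hr]]].
      assert (hc : continuous (fun s => phase (gam s)) t).
      { apply cont_phase. intros h0. specialize (hbot h0). split; [exact hbot|].
        destruct (axis_cosine t h0) as [hc|hc]; [rewrite hc in hbot; lra | apply hc]. }
      pose proof (hne t) as hnt.
      destruct (proj1 (cont_eps _ t) hc (Rabs (phase (gam t) - a))) as [e [he hnear]].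
      { apply Rabs_pos_lt. lra. }
      exists (Rmin d e). pose proof (Rmin_l d e); pose proof (Rmin_r d e).
      split; [apply Rmin_glb_lt; lra|].
      assert (hn : forall s, t - Rmin d e < s < t + Rmin d e -> Rabs (phase (gam s) - phase (gam t)) < Rabs (phase (gam t) - a)).
      { intros s hs. apply hnear, Rabs_def1; lra. }
      destruct (Rlt_le_dec (phase (gam t)) a) as [hlt|hge].
      * rewrite (Rabs_left (phase (gam t) - a)) in hn by lra.
        split; intros s hs; specialize (hn s ltac:(lra)); apply Rabs_def2 in hn;
        rewrite !hlow by lra; [specialize (hl s ltac:(lra)) | specialize (hr s ltac:(lra))]; lra.
      * rewrite (Rabs_pos_eq (phase (gam t) - a)) in hn by lra.
        split; intros s hs; specialize (hn s ltac:(lra)); apply Rabs_def2 in hn;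
        rewrite !hhigh by lra; [specialize (hl s ltac:(lra)) | specialize (hr s ltac:(lra))]; lra.
    + destruct (top_crossing t h0 htop) as [d [hd [hl hr]]].
      assert (hpt : phase (gam t) = 0) by (rewrite phase_right, htop by lra; ring).
      assert (hapos : 0 < a) by (pose proof (hne t); lra).
      destruct (axis_cosine t h0) as [hc|hc]; [|rewrite hc in htop; lra].
      destruct (proj1 (cont_eps _ t) (cont_cosn_gam LeftZone t) (4 - a) ltac:(lra)) as [e1 [he1 hn1]].
      destruct (proj1 (cont_eps _ t) (cont_cosn_gam RightZone t) a hapos) as [e2 [he2 hn2]].
      rewrite hc in hn1, hn2.
      exists (Rmin d (Rmin e1 e2)). pose proof (Rmin_l d (Rmin e1 e2)); pose proof (Rmin_r d (Rmin e1 e2)).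
      pose proof (Rmin_l e1 e2); pose proof (Rmin_r e1 e2).
      split; [repeat apply Rmin_glb_lt; lra|].
      rewrite hpt, (hlow 0) by lra. split; intros s hs.
      * destruct (hl s ltac:(lra)) as [p1 p2].
        specialize (hn1 s ltac:(apply Rabs_def1; lra)). apply Rabs_def2 in hn1.
        rewrite hhigh; lra.
      * destruct (hr s ltac:(lra)) as [p1 p2].
        specialize (hn2 s ltac:(apply Rabs_def1; lra)). apply Rabs_def2 in hn2.
        rewrite hlow; lra.
Qed.

End Periodic.
End Cycle.


(** * Motions along half-orbits *)

Section HalfPath.
Variables (S : side) (h r0 w : R) (r : R -> R).
Hypotheses (hS : admissible S) (hsize : size S h) (hsmall : h * (100 * bigK) <= 1).
Hypotheses (hr : half_orbit S r0 r) (hr0 : 3 / 4 <= r0 <= 21 / 4) (hw : 0 < w).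

Let rho th := r (cos th).
Let arg th := rho th * sine (cos th).
(** dt / d(angle) along the half-orbit.  The angle, unlike its cosine, is a
    regular parameter at the ends of the half-orbit. *)
Definition clock_rate (th : R) : R :=
  rho th / (w * ampl' S (chi S (arg th)) * (rho th - cos th * udrag S (arg th))).

Let cos_range th : -1 <= cos th <= 1.
Proof. pose proof (COS_bound th); lra. Qed.

Let rho_range th : / 2 < rho th < 11 / 2.
Proof. apply (half_orbit_range S h hS hsize hsmall r0 r hr hr0), cos_range. Qed.

Let denom th : rho th - / 8 <= rho th - cos th * udrag S (arg th) <= rho th + / 8.
Proof.
  pose proof (rho_range th). apply (denom_lower S h hS hsize hsmall (cos th) (cos_range th)); lra.
Qed.

Let cont_cos th : continuous cos th.
Proof. apply continuity_pt_filterlim, continuity_cos. Qed.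

Let cont_rho th : continuous rho th.
Proof. apply (cont_comp _ r cos); [apply cont_cos | apply hr]. Qed.

Let cont_arg th : continuous arg th.
Proof.
  apply cont_mult; [apply cont_rho|]. apply (cont_comp _ sine cos); [apply cont_cos | apply cont_sine].
Qed.

Let ampl'_range th : 1 <= ampl' S (chi S (arg th)) <= 43.
Proof.
  split; [now apply ampl'_ge1|].
  pose proof (rho_range th). pose proof (sine_bounds (cos th)).
  pose proof (chi_range S hS (arg th) ltac:(unfold arg; nra)) as hc.
  destruct (stiffness_lipb S hS) as [hD _]. specialize (hD _ hc).
  pose proof (stiffness_ge1 S (chi S (arg th)) hS). rewrite Rabs_pos_eq in hD by lra.
  destruct (sqrt_ge1 _ (mean_stiffness_ge1 S (chi S (arg th)) hS)) as [h1 _].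
  unfold ampl'. apply Rmult_le_reg_r with (sqrt (mean_stiffness S (chi S (arg th)))); [lra|].
  unfold Rdiv. rewrite Rmult_assoc, Rinv_l by lra. nra.
Qed.

Let cont_rate th : continuous clock_rate th.
Proof.
  assert (continuous (fun x => rho x) th) by apply cont_rho.
  assert (continuous (fun x => cos x) th) by apply cont_cos.
  assert (continuous (fun x => udrag S (arg x)) th).
  { apply (cont_comp _ (udrag S) arg); [apply cont_arg | now apply cont_udrag]. }
  assert (continuous (fun x => ampl' S (chi S (arg x))) th).
  { apply (cont_comp _ (ampl' S) (fun x => chi S (arg x))); [|now apply cont_ampl'].
    apply (cont_comp _ (chi S) arg); [apply cont_arg | now apply cont_chi]. }
  unfold clock_rate. cont.
  pose proof (ampl'_range th); pose proof (denom th); pose proof (rho_range th).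
  apply Rmult_integral_contrapositive_currified; [|lra].
  apply Rmult_integral_contrapositive_currified; lra.
Qed.

Let rate_lower th : / (172 * w) <= clock_rate th.
Proof.
  unfold clock_rate. pose proof (ampl'_range th) as hk; pose proof (denom th) as hd; pose proof (rho_range th) as hrr.
  set (k := ampl' S _) in *. set (d := rho th - cos th * _) in *. set (p := rho th) in *. clearbody k d p.
  apply Rmult_le_reg_r with (172 * w * (w * k * d)).
  { repeat apply Rmult_lt_0_compat; lra. }
  replace (/ (172 * w) * (172 * w * (w * k * d))) with (w * (k * d)) by (field; lra).
  replace (p / (w * k * d) * (172 * w * (w * k * d))) with (w * (172 * p)) by (field; lra).
  apply Rmult_le_compat_l; [lra|]. nra.
Qed.

Let rate_c_pos : 0 < / (172 * w).
Proof. apply Rinv_0_lt_compat; lra. Qed.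

(** The angle as a function of time is the inverse of the integral of
    [clock_rate]. *)
Lemma half_path : exists (X Y : R -> R) (T : R), 0 < T /\
  (forall t, continuous X t) /\ (forall t, continuous Y t) /\
  (forall t, 0 < t < T -> 0 < X t /\ is_derive X t (w * (Y t - drag S (X t))) /\
                          is_derive Y t (- (w * force S (X t)))) /\
  X 0 = 0 /\ Y 0 = r 1 /\ X T = 0 /\ Y T = - r (-1) /\
  (forall t, 0 <= t <= T -> 0 <= X t /\
     exists c, -1 <= c <= 1 /\ Y t = r c * c /\ ampl S (X t) = r c * sine c).
Proof.
  set (tau := fun th => RInt clock_rate 0 th : R).
  assert (htau : forall th, is_derive tau th (clock_rate th)) by (intros th; apply derive_RInt, cont_rate).
  destruct (inverse_function tau clock_rate _ rate_c_pos htau rate_lower) as [ang [a1 [a2 a3]]].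
  pose proof (expanding tau clock_rate _ htau rate_lower) as hexp.
  assert (tau0 : tau 0 = 0) by apply (RInt_point (V := R_CompleteNormedModule)).
  set (T := tau PI). pose proof PI_RGT_0 as hpi.
  assert (hT : 0 < T).
  { pose proof (hexp 0 PI ltac:(lra)) as hx. rewrite tau0 in hx. unfold T. nra. }
  assert (hang : forall t, 0 <= t <= T -> 0 <= ang t <= PI).
  { intros t ht. split; apply Rnot_lt_le; intros hl.
    - pose proof (hexp (ang t) 0 ltac:(lra)) as hx. rewrite tau0, a1 in hx. nra.
    - pose proof (hexp PI (ang t) ltac:(lra)) as hx. rewrite a1 in hx. fold T in hx. nra. }
  assert (hang' : forall t, 0 < t < T -> 0 < ang t < PI).
  { intros t ht. destruct (hang t ltac:(lra)) as [h1 h2]. split.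
    - destruct h1 as [h1|h1]; [exact h1|]. pose proof (a1 t) as e. rewrite <- h1, tau0 in e. lra.
    - destruct h2 as [h2|h2]; [exact h2|]. pose proof (a1 t) as e. rewrite h2 in e. fold T in e. lra. }
  assert (ang0 : ang 0 = 0) by (rewrite <- tau0 at 1; apply a2).
  assert (angT : ang T = PI) by apply a2.
  assert (hsg : forall t, 0 <= t <= T -> sine (cos (ang t)) = sin (ang t)).
  { intros t ht. pose proof (hang t ht) as ha. pose proof (sin_ge_0 (ang t) ltac:(lra) ltac:(lra)).
    unfold sine. replace (1 - cos (ang t) ^ 2) with (Rsqr (sin (ang t))).
    - apply sqrt_Rsqr; assumption.
    - pose proof (sin2_cos2 (ang t)) as e. unfold Rsqr in *. simpl. lra. }
  exists (fun t => chi S (rho (ang t) * sin (ang t))), (fun t => rho (ang t) * cos (ang t)), T.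
  assert (cont_ang : forall t, continuous ang t) by (intros t; exact (is_derive_cont _ _ _ (a3 t))).
  assert (cr : forall t, continuous (fun t => rho (ang t)) t).
  { intros t. apply (cont_comp _ rho ang); [apply cont_ang | apply cont_rho]. }
  assert (cs : forall t, continuous (fun t => sin (ang t)) t).
  { intros t. apply (cont_comp _ sin ang); [apply cont_ang | apply continuity_pt_filterlim, continuity_sin]. }
  assert (cc : forall t, continuous (fun t => cos (ang t)) t).
  { intros t. apply (cont_comp _ cos ang); [apply cont_ang | apply cont_cos]. }
  split; [exact hT|]. split; [|split; [|split; [|split; [|split; [|split; [|split]]]]]].
  - intros t. apply (cont_comp _ (chi S)); [|now apply cont_chi].
    apply (cont_mult _ (fun t => rho (ang t))); [apply cr | apply cs].
  - intros t. apply (cont_mult _ (fun t => rho (ang t))); [apply cr | apply cc].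
  - intros t ht. pose proof (hang' t ht) as ha. pose proof (sin_gt_0 (ang t) ltac:(lra) ltac:(lra)) as hsin.
    pose proof (hsg t ltac:(lra)) as hsgt.
    pose proof (rho_range (ang t)) as hrr. pose proof (denom (ang t)) as hdd. pose proof (ampl'_range (ang t)) as hkk.
    assert (harg : rho (ang t) * sin (ang t) = arg (ang t)) by (unfold arg; now rewrite hsgt).
    assert (hcos : -1 < cos (ang t) < 1).
    { pose proof (sin2_cos2 (ang t)) as e. unfold Rsqr in e. split; nra. }
    split; [apply chi_pos; [exact hS | apply Rmult_lt_0_compat; lra]|].
    set (th := ang t) in *.
    assert (dc : is_derive (fun t => cos (ang t)) t (/ clock_rate th * - sin th)).
    { apply (derive_comp cos ang); [|apply a3]. apply is_derive_Reals, derivable_pt_lim_cos. }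
    assert (ds : is_derive (fun t => sin (ang t)) t (/ clock_rate th * cos th)).
    { apply (derive_comp sin ang); [|apply a3]. apply is_derive_Reals, derivable_pt_lim_sin. }
    assert (dr : is_derive (fun t => rho (ang t)) t ((/ clock_rate th * - sin th) * slope S (cos th) (rho th))).
    { unfold rho. apply (derive_comp r (fun t => cos (ang t))); [|exact dc].
      apply (half_orbit_derive S h hS hsize hsmall r0); assumption. }
    assert (dmul : forall (f g : R -> R) df dg, is_derive f t df -> is_derive g t dg ->
              is_derive (fun t => f t * g t) t (df * g t + f t * dg)).
    { intros f g df dg hf hg. apply (is_derive_mult f g t df dg hf hg). intros; apply Rmult_comm. }
    pose proof (dmul _ _ _ _ dr ds) as dX. pose proof (dmul _ _ _ _ dr dc) as dY. simpl in dX, dY. fold th in dX, dY.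
    set (X := chi S (rho th * sin th)).
    assert (hXF : udrag S (arg th) = drag S X) by (unfold X; rewrite harg; reflexivity).
    assert (hrate : clock_rate th = rho th / (w * ampl' S X * (rho th - cos th * drag S X))).
    { unfold clock_rate. rewrite hXF. unfold X. now rewrite harg. }
    assert (hslope : slope S (cos th) (rho th) = rho th * drag S X / (rho th - cos th * drag S X)).
    { unfold slope. fold (arg th). now rewrite hXF. }
    assert (hkX : 1 <= ampl' S X) by now apply ampl'_ge1.
    rewrite hXF in hdd. pose proof (sin2_cos2 th) as hsc. unfold Rsqr in hsc.
    split.
    + eapply is_derive_eq; [apply (derive_comp (chi S)); [apply chi_derive, hS | exact dX]|].
      fold th X. rewrite hrate, hslope.
      assert (hs2 : sin th * sin th = 1 - cos th * cos th) by lra.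
      transitivity (w * (- (sin th * sin th) * drag S X + cos th * (rho th - cos th * drag S X))).
      * field. repeat split; lra.
      * rewrite hs2. ring.
    + eapply is_derive_eq; [exact dY|]. rewrite hrate, hslope.
      assert (hg : force S X = ampl' S X * (rho th * sin th)).
      { rewrite <- (ampl_chi S hS (rho th * sin th)). fold X. unfold force, ampl', ampl.
        destruct (sqrt_ge1 _ (mean_stiffness_ge1 S X hS)). field. lra. }
      rewrite hg. field. repeat split; lra.
  - rewrite ang0, sin_0, Rmult_0_r. now apply chi_0.
  - rewrite ang0. unfold rho. rewrite cos_0. ring.
  - rewrite angT, sin_PI, Rmult_0_r. now apply chi_0.
  - rewrite angT. unfold rho. rewrite cos_PI. ring.
  - intros t ht. pose proof (hang t ht) as ha. pose proof (sin_ge_0 (ang t) ltac:(lra) ltac:(lra)).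
    pose proof (rho_range (ang t)). split.
    + apply chi_bounds; [exact hS | nra].
    + exists (cos (ang t)). split; [apply cos_range|]. split; [reflexivity|].
      rewrite ampl_chi by exact hS. now rewrite hsg.
Qed.

End HalfPath.


(** * Concatenation of two arcs into a periodic motion *)

Lemma continuous_join (f g1 g2 : R -> R * R) (t d : R) : 0 < d ->
  (forall s, t - d < s <= t -> f s = g1 s) -> (forall s, t <= s < t + d -> f s = g2 s) ->
  continuous g1 t -> continuous g2 t -> continuous f t.
Proof.
  intros hd h1 h2 c1 c2 P hP.
  assert (hP1 : locally (g1 t) P) by (rewrite <- h1 by lra; exact hP).
  assert (hP2 : locally (g2 t) P) by (rewrite <- h2 by lra; exact hP).
  pose proof (c1 P hP1) as q1. pose proof (c2 P hP2) as q2. unfold filtermap in *.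
  assert (hn : locally t (fun s => t - d < s < t + d)).
  { apply (locally_interval _ t (t - d) (t + d)); simpl; [lra | lra | intros; lra]. }
  pose proof (filter_and _ _ hn (filter_and _ _ q1 q2)) as q.
  apply filter_imp with (2 := q). intros s [hs [p1 p2]].
  destruct (Rle_lt_dec s t); [rewrite h1 by lra | rewrite h2 by lra]; assumption.
Qed.

Lemma arc_shift SS z (p f : R -> R * R) a b o :
  (forall t, a + o < t < b + o -> f t = p (t - o)) -> orbit_arc SS z p a b ->
  orbit_arc SS z f (a + o) (b + o).
Proof.
  intros he harc t ht. destruct (harc (t - o) ltac:(lra)) as [hz [dx dy]].
  rewrite he by exact ht. split; [exact hz|].
  assert (hn : locally t (fun s => p (s - o) = f s)).
  { apply (locally_interval _ t (a + o) (b + o)); simpl; [lra | lra | intros; symmetry; apply he; lra]. }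
  assert (hd : is_derive (fun s => s - o) t 1) by (auto_derive; [trivial | ring]).
  split.
  - apply (derive_ext_loc (fun s => fst (p (s - o)))).
    + apply filter_imp with (2 := hn). intros s ->. reflexivity.
    + rewrite <- (Rmult_1_l (fst _)). apply (derive_comp (fun s => fst (p s)) (fun s => s - o)); assumption.
  - apply (derive_ext_loc (fun s => snd (p (s - o)))).
    + apply filter_imp with (2 := hn). intros s ->. reflexivity.
    + rewrite <- (Rmult_1_l (snd _)). apply (derive_comp (fun s => snd (p s)) (fun s => s - o)); assumption.
Qed.

Section Concatenate.
Variables (SS : switching_system) (pR pL : R -> R * R) (T1 T2 : R).
Hypotheses (hT1 : 0 < T1) (hT2 : 0 < T2).
Hypotheses (cR : forall t, continuous pR t) (cL : forall t, continuous pL t).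
Hypotheses (aR : orbit_arc SS RightZone pR 0 T1) (aL : orbit_arc SS LeftZone pL 0 T2).
Hypotheses (j1 : pR T1 = pL 0) (j2 : pL T2 = pR 0).
Hypotheses (x0 : crossing_point SS (pR 0)) (x1 : crossing_point SS (pR T1)).

Let T := T1 + T2.
Definition concat (t : R) : R * R :=
  let s := t - T * IZR (Int_part (t / T)) in if Rlt_dec s T1 then pR s else pL (s - T1).

Let concat_eq n s : 0 <= s < T -> concat (s + T * IZR n) = if Rlt_dec s T1 then pR s else pL (s - T1).
Proof.
  intros hs. unfold concat.
  assert (hn : Int_part ((s + T * IZR n) / T) = n).
  { symmetry. apply Int_part_spec.
    assert (e : (s + T * IZR n) / T = s / T + IZR n) by (field; unfold T; lra).
    rewrite e. assert (hTp : 0 < T) by (unfold T; lra).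
    assert (0 <= s / T) by (apply Rdiv_le_0_compat; lra).
    assert (s / T < 1).
    { apply Rmult_lt_reg_r with T; [exact hTp|]. unfold Rdiv. rewrite Rmult_assoc, Rinv_l by lra. lra. }
    lra. }
  rewrite hn. replace (s + T * IZR n - T * IZR n) with s by ring. reflexivity.
Qed.

Let concat_right n s : 0 <= s <= T1 -> concat (s + T * IZR n) = pR s.
Proof.
  intros hs. rewrite concat_eq by (unfold T; lra). destruct (Rlt_dec s T1); [reflexivity|].
  replace s with T1 by lra. now rewrite Rminus_diag, j1.
Qed.

Let concat_left n s : 0 <= s <= T2 -> concat (s + T1 + T * IZR n) = pL s.
Proof.
  intros hs. destruct (Req_dec s T2) as [->|hne].
  - replace (T2 + T1 + T * IZR n) with (0 + T * IZR (n + 1)) by (rewrite plus_IZR; unfold T; ring).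
    rewrite concat_right by lra. now rewrite j2.
  - rewrite concat_eq by (unfold T; lra). destruct (Rlt_dec (s + T1) T1); [lra|].
    f_equal; ring.
Qed.

Let decompose t : exists n s, 0 <= s < T /\ t = s + T * IZR n.
Proof.
  assert (hTp : 0 < T) by (unfold T; lra).
  exists (Int_part (t / T)), (t - T * IZR (Int_part (t / T))). split; [|ring].
  destruct (base_Int_part (t / T)) as [h1 h2]. set (z := IZR (Int_part (t / T))) in *.
  assert (e : T * (t / T) = t) by (field; exact (Rgt_not_eq _ _ hTp)).
  set (q := t / T) in *. clearbody q z.
  assert (T * z <= T * q) by (apply Rmult_le_compat_l; [apply Rlt_le, hTp | exact h1]).
  assert (T * q < T * (z + 1)) by (apply Rmult_lt_compat_l; [exact hTp | lra]).
  rewrite Rmult_plus_distr_l, Rmult_1_r in *. clearbody T. lra.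
Qed.

Let arc_right n : orbit_arc SS RightZone concat (0 + T * IZR n) (T1 + T * IZR n).
Proof.
  apply (arc_shift SS RightZone pR); [|exact aR]. intros t ht.
  rewrite <- (concat_right n (t - T * IZR n)) by lra. f_equal; ring.
Qed.

Let arc_left n : orbit_arc SS LeftZone concat (0 + (T1 + T * IZR n)) (T2 + (T1 + T * IZR n)).
Proof.
  apply (arc_shift SS LeftZone pL); [|exact aL]. intros t ht.
  rewrite <- (concat_left n (t - (T1 + T * IZR n))) by lra. f_equal; ring.
Qed.

Let cont_shift (p : R -> R * R) o t : (forall s, continuous p s) -> continuous (fun s => p (s - o)) t.
Proof.
  intros hp. apply (continuous_comp (fun s => s - o) p); [|apply hp].
  apply (cont_minus _ (fun s => s) (fun _ => o)); [apply cont_id | apply cont_const].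
Qed.

(** At the multiples of the period and at the first joint the motion passes from
    one arc to the other through a crossing point. *)
Lemma concat_solution : solution SS concat.
Proof.
  intros t. destruct (decompose t) as [n [s [hs ->]]].
  assert (er : forall u n, 0 + T * IZR n <= u <= T1 + T * IZR n -> concat u = pR (u - T * IZR n)).
  { intros u m hu. rewrite <- (concat_right m (u - T * IZR m)) by lra. f_equal; ring. }
  assert (el : forall u n, 0 + (T1 + T * IZR n) <= u <= T2 + (T1 + T * IZR n) ->
     concat u = pL (u - (T1 + T * IZR n))).
  { intros u m hu. rewrite <- (concat_left m (u - (T1 + T * IZR m))) by lra. f_equal; ring. }
  (* The left arc that precedes the time [T * IZR n] belongs to the previous period. *)
  assert (hprev : T2 + (T1 + T * IZR (n - 1)) = T * IZR n) by (rewrite minus_IZR; unfold T; ring).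
  destruct (Req_dec s 0) as [->|hs0]; [|destruct (Rtotal_order s T1) as [hl|[->|hg]]].
  - split.
    + apply (continuous_join _ (fun u => pL (u - (T1 + T * IZR (n - 1)))) (fun u => pR (u - T * IZR n)) _ (Rmin T1 T2)).
      * apply Rmin_glb_lt; assumption.
      * intros u hu. pose proof (Rmin_r T1 T2). apply el. lra.
      * intros u hu. pose proof (Rmin_l T1 T2). apply er. lra.
      * apply cont_shift, cL.
      * apply cont_shift, cR.
    + exists (0 + (T1 + T * IZR (n - 1))), (T1 + T * IZR n). split; [lra|]. right. split.
      * rewrite concat_right by lra. exact x0.
      * exists LeftZone. split; [|exact (arc_right n)].
        replace (0 + T * IZR n) with (T2 + (T1 + T * IZR (n - 1))) by lra. apply arc_left.
  - split.
    + apply (continuous_join _ (fun u => pR (u - T * IZR n)) (fun u => pR (u - T * IZR n)) _ (Rmin s (T1 - s))).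
      * apply Rmin_glb_lt; lra.
      * intros u hu. pose proof (Rmin_l s (T1 - s)). apply er. lra.
      * intros u hu. pose proof (Rmin_r s (T1 - s)). apply er. lra.
      * apply cont_shift, cR.
      * apply cont_shift, cR.
    + exists (0 + T * IZR n), (T1 + T * IZR n). split; [lra|]. left. exists RightZone. apply arc_right.
  - split.
    + apply (continuous_join _ (fun u => pR (u - T * IZR n)) (fun u => pL (u - (T1 + T * IZR n))) _ (Rmin T1 T2)).
      * apply Rmin_glb_lt; assumption.
      * intros u hu. pose proof (Rmin_l T1 T2). apply er. lra.
      * intros u hu. pose proof (Rmin_r T1 T2). apply el. lra.
      * apply cont_shift, cR.
      * apply cont_shift, cL.
    + exists (0 + T * IZR n), (T2 + (T1 + T * IZR n)). split; [lra|]. right. split.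
      * rewrite concat_right by lra. exact x1.
      * exists RightZone. split; [apply arc_right|].
        replace (T1 + T * IZR n) with (0 + (T1 + T * IZR n)) at 1 by ring. apply arc_left.
  - unfold T in hs. fold T in hs. split.
    + apply (continuous_join _ (fun u => pL (u - (T1 + T * IZR n))) (fun u => pL (u - (T1 + T * IZR n))) _
        (Rmin (s - T1) (T - s))).
      * apply Rmin_glb_lt; lra.
      * intros u hu. pose proof (Rmin_l (s - T1) (T - s)). apply el. unfold T in *; lra.
      * intros u hu. pose proof (Rmin_r (s - T1) (T - s)). apply el. unfold T in *; lra.
      * apply cont_shift, cL.
      * apply cont_shift, cL.
    + exists (0 + (T1 + T * IZR n)), (T2 + (T1 + T * IZR n)). split; [unfold T in *; lra|].
      left. exists LeftZone. apply arc_left.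
Qed.

Lemma concat_periodic t : concat (t + (T1 + T2)) = concat t.
Proof.
  fold T. destruct (decompose t) as [n [s [hs ->]]].
  replace (s + T * IZR n + T) with (s + T * IZR (n + 1)) by (rewrite plus_IZR; ring).
  now rewrite !concat_eq.
Qed.

Lemma concat_start : concat 0 = pR 0.
Proof. replace 0 with (0 + T * IZR 0) at 1 by (simpl; ring). apply concat_right; lra. Qed.

Lemma concat_middle : concat T1 = pR T1.
Proof. replace T1 with (T1 + T * IZR 0) at 1 by (simpl; ring). apply concat_right; lra. Qed.

Lemma concat_image t : (exists s, 0 <= s <= T1 /\ concat t = pR s) \/ (exists s, 0 <= s <= T2 /\ concat t = pL s).
Proof.
  destruct (decompose t) as [n [s [hs ->]]]. rewrite concat_eq by exact hs.
  destruct (Rlt_dec s T1).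
  - left. exists s. split; [lra | reflexivity].
  - right. exists (s - T1). unfold T in hs. split; [lra | reflexivity].
Qed.

End Concatenate.


(** * The closed curve is a limit cycle *)

Section LimitCycle.
Variables (SS : switching_system) (sx sy w : R) (sd : zone -> side) (h r0 rate : R) (orb : zone -> R -> R).
Hypotheses (hsx : 0 < sx) (hsy : 0 < sy) (hw : 0 < w) (had : adapted SS sx sy w sd).
Hypotheses (hwf : forall z, admissible (sd z)) (hsize : forall z, size (sd z) h) (hsmall : h * (100 * bigK) <= 1).
Hypothesis hR : forall z, half_orbit (sd z) r0 (orb z).
Hypothesis hr0 : 3 / 4 <= r0 <= 21 / 4.
Hypothesis hmatch : orb RightZone (-1) = orb LeftZone (-1).
Hypothesis hkk : rate <> 0.
Hypothesis hbal : exponent sd rate orb RightZone (-1) = exponent sd rate orb LeftZone (-1).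

Let V := level sx sy sd h rate orb.
Let et := width h rate.

Let range z c : -1 <= c <= 1 -> 73 / 100 <= orb z c <= 527 / 100.
Proof. exact (orb_range sd h r0 orb hwf hsize hsmall hR hr0 z c). Qed.

Lemma on_curve z p c : 0 <= zsign z * fst p -> -1 <= c <= 1 ->
  ysc sy p = orb z c * c -> ampl (sd z) (xabs sx p) = orb z c * sine c -> V p = 0.
Proof.
  intros hz hc hy hU. pose proof (range z c hc) as hr.
  assert (hrad : radius sx sy (sd z) p = orb z c).
  { unfold radius. rewrite hy, hU.
    replace ((orb z c * c) ^ 2 + (orb z c * sine c) ^ 2) with (Rsqr (orb z c)).
    - apply sqrt_Rsqr; lra.
    - unfold Rsqr. replace ((orb z c * sine c) ^ 2) with (orb z c ^ 2 * (sine c * sine c)) by ring.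
      unfold sine. rewrite sqrt_sqrt by nra. ring. }
  assert (hcos : cosine sx sy (sd z) p = c).
  { unfold cosine. rewrite hrad, hy, Rmax_right by lra. field; lra. }
  unfold V. rewrite (level_zone sx sy sd h r0 rate orb hwf hsize hsmall hR hr0 hmatch hkk hbal z p hz).
  unfold level_in, offset. rewrite hcos, hrad, Rminus_diag, Rmult_0_l.
  apply Rmax_right. pose proof (width_pos h rate hkk). lra.
Qed.

Lemma drag_0 S : drag S 0 = c0 S.
Proof. unfold drag; ring. Qed.

(** On the switching line both horizontal components are close to Y. *)
Lemma crossing_far y : / 2 <= Rabs y -> crossing_point SS (0, sy * y).
Proof.
  intros hy. split; [reflexivity|].
  change (right_field SS) with (field SS RightZone). change (left_field SS) with (field SS LeftZone).
  rewrite (had RightZone), (had LeftZone) by (simpl; lra). simpl.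
  replace (1 * 0 / sx) with 0 by (field; lra). replace (-1 * 0 / sx) with 0 by (field; lra).
  rewrite !drag_0. replace (sy * y / sy) with y by (field; lra).
  destruct (hsize RightZone) as [h1 _]; destruct (hsize LeftZone) as [h2 _].
  apply Rabs_le_between in h1; apply Rabs_le_between in h2. unfold bigK in hsmall.
  assert (0 < sx * w) by now apply Rmult_lt_0_compat.
  replace (sx * w * (y - c0 (sd RightZone)) * (sx * w * (y - c0 (sd LeftZone))))
    with ((sx * w) * (sx * w) * ((y - c0 (sd RightZone)) * (y - c0 (sd LeftZone)))) by ring.
  apply Rmult_lt_0_compat; [now apply Rmult_lt_0_compat|].
  unfold Rabs in hy; destruct (Rcase_abs y); nra.
Qed.

Lemma continuous_pair (f g : R -> R) t : continuous f t -> continuous g t -> continuous (fun s => (f s, g s)) t.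
Proof.
  intros hf hg P [e he].
  assert (h1 : locally t (fun s => ball (f t) e (f s))) by exact (hf _ (locally_ball (f t) e)).
  assert (h2 : locally t (fun s => ball (g t) e (g s))) by exact (hg _ (locally_ball (g t) e)).
  pose proof (filter_and _ _ h1 h2) as h3. apply filter_imp with (2 := h3).
  intros s [p1 p2]. apply he. split; assumption.
Qed.

Lemma periodic_motion : exists gam T, 0 < T /\ solution SS gam /\
  (forall t, gam (t + T) = gam t) /\ (exists t, gam t <> gam 0) /\
  (forall t, V (gam t) = 0) /\ gam 0 = (0, sy * r0).
Proof.
  destruct (half_path (sd RightZone) h r0 w (orb RightZone) (hwf _) (hsize _) hsmall (hR _) hr0 hw)
    as [Xp [Yp [T1 [hT1 [cXp [cYp [dp [Xp0 [Yp0 [XpT [YpT ip]]]]]]]]]]].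
  destruct (half_path (sd LeftZone) h r0 w (orb LeftZone) (hwf _) (hsize _) hsmall (hR _) hr0 hw)
    as [Xm [Ym [T2 [hT2 [cXm [cYm [dm [Xm0 [Ym0 [XmT [YmT im]]]]]]]]]]].
  assert (h1 : forall z, orb z 1 = r0) by (intros z; exact (half_orbit_start _ _ _ (hR z))).
  rewrite h1 in Yp0, Ym0.
  set (pR := fun t => (sx * Xp t, sy * Yp t)).
  set (pL := fun t => (- sx * Xm (T2 - t), sy * Ym (T2 - t))).
  assert (cR : forall t, continuous pR t).
  { intros t. apply continuous_pair; apply (cont_mult _ (fun _ => _)); try apply cont_const; auto. }
  assert (cmin : forall t, continuous (fun t => T2 - t) t).
  { intros t. apply (cont_minus _ (fun _ => T2) (fun t => t)); [apply cont_const | apply cont_id]. }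
  assert (cL : forall t, continuous pL t).
  { intros t. apply continuous_pair; apply (cont_mult _ (fun _ => _)); try apply cont_const.
    - apply (cont_comp _ Xm (fun t => T2 - t)); auto.
    - apply (cont_comp _ Ym (fun t => T2 - t)); auto. }
  assert (aR : orbit_arc SS RightZone pR 0 T1).
  { intros t ht. destruct (dp t ht) as [hx [dX dY]]. unfold pR.
    assert (hxp : 0 < sx * Xp t) by now apply Rmult_lt_0_compat.
    split; [simpl; lra|]. rewrite (had RightZone) by (simpl; lra). simpl.
    replace (1 * (sx * Xp t) / sx) with (Xp t) by (field; lra).
    replace (sy * Yp t / sy) with (Yp t) by (field; lra). split.
    - apply (is_derive_eq _ _ (sx * (w * (Yp t - drag (sd RightZone) (Xp t))))); [|ring].
      exact (is_derive_scal Xp t sx _ dX).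
    - apply (is_derive_eq _ _ (sy * (- (w * force (sd RightZone) (Xp t))))); [|ring].
      exact (is_derive_scal Yp t sy _ dY). }
  assert (aL : orbit_arc SS LeftZone pL 0 T2).
  { intros t ht. destruct (dm (T2 - t) ltac:(lra)) as [hx [dX dY]]. unfold pL.
    assert (hxp : 0 < sx * Xm (T2 - t)) by now apply Rmult_lt_0_compat.
    assert (hd : is_derive (fun s => T2 - s) t (-1)) by (auto_derive; [trivial | ring]).
    split; [simpl; lra|]. rewrite (had LeftZone) by (simpl; lra). simpl.
    replace (-1 * (- sx * Xm (T2 - t)) / sx) with (Xm (T2 - t)) by (field; lra).
    replace (sy * Ym (T2 - t) / sy) with (Ym (T2 - t)) by (field; lra). split.
    - apply (is_derive_eq _ _ (- sx * (-1 * (w * (Ym (T2 - t) - drag (sd LeftZone) (Xm (T2 - t))))))); [|ring].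
      apply (is_derive_scal (fun s => Xm (T2 - s)) t (- sx)).
      exact (derive_comp Xm (fun s => T2 - s) t _ _ dX hd).
    - apply (is_derive_eq _ _ (sy * (-1 * (- (w * force (sd LeftZone) (Xm (T2 - t))))))); [|ring].
      apply (is_derive_scal (fun s => Ym (T2 - s)) t sy).
      exact (derive_comp Ym (fun s => T2 - s) t _ _ dY hd). }
  assert (pR0 : pR 0 = (0, sy * r0)) by (unfold pR; rewrite Xp0, Yp0; f_equal; ring).
  assert (pRT : pR T1 = (0, sy * - orb RightZone (-1))) by (unfold pR; rewrite XpT, YpT; f_equal; ring).
  assert (j1 : pR T1 = pL 0).
  { rewrite pRT. unfold pL. rewrite Rminus_0_r, XmT, YmT, hmatch. f_equal; ring. }
  assert (j2 : pL T2 = pR 0).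
  { rewrite pR0. unfold pL. rewrite Rminus_diag, Xm0, Ym0. f_equal; ring. }
  pose proof (range RightZone (-1) ltac:(lra)) as hrm.
  assert (x0 : crossing_point SS (pR 0)).
  { rewrite pR0. apply crossing_far. rewrite Rabs_pos_eq; lra. }
  assert (x1 : crossing_point SS (pR T1)).
  { rewrite pRT. apply crossing_far. rewrite Rabs_Ropp, Rabs_pos_eq; lra. }
  exists (concat pR pL T1 T2), (T1 + T2). split; [lra|].
  split; [now apply concat_solution|]. split; [now apply concat_periodic|].
  pose proof (concat_start pR pL T1 T2 hT1 hT2 j1) as e0.
  split; [|split].
  - exists T1. rewrite e0, (concat_middle pR pL T1 T2 hT1 hT2 j1), pR0, pRT. intros e.
    injection e as e. nra.
  - intros t. destruct (concat_image pR pL T1 T2 hT1 hT2 t) as [[s [hs ->]]|[s [hs ->]]].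
    + destruct (ip s hs) as [hX [c [hc [hy hU]]]]. apply (on_curve RightZone _ c); unfold pR, ysc, xabs; simpl.
      * rewrite Rmult_1_l. apply Rmult_le_pos; lra.
      * exact hc.
      * rewrite <- hy. field; lra.
      * rewrite <- hU. f_equal. rewrite Rabs_pos_eq by (apply Rmult_le_pos; lra). field; lra.
    + destruct (im (T2 - s) ltac:(lra)) as [hX [c [hc [hy hU]]]].
      assert (0 <= sx * Xm (T2 - s)) by (apply Rmult_le_pos; lra).
      apply (on_curve LeftZone _ c); unfold pL, ysc, xabs; simpl.
      * lra.
      * exact hc.
      * rewrite <- hy. field; lra.
      * rewrite <- hU. f_equal. rewrite Rabs_left1 by lra. field; lra.
  - now rewrite e0.
Qed.

Let cont_V p : continuous V p.
Proof. apply (cont_level sx sy sd h r0 rate orb hsx hsy hwf hsize hsmall hR hr0 hmatch hkk hbal). Qed.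

Lemma covered gam T : 0 < T -> solution SS gam -> (forall t, gam (t + T) = gam t) ->
  (forall t, V (gam t) = 0) -> forall p, V p = 0 <-> exists t, gam t = p.
Proof.
  intros hT hsol hper hC p. split.
  - intros hp.
    exact (curve_covered SS sx sy w sd h r0 rate orb hsx hsy hw had hwf hsize hsmall hR hr0 hmatch hkk hbal
      gam T hT hsol hper hC p hp).
  - intros [t <-]. apply hC.
Qed.

Lemma curve_limit_cycle : limit_cycle SS (fun p => V p = 0).
Proof.
  split.
  - destruct periodic_motion as [gam [T [hT [hsol [hper [hnc [hC _]]]]]]].
    exists gam, T. split; [exact hT|]. split; [exact hsol|]. split; [exact hper|]. split; [exact hnc|].
    now apply (covered gam T).
  - exists (fun p => 0 < et - Rabs (V p)). split; [|split].
    + intros p hp. assert (hc : continuous (fun p => et - Rabs (V p)) p).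
      { apply (cont_minus _ (fun _ => et)); [apply cont_const | apply cont_abs, cont_V]. }
      exact (hc _ (locally_pos _ hp)).
    + intros p ->. rewrite Rabs_R0. pose proof (width_pos h rate hkk). unfold et. lra.
    + intros H [gam [T [hT [hsol [hper [_ hH]]]]]] [p [hp hV]].
      destruct (proj1 (hH p) hp) as [t0 <-].
      assert (hC : forall t, V (gam t) = 0).
      { apply (level_zero_everywhere SS sx sy w sd h r0 rate orb hsx hsy hw had hwf hsize hsmall hR hr0 hmatch hkk hbal
          gam T hT hsol hper t0). fold V et. lra. }
      intros q. rewrite hH. symmetry. now apply (covered gam T).
Qed.

Lemma curve_bounds p : V p = 0 -> Rabs (fst p) <= 6 * sx /\ Rabs (snd p) <= 6 * sy.
Proof.
  intros hp.
  assert (hz : exists z, 0 <= zsign z * fst p).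
  { destruct (Rle_lt_dec 0 (fst p)); [exists RightZone | exists LeftZone]; simpl; lra. }
  destruct hz as [z hz].
  destruct (curve_point sx sy sd h r0 rate orb hwf hsize hsmall hR hr0 hmatch hkk hbal z p hp hz) as [_ hr].
  pose proof (xabs_chi sx sy hsx (sd z) p (hwf z) ltac:(lra)) as hx.
  pose proof (arg_range (cosine sx sy (sd z) p) (radius sx sy (sd z) p) ltac:(lra)) as ha.
  pose proof (chi_range (sd z) (hwf z) _ ha) as hc. rewrite hx in hc.
  pose proof (ysc_le_radius sx sy (sd z) p) as hy. unfold xabs in hc. unfold ysc in hy.
  split.
  - apply Rmult_le_reg_r with (/ sx); [now apply Rinv_0_lt_compat|].
    replace (6 * sx * / sx) with 6 by (field; lra). apply hc.
  - apply Rmult_le_reg_r with (/ sy); [now apply Rinv_0_lt_compat|].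
    replace (6 * sy * / sy) with 6 by (field; lra).
    unfold Rdiv in hy. rewrite Rabs_mult, (Rabs_pos_eq (/ sy)) in hy by (apply Rlt_le, Rinv_0_lt_compat; lra). lra.
Qed.

Lemma curve_top : V (0, sy * r0) = 0.
Proof. destruct periodic_motion as [gam [T [_ [_ [_ [_ [hC <-]]]]]]]. apply hC. Qed.

Lemma curve_top_unique y : 0 < y -> V (0, sy * y) = 0 -> y = r0.
Proof.
  intros hy hp.
  destruct (curve_point sx sy sd h r0 rate orb hwf hsize hsmall hR hr0 hmatch hkk hbal RightZone _ hp
    ltac:(simpl; lra)) as [he hr].
  assert (hys : ysc sy (0, sy * y) = y) by (unfold ysc; simpl; field; lra).
  rewrite radius_axis in he, hr by reflexivity. rewrite hys in he, hr.
  rewrite Rabs_pos_eq in he, hr by lra.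
  destruct (cosine_axis sx sy (sd RightZone) (0, sy * y) eq_refl) as [[_ e]|[e _]].
  - rewrite hys, Rabs_pos_eq; lra.
  - rewrite e in he. rewrite he. exact (half_orbit_start _ _ _ (hR RightZone)).
  - rewrite hys in e. lra.
Qed.

End LimitCycle.

Definition by_zone {A : Type} (a b : A) (z : zone) : A :=
  match z with RightZone => a | LeftZone => b end.

(** [rate] is a quarter of the difference of the total exponents, so that the
    shifts by it on the two sides balance over an interval of length 2. *)
Theorem limit_cycle_of_zero SS sx sy w Sp Sm h i :
  0 < sx -> 0 < sy -> 0 < w -> adapted SS sx sy w (by_zone Sp Sm) ->
  admissible Sp -> admissible Sm -> size Sp h -> size Sm h -> h * (100 * bigK) <= 1 ->
  1 <= i <= 5 -> zero_near Sp Sm i ->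
  exists G : R * R -> Prop, limit_cycle SS G /\
    (forall p, G p -> Rabs (fst p) <= 6 * sx /\ Rabs (snd p) <= 6 * sy) /\
    exists r0, i - / 100 <= r0 <= i + / 100 /\ G (0, sy * r0) /\
      forall y, 0 < y -> G (0, sy * y) -> y = r0.
Proof.
  intros hsx hsy hw had wp wm zp zm hsm hi [r0 [rp [rm [hr0 [hp [hm [hmatch hne]]]]]]].
  set (sd := by_zone Sp Sm). set (orb := by_zone rp rm).
  set (rate := (RInt (fun c => slope_r' Sm c (rm c)) 1 (-1) - RInt (fun c => slope_r' Sp c (rp c)) 1 (-1)) / 4).
  assert (hkk : rate <> 0) by (unfold rate; intros e; apply hne; simpl in *; lra).
  assert (hwf : forall z, admissible (sd z)) by (intros []; assumption).
  assert (hsize : forall z, size (sd z) h) by (intros []; assumption).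
  assert (hR : forall z, half_orbit (sd z) r0 (orb z)) by (intros []; assumption).
  assert (hL : forall z, exponent sd rate orb z (-1) =
     RInt (fun c => slope_r' (sd z) c (orb z c)) 1 (-1) + 2 * (zsign z * rate)).
  { intros z. unfold exponent, exponent_density.
    assert (hc : forall x, continuous (fun c => slope_r' (sd z) c (orb z c)) x).
    { apply (cont_slope_r' (sd z) h (hwf z) (hsize z) hsm). apply hR. }
    rewrite <- (RInt_sub (fun c => slope_r' (sd z) c (orb z c)) (fun _ => zsign z * rate));
      [|exact hc | intros; apply cont_const].
    rewrite RInt_const. unfold scal; simpl; unfold mult; simpl. ring. }
  assert (hbal : exponent sd rate orb RightZone (-1) = exponent sd rate orb LeftZone (-1)).
  { rewrite !hL. simpl. unfold rate. field. }
  assert (hr0' : 3 / 4 <= r0 <= 21 / 4) by lra.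
  exists (fun p => level sx sy sd h rate orb p = 0). split; [|split].
  - now apply (curve_limit_cycle SS sx sy w sd h r0 rate orb).
  - now apply (curve_bounds sx sy sd h r0 rate orb).
  - exists r0. split; [exact hr0|]. split.
    + now apply (curve_top SS sx sy w sd h r0 rate orb).
    + now apply (curve_top_unique sx sy sd h r0 rate orb).
Qed.


(** * The perturbed family *)

(** The shared drag comes from a_3 and p_22, of order eps^3 after scaling; the
    constant dd, the linear coefficient de and the p2, p3 of the right side have
    order eps^6; the -1 is the coefficient that adds the cubic force on the right. *)
Lemma family_adapted al be de p2 p3 dd k eps : 0 < eps ->
  adapted
    (SwitchingSystem
       (perturbed_field 0 be k 0 0
          (fun n => match n with 6%nat => de | _ => 0 end)
          (fun n => match n with 2%nat => - al | 5%nat => p2 | _ => 0 end)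
          (fun n => match n with 3%nat => p3 | _ => 0 end)
          (fun _ => 0)
          (fun n => match n with 1%nat => -1 | _ => 0 end) eps)
       (perturbed_field 0 (- be) (- k) 0 (dd * eps ^ 9)
          (fun n => match n with 6%nat => de | _ => 0 end)
          (fun n => match n with 2%nat => - al | _ => 0 end)
          (fun _ => 0) (fun _ => 0) (fun _ => 0) eps))
    (eps ^ 2) (eps ^ 3) eps
    (by_zone (right_side al be de p2 p3 k (eps ^ 3)) (left_side al be de dd k (eps ^ 3))).
Proof.
  intros he z x y hx.
  assert (he2 : 0 < eps ^ 2) by now apply pow_lt.
  assert (hX : 0 <= zsign z * x / eps ^ 2) by now apply Rdiv_le_0_compat.
  destruct z; unfold force, stiffness; rewrite (Rabs_pos_eq (_ / _)) by exact hX; clear hX;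
    unfold field, right_field, left_field, perturbed_field, drag, by_zone, right_side, left_side, sum_f;
    cbn [zsign quad cub c0 c1 c2 c3 sum_f_R0 Nat.sub Nat.add pow]; f_equal; field; lra.
Qed.

Theorem theorem1p3 :
  exists a2p a2m a3p a3m b2p b2m b3p b3m : R,
    (a2m = a2p /\ a3m = - a3p /\ b2m = - b2p /\ - b2p < 0 /\ b3m = b3p) /\
    exists (d : R) (delta p2p p2m p3p p3m q2p q2m q3p q3m : nat -> R),
      forall U : R * R -> Prop, locally (0, 0) U ->
        exists eps0 : R, 0 < eps0 /\
          forall eps : R, 0 < eps < eps0 ->
            at_least_limit_cycles_in 5
              (SwitchingSystem
                 (perturbed_field a2p a3p b2p b3p 0
                    delta p2p p3p q2p q3p eps)
                 (perturbed_field a2m a3m b2m b3m (d * eps ^ 9)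
                    delta p2m p3m q2m q3m eps))
              U.
Proof.
  destruct five_zeros as [al [be [de [p2 [p3 [dd [k [hk [m0 [hm0 hz]]]]]]]]]].
  exists 0, 0, be, (- be), k, (- k), 0, 0. split; [repeat split; lra|].
  exists dd, (fun n => match n with 6%nat => de | _ => 0 end),
    (fun n => match n with 2%nat => - al | 5%nat => p2 | _ => 0 end),
    (fun n => match n with 2%nat => - al | _ => 0 end),
    (fun n => match n with 3%nat => p3 | _ => 0 end), (fun _ => 0),
    (fun _ => 0), (fun _ => 0), (fun n => match n with 1%nat => -1 | _ => 0 end), (fun _ => 0).
  intros U [del hdel].
  pose proof (cond_pos del) as hdp.
  exists (Rmin 1 (Rmin m0 (del / 7))).
  split; [repeat apply Rmin_glb_lt; lra|]. intros eps heps.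
  assert (h1 : 0 < eps < 1 /\ eps < m0 /\ eps < del / 7).
  { pose proof (Rmin_l 1 (Rmin m0 (del / 7))); pose proof (Rmin_r 1 (Rmin m0 (del / 7))).
    pose proof (Rmin_l m0 (del / 7)); pose proof (Rmin_r m0 (del / 7)). lra. }
  assert (h2 : 0 < eps ^ 2 <= eps) by (split; [apply pow_lt|]; nra).
  assert (h3 : 0 < eps ^ 3 <= eps).
  { split; [apply pow_lt; lra|]. replace (eps ^ 3) with (eps ^ 2 * eps) by ring. nra. }
  destruct (hz (eps ^ 3) ltac:(lra)) as [hmk [h [hsm [zp [zm hzero]]]]].
  assert (hdom : param_dom k (eps ^ 3) 0) by (unfold param_dom; lra).
  pose proof (family_adapted al be de p2 p3 dd k eps ltac:(lra)) as had.
  match type of had with adapted ?SS _ _ _ _ => set (sys := SS) in * end.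
  assert (hG : forall i, (i < 5)%nat -> exists G : R * R -> Prop, limit_cycle sys G /\
    (forall p, G p -> Rabs (fst p) <= 6 * eps ^ 2 /\ Rabs (snd p) <= 6 * eps ^ 3) /\
    exists r0, INR i + 1 - / 100 <= r0 <= INR i + 1 + / 100 /\ G (0, eps ^ 3 * r0) /\
      forall y, 0 < y -> G (0, eps ^ 3 * y) -> y = r0).
  { intros i hi.
    apply (limit_cycle_of_zero sys (eps ^ 2) (eps ^ 3) eps
      (right_side al be de p2 p3 k (eps ^ 3)) (left_side al be de dd k (eps ^ 3)) h); try assumption; try lra.
    - exact (right_admissible al be de p2 p3 k (eps ^ 3) 0 hdom).
    - exact (left_admissible al be de dd k (eps ^ 3) 0 hdom).
    - pose proof (pos_INR i). assert (INR i <= INR 4) by (apply le_INR; lia). simpl in H0. lra.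
    - now apply hzero. }
  set (G := fun i : nat => match lt_dec i 5 with
    | left hi => proj1_sig (constructive_indefinite_description _ (hG i hi))
    | right _ => fun _ => False end).
  assert (hGi : forall i, (i < 5)%nat -> limit_cycle sys (G i) /\
    (forall p, G i p -> Rabs (fst p) <= 6 * eps ^ 2 /\ Rabs (snd p) <= 6 * eps ^ 3) /\
    exists r0, INR i + 1 - / 100 <= r0 <= INR i + 1 + / 100 /\ G i (0, eps ^ 3 * r0) /\
      forall y, 0 < y -> G i (0, eps ^ 3 * y) -> y = r0).
  { intros i hi. unfold G. destruct (lt_dec i 5) as [hi'|]; [|contradiction].
    exact (proj2_sig (constructive_indefinite_description _ (hG i hi'))). }
  exists G. split.
  - intros i hi. destruct (hGi i hi) as [hl [hb _]]. split; [exact hl|].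
    intros p hp. destruct (hb p hp) as [b1 b2]. apply hdel.
    split; unfold ball; simpl; unfold AbsRing_ball, abs, minus, plus, opp; simpl;
      rewrite Ropp_0, Rplus_0_r; lra.
  - intros i j hij he.
    destruct (hGi i ltac:(lia)) as [_ [_ [ri [hri [_ hui]]]]].
    destruct (hGi j ltac:(lia)) as [_ [_ [rj [hrj [hGj _]]]]].
    apply he in hGj. pose proof (pos_INR j).
    specialize (hui rj ltac:(lra) hGj).
    assert (INR i + 1 <= INR j) by (rewrite <- S_INR; apply le_INR; lia). lra.
Qed.
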